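(* Let $f\in\Lambda^*$. Then the $q$-bracket $\langle f\rangle_q$ is modular, i.e. $\langle f\rangle_q\in\mathbb{Q}[Q,R]$, if and only if $f=h+k$ with $h\in\mathcal{H}$ and $k\in\ker\langle\cdot\rangle_q$ (that is, $\langle k\rangle_q=0$).
   Context: Partitions are identified with non-increasing sequences $\lambda=(\lambda_1,\lambda_2,\ldots)$ of non-negative integers that are eventually $0$; $\mathscr{P}$ is the set of partitions and $|\lambda|=\sum_i\lambda_i$. More generally, let $\mathcal{S}$ be the set of non-increasing, eventually constant sequences of integers. For $\lambda\in\mathcal{S}$ with eventual value $n$, define $Q_k(\lambda)\in\mathbb{Q}$ ($k\ge 0$) by the Laurent expansion at $z=0$ $$\sum_{k\ge0}Q_k(\lambda)z^{k-1}=e^{nz}\Big(\frac{1}{e^{z/2}-e^{-z/2}}+\sum_{i\ge1}\big(e^{z(\lambda_i-n-i+1/2)}-e^{z(-i+1/2)}\big)\Big)$$ (a finite sum; formally this is $\sum_{i\ge1}e^{z(\lambda_i-i+1/2)}$). Then $Q_0=1$, $Q_1(\lambda)=n$, and $Q_2(\lambda)=|\lambda|-\tfrac1{24}$ for partitions. The algebra of shifted symmetric polynomials is $\Lambda^*=\mathbb{Q}[Q_2,Q_3,\ldots]$, viewed as functions on partitions (where $Q_1=0$), and $\mathcal{R}=\Lambda^*[Q_1]=\mathbb{Q}[Q_1,Q_2,\ldots]$, viewed as functions on $\mathcal{S}$; the $Q_i$ ($i\ge1$) are algebraically independent. Both are graded by weight, $Q_i$ having weight $i$; a subscript $n$ denotes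 the weight-$n$ component. Regarding elements of $\mathcal{R}$ as polynomials in the variables $Q_1,Q_2,\ldots$ with $Q_0:=1$, define the differential operators $\boldsymbol{\partial}=\sum_{m\ge0}Q_m\frac{\partial}{\partial Q_{m+1}}$, $\mathscr{D}=\sum_{k,\ell\ge0}\binom{k+\ell}{k}Q_{k+\ell}\frac{\partial^2}{\partial Q_{k+1}\partial Q_{\ell+1}}$ and $\Delta=\tfrac12(\mathscr{D}-\boldsymbol{\partial}^2)$. The space of shifted symmetric harmonic polynomials is $\mathcal{H}=\{f\in\Lambda^*:\Delta f\in Q_1\mathcal{R}\}$. For $f:\mathscr{P}\to\mathbb{Q}$ the $q$-bracket is the formal power series $\langle f\rangle_q=\frac{\sum_{\lambda\in\mathscr{P}}f(\lambda)q^{|\lambda|}}{\sum_{\lambda\in\mathscr{P}}q^{|\lambda|}}$. Let $P=1-24\sum_{n\ge1}\sigma_1(n)q^n$, $Q=1+240\sum_{n\ge1}\sigma_3(n)q^n$, $R=1-504\sum_{n\ge1}\sigma_5(n)q^n$ be the Eisenstein series of weights $2,4,6$ (not to be confused with the $Q_k$). The algebra of quasimodular forms is $\widetilde{M}=\mathbb{Q}[P,Q,R]$ and the modular forms are $\mathbb{Q}[Q,R]$. (By the Bloch–Okounkov theorem, $\langle f\rangle_q\in\widetilde{M}$ for all $f\in\Lambda^*$.) *)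

(* Defs.v *)
From HB Require Import structures.
From mathcomp Require Import all_boot all_order all_algebra.
From mathcomp Require Import finmap.
From mathcomp Require Import monalg.

Set Implicit Arguments.
Unset Strict Implicit.
Unset Printing Implicit Defensive.

Import Order.TTheory GRing.Theory Num.Theory.
Local Open Scope ring_scope.

(* A formal power series over rat is its sequence of coefficients; equality of
   series is pointwise equality =1. *)
Definition fps := nat -> rat.

Definition fps_mul (a b : fps) : fps :=
  fun n => \sum_(i < n.+1) a i * b (n - i)%N.

Definition fps_pow (a : fps) (m : nat) : fps :=
  iter m (fps_mul a) (fun n => (n == 0%N)%:R).

(* The coefficients of degree 0, ..., n of the multiplicative inverse of a. *)
Fixpoint fps_inv_coefs (a : fps) (n : nat) : seq rat :=
  if n is m.+1 then
    let s := fps_inv_coefs a m in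
    rcons s (- (a 0%N)^-1 * \sum_(i < m.+1) a (m.+1 - i)%N * s`_i)
  else [:: (a 0%N)^-1].

Definition fps_inv (a : fps) : fps := fun n => (fps_inv_coefs a n)`_n.

Lemma size_fps_inv_coefs a n : size (fps_inv_coefs a n) = n.+1.
Proof. by elim: n => //= n IH; rewrite size_rcons IH. Qed.

Lemma nth_fps_inv_coefs a n i :
  (i <= n)%N -> (fps_inv_coefs a n)`_i = fps_inv a i.
Proof.
elim: n => [|n IH]; first by rewrite leqn0 => /eqP->.
rewrite leq_eqVlt ltnS => /predU1P[-> //|le_in].
by rewrite /= nth_rcons size_fps_inv_coefs ltnS le_in IH.
Qed.

Lemma fps_mulV (a : fps) :
  a 0%N != 0 -> fps_mul a (fps_inv a) =1 (fun n => (n == 0%N)%:R).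
Proof.
move=> a0 [|n]; first by rewrite /fps_mul big_ord1 /fps_inv /= mulfV.
rewrite /fps_mul big_ord_recl subn0 /= {1}/fps_inv /=.
rewrite nth_rcons size_fps_inv_coefs ltnn eqxx mulrA mulrN mulfV // mulN1r.
apply/eqP; rewrite addrC subr_eq0; apply/eqP.
rewrite (reindex_inj rev_ord_inj) /=; apply: eq_bigr => i _.
have le_in : (i <= n)%N by rewrite -ltnS.
by rewrite nth_fps_inv_coefs // /bump /= add1n !subSS subKn // subSn.
Qed.

(* exp(c z) *)
Definition fps_exp (c : rat) : fps := fun n => c ^+ n / n`!%:R.

(* Multiplication by the variable. *)
Definition fps_mulX (a : fps) : fps := fun n => if n is m.+1 then a m else 0.

(* The sequences (lambda_1, lambda_2, ...), with lambda_{i+1} stored at index i.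
   ev_bound is not determined by the sequence; see Qfun_ext. *)
Record evseq := EvSeq {
  ev_seq :> nat -> int;
  ev_lim : int;
  ev_bound : nat;
  ev_noninc : forall i, ev_seq i.+1 <= ev_seq i;
  ev_const : forall i, (ev_bound <= i)%N -> ev_seq i = ev_lim
}.

Local Notation half := (2%:R^-1 : rat).

(* z / (exp(z/2) - exp(-z/2)) *)
Definition fps_bernoulli : fps :=
  fps_inv (fun n => fps_exp half n.+1 - fps_exp (- half) n.+1).

(* The defining Laurent series has a simple pole, so it is multiplied through
   by z: Q_k is the coefficient of z^k in z times that series.  The terms with
   index at least ev_bound s vanish. *)
Definition Qfun (k : nat) (s : evseq) : rat :=
  fps_mul (fps_exp (ev_lim s)%:~R)
    (fun m => fps_bernoulli m +
       fps_mulX (fun j => \sum_(i < ev_bound s)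
           (fps_exp ((s i)%:~R - (ev_lim s)%:~R - i.+1%:R + half) j
            - fps_exp (- i.+1%:R + half) j)) m)
    k.

Lemma fps_bernoulli_small :
  [/\ fps_bernoulli 0 = 1, fps_bernoulli 1 = 0 & fps_bernoulli 2 = - 24%:R^-1].
Proof.
by rewrite /fps_bernoulli /fps_inv /= !big_ord_recr !big_ord0 /= /fps_exp;
  split; apply/eqP; vm_compute.
Qed.

Lemma Qfun0 s : Qfun 0 s = 1.
Proof.
have [b0 _ _] := fps_bernoulli_small.
by rewrite /Qfun /fps_mul big_ord1 /= b0 addr0 mulr1 /fps_exp expr0 divr1.
Qed.

Lemma Qfun1 s : Qfun 1 s = (ev_lim s)%:~R.
Proof.
have [b0 b1 _] := fps_bernoulli_small.
rewrite /Qfun /fps_mul big_ord_recr big_ord1 /= b0 b1 /fps_exp /=.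
rewrite big1 => [|i _]; last by rewrite !expr0 subrr.
by rewrite !addr0 mulr0 mulr1 add0r expr1 divr1.
Qed.

Lemma Qfun_ext k (s t : evseq) : s =1 t -> Qfun k s = Qfun k t.
Proof.
move=> st; have lim_st : ev_lim s = ev_lim t.
  rewrite -(ev_const (leq_maxl (ev_bound s) (ev_bound t))) st.
  by rewrite (ev_const (leq_maxr _ _)).
pose F (u : evseq) j i :=
  fps_exp ((u i)%:~R - (ev_lim u)%:~R - i.+1%:R + 2%:R^-1) j
    - fps_exp (- i.+1%:R + 2%:R^-1) j.
have widen (u : evseq) j N : (ev_bound u <= N)%N ->
    \sum_(i < ev_bound u) F u j i = \sum_(i < N) F u j i.
  move=> le_N; rewrite (big_ord_widen _ (F u j) le_N) big_mkcond /=.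
  apply: eq_bigr => i _; case: ltnP => // /ev_const ui.
  by rewrite /F ui subrr add0r subrr.
rewrite /Qfun lim_st; apply: eq_bigr => i _; congr (_ * (_ + _)).
rewrite /fps_mulX; case: (k - i)%N => // j.
rewrite -lim_st (widen s _ _ (leq_maxl _ (ev_bound t))) lim_st.
rewrite (widen t _ _ (leq_maxr (ev_bound s) _)).
by apply: eq_bigr => x _; rewrite /F st lim_st.
Qed.

Definition is_part (l : seq nat) := sorted geq l && (0%N \notin l).

Record ipartition := IPartition { parts_of :> seq nat; _ : is_part parts_of }.

HB.instance Definition _ := [isSub for parts_of].
HB.instance Definition _ := [Choice of ipartition by <:].

Definition psize (l : ipartition) : nat := sumn l.

Lemma partition_noninc (l : ipartition) i :
  (nth 0%N l i.+1)%:Z <= (nth 0%N l i)%:Z.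
Proof.
rewrite lez_nat; case: (ltnP i.+1 (size l)) => [lt_i|/(nth_default 0%N)-> //].
have /andP[sl _] := valP l; have lt_i' := ltnW lt_i.
have geq_tr : transitive geq by move=> a b c ba ac; exact: leq_trans ac ba.
exact: (sorted_leq_nth geq_tr leqnn 0%N sl).
Qed.

Lemma partition_const (l : ipartition) i :
  (size l <= i)%N -> (nth 0%N l i)%:Z = 0.
Proof. by move/(nth_default 0%N)->. Qed.

Definition evseq_of_partition (l : ipartition) : evseq :=
  EvSeq (partition_noninc l) (@partition_const l).

Lemma Qfun2 l : Qfun 2 (evseq_of_partition l) = (psize l)%:R - 24%:R^-1.
Proof.
have [b0 b1 b2] := fps_bernoulli_small.
rewrite /Qfun /fps_mul !big_ord_recr big_ord0 /= b0 b1 b2 /fps_exp /=.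
rewrite !mulr0z !expr0n /= mul0r !mul0r !addr0 add0r !divr1 mul1r addrC.
congr (_ + _); rewrite /psize sumnE (big_nth 0%N) big_mkord natr_sum.
apply: eq_bigr => i _; rewrite !expr1 subr0 !divr1.
by rewrite -[_ - _ + _]addrA addrK.
Qed.

(* The duplicate-free list of the partitions of n: each one is obtained from a
   sequence of n numbers, all at most n, by deleting the zeros. *)
Definition partitions (n : nat) : seq ipartition :=
  undup [seq l <- pmap insub
           [seq [seq x <- map val (val t) | x != 0%N]
              | t : n.-tuple 'I_n.+1]
        | psize l == n].

Lemma partitions_uniq n : uniq (partitions n).
Proof. exact: undup_uniq. Qed.

Lemma mem_partitions n l : (l \in partitions n) = (psize l == n).
Proof.
rewrite mem_undup mem_filter; case: eqP => //= def_n.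
have /andP[_ l0] := valP l; rewrite /= in l0.
have le_sum (s : seq nat) x : x \in s -> (x <= sumn s)%N.
  by move=> xs; rewrite sumnE (big_rem x) //= leq_addr.
have le_size : (size l <= n)%N.
  rewrite -def_n /psize; elim: (l : seq nat) l0 => //= x s IH.
  rewrite inE negb_or eq_sym => /andP[x0 /IH]; rewrite -lt0n in x0.
  by move=> le_s; rewrite -add1n leq_add.
rewrite mem_pmap_sub /=.
pose u := l ++ nseq (n - size l) 0%N.
have sz : size (map (@inord n) u) == n.
  by rewrite size_map size_cat size_nseq subnKC.
apply/mapP; exists (Tuple sz); first exact: mem_enum.
rewrite /=.
rewrite -map_comp map_id_in; last first.
  move=> x; rewrite mem_cat => /orP[xl|/nseqP[-> _]]; last by rewrite /= inordK.
  by rewrite /= inordK // ltnS -def_n le_sum.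
rewrite filter_cat filter_nseq /= cats0 (_ : filter _ _ = l) //.
by apply/all_filterP/allP => x xl; apply: contraNneq l0 => <-.
Qed.

Definition qbracket (f : ipartition -> rat) : fps :=
  fps_mul (fun n => \sum_(l <- partitions n) f l)
          (fps_inv (fun n => \sum_(l <- partitions n) 1)).

(* The polynomial ring rat[Q_1, Q_2, ...]: the variable with index i is
   Q_{i+1}. *)
Notation Rpoly := {malg rat[{cmonom nat}]}.

Definition Qvar (k : nat) : Rpoly := if k is i.+1 then << ucm i >> else 1.

Definition evalR (p : Rpoly) (s : evseq) : rat :=
  mmap idfun (fun m : {cmonom nat} =>
    \prod_(i <- finsupp (cmonom_val m)) Qfun i.+1 s ^+ m i) p.

Definition pfun (p : Rpoly) (l : ipartition) : rat :=
  evalR p (evseq_of_partition l).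

(* d / d Q_{i+1} *)
Definition pderiv (i : nat) (p : Rpoly) : Rpoly :=
  \sum_(m <- msupp p) << p@_m *+ m i *g divcm m (ucm i) >>.

(* Only Q_1, ..., Q_{nvars p} can occur in p, so the infinite sums below are
   truncated without changing their value. *)
Definition nvars (p : Rpoly) : nat :=
  \max_(m <- msupp p) \max_(i <- finsupp (cmonom_val m)) i.+1.

Lemma nvars_cmonom p (m : {cmonom nat}) i :
  m \in msupp p -> (nvars p <= i)%N -> m i = 0%N.
Proof.
move=> mp le_i; apply/eqP; rewrite cmE_eq0; apply/negP => im.
have lt_i : (i < nvars p)%N.
  rewrite /nvars (big_rem m) //= leq_max; apply/orP; left.
  by rewrite (big_rem i) //= leq_max leqnn.
by rewrite ltnNge le_i in lt_i.
Qed.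

Lemma pderiv_nvars i p : (nvars p <= i)%N -> pderiv i p = 0.
Proof.
move=> le_i; rewrite /pderiv big_seq big1 // => m mp.
by rewrite (nvars_cmonom mp le_i) mulr0n monalgU0.
Qed.

Definition bdel (p : Rpoly) : Rpoly :=
  \sum_(m < nvars p) Qvar m * pderiv m p.

Definition scrD (p : Rpoly) : Rpoly :=
  \sum_(k < nvars p) \sum_(l < nvars p)
    'C(k + l, k)%:R *: (Qvar (k + l) * pderiv k (pderiv l p)).

Definition Delta (p : Rpoly) : Rpoly := half *: (scrD p - bdel (bdel p)).

(* Q_1 does not occur in p. *)
Definition in_Lambda_star (p : Rpoly) : Prop :=
  forall m : {cmonom nat}, m \in msupp p -> m 0%N = 0%N.

Definition harmonic (p : Rpoly) : Prop :=
  in_Lambda_star p /\ exists g : Rpoly, Delta p = Qvar 1 * g.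

Definition sigma (k n : nat) : nat := \sum_(d <- divisors n) d ^ k.

Definition E4 : fps :=
  fun n => if n is 0%N then 1 else 240%:R * (sigma 3 n)%:R.

Definition E6 : fps :=
  fun n => if n is 0%N then 1 else - (504%:R * (sigma 5 n)%:R).

Definition modular (g : fps) : Prop :=
  exists (N : nat) (c : 'M[rat]_N),
    g =1 fun n => \sum_(i < N) \sum_(j < N)
                    c i j * fps_mul (fps_pow E4 i) (fps_pow E6 j) n.

(* Main.v *)
(* The Bloch-Okounkov identity comes from toggling one element in the beta sets
   that encode partitions of charge c: for f in Lambda* it gives
     sum_k ev(S_k) <bdel^(2k+1) f>_q / (12^k (2k+1)!) = 0,
   where the S_k are the normalised Taylor coefficients of a theta function, so
   they lie in rat[P, Q, R] and satisfy dS_k/dP = k (2k+1) S_(k-1).  Since bdel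
   is onto Lambda* modulo Q_1, induction on the weight shows that <f>_q is the
   value of a polynomial a with 12 da/dP having value <Delta f>_q.  As P, Q, R
   are algebraically independent, <f>_q is modular iff <Delta f>_q = 0.

   Independence: Q^3 - R^2 = 1728 q / p^24, with p the generating series of
   partitions, decays faster than any power of 1 - r as q = r tends to 1, while a
   nonzero polynomial in Q stays away from 0; this forces every relation between
   Q and R to be divisible by Q^3 - R^2, and descent applies.  A relation of
   minimal degree d in P is reduced to d = 1 with the derivations D, d/dP and the
   weight, and d = 1 is excluded by restricting to the cuspidal curve Q^3 = R^2.

   Finally Delta, multiplication by Q_2 and the weight minus 1/2 form an
   sl2-triple modulo Q_1 that preserves the kernel of the bracket.  The weights
   w - 1/2 are never integers, so Delta is onto on this kernel: for f with
   <Delta f>_q = 0 there is k in the kernel with Delta k = Delta f modulo Q_1,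
   and f - k is harmonic. *)

Require Import Defs.
From HB Require Import structures.
From mathcomp Require Import all_boot all_order all_algebra.
From mathcomp Require Import finmap.
From mathcomp Require Import monalg.
From mathcomp Require Import boolp.
From Stdlib Require Reals.
From Coquelicot Require Coquelicot.
From mathcomp Require Import Rstruct.
From mathcomp Require Import ring lra zify.
Set Implicit Arguments.
Unset Strict Implicit.
Unset Printing Implicit Defensive.
Import Order.TTheory GRing.Theory Num.Theory.
Local Open Scope ring_scope.

(** * The polynomial ring rat[Q_1, Q_2, ...] *)

(** The shape of the proof comes from working with formal series and with values at real points of
    [0, 1). The analytic input is a pair of lower bounds near 1: 1/(1 - r) for Q and (1 - r)^(-K) /
    K! for the partition series. Ramanujan's equations are derived from Skoruppa's convolution
    identities for divisor sums, and the logarithmic derivative of theta from the toggle identity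
    for Q_3.

    The derivative in P is found by using the bracket identity twice, for g and for [opD g]. Since
    [opD] commutes with [del] and equals 2 [opDelta] + [del]^2, the second instance is the
    P-derivative of the recursion given by the first one.

    Independence attaches d/dP to the bracket and not merely to a polynomial representing it. It
    also yields that Delta preserves the kernel of the bracket, zero being a modular value.

    A second sl2-triple explains why bdel is onto modulo Q_1: Q_m has weight 2(m - 1), positive for
    m >= 2, so the only obstruction sits in the constants, which are treated apart. *)

Local Notation cmon := {cmonom nat}.
Local Notation Xm m := (<< m >> : Rpoly).

Lemma malgUZ (c : rat) (m : cmon) : << c *g m >> = c *: Xm m :> Rpoly.
Proof. by apply/malgP => k; rewrite [LHS]mcoeffU [RHS]mcoeffZ mcoeffU mulrnAr mulr1. Qed.

Lemma malgUM (m n : cmon) : Xm m * Xm n = Xm (mmul m n).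
Proof. by rewrite malgM_def fgmulUU mulr1. Qed.

Lemma mulcm_div (m : cmon) i : (0 < m i)%N -> m = mmul (ucm i) (divcm m (ucm i)).
Proof.
move=> mi; apply/eqP/cmP => j; rewrite cmM divcmE ucmE.
by case: eqP => [<-|_]; rewrite ?subn0 // subnKC.
Qed.

Lemma divcm_mul (m : cmon) i : divcm (mmul m (ucm i)) (ucm i) = m.
Proof. by apply/eqP/cmP => j; rewrite divcmE cmM addnK. Qed.

Lemma divcmU i : divcm (ucm i) (ucm i) = mone :> cmon.
Proof. by apply/eqP/cmP => j; rewrite divcmE cm1 subnn. Qed.

Lemma cmonom_ind (P : cmon -> Prop) :
  P mone -> (forall i m, P m -> P (mmul (ucm i) m)) -> forall m, P m.
Proof.
move=> P1 PM m; have [n le_n] := ubnP (mdeg m).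
elim: n m le_n => // n IH m lt_n.
have [/mdeg_eq0I -> //|] := eqVneq (mdeg m) 0%N.
move=> m0; have [i mi] : exists i, (0 < m i)%N.
  have : m != mone by rewrite -mdeg_eq0.
  move=> m1; case: (fset_0Vmem (finsupp (cmonom_val m))) => [e|[i]].
    case/eqP: m1; apply/eqP/cmP => i; rewrite cm1; apply/eqP.
    by rewrite cmE_eq0 e inE.
  by rewrite -cmE_neq0 -lt0n; exists i.
rewrite (mulcm_div mi); apply: PM; apply: IH.
by move: lt_n; rewrite {1}(mulcm_div mi) mdegM mdegU add1n ltnS.
Qed.

Lemma Rpoly_lin_ind (P : Rpoly -> Prop) :
  (forall p q, P p -> P q -> P (p + q)) -> (forall c m, P (c *: Xm m)) ->
  forall p, P p.
Proof.
move=> PD PX p; have P0 : P 0 by rewrite -(scale0r (Xm mone)); apply: PX.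
rewrite (monalgE p); elim/big_rec: _ => // m q _ Pq.
by rewrite malgUZ; apply: PD.
Qed.

Lemma Rpoly_ind (P : Rpoly -> Prop) :
  (forall p q, P p -> P q -> P (p + q)) -> (forall c p, P p -> P (c *: p)) ->
  P 1 -> (forall i p, P p -> P (Qvar i.+1 * p)) -> forall p, P p.
Proof.
move=> PD PZ P1 PX; apply: Rpoly_lin_ind => // c m; apply: PZ.
elim/cmonom_ind: m => [|i m Pm]; first exact: P1.
rewrite -malgUM; exact: (PX i _ Pm).
Qed.

Section Leibniz.
Context (A : comAlgType rat) (d : A -> A).
Context (dD : forall x y, d (x + y) = d x + d y).
Context (dZ : forall c x, d (c *: x) = c *: d x).

(** The four lemmas of this section reduce the product rule for a linear [d] to products of two
    monomials. *)
Lemma leibnizDl p1 p2 q :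
  d (p1 * q) = d p1 * q + p1 * d q -> d (p2 * q) = d p2 * q + p2 * d q ->
  d ((p1 + p2) * q) = d (p1 + p2) * q + (p1 + p2) * d q.
Proof. by move=> h1 h2; rewrite mulrDl !dD h1 h2 !mulrDl addrACA. Qed.

Lemma leibnizDr p q1 q2 :
  d (p * q1) = d p * q1 + p * d q1 -> d (p * q2) = d p * q2 + p * d q2 ->
  d (p * (q1 + q2)) = d p * (q1 + q2) + p * d (q1 + q2).
Proof. by move=> h1 h2; rewrite mulrDr !dD h1 h2 !mulrDr addrACA. Qed.

Lemma leibnizZl c p q : d (p * q) = d p * q + p * d q ->
  d (c *: p * q) = d (c *: p) * q + c *: p * d q.
Proof. by move=> h; rewrite -scalerAl !dZ h -!scalerAl scalerDr. Qed.

Lemma leibnizZr c p q : d (p * q) = d p * q + p * d q ->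
  d (p * (c *: q)) = d p * (c *: q) + p * d (c *: q).
Proof. by move=> h; rewrite -scalerAr !dZ h -!scalerAr scalerDr. Qed.

End Leibniz.

(** * Partial derivatives *)

Section PDeriv.
Implicit Types (p q : Rpoly) (m : cmon) (i j : nat).

Lemma mcoeff_pderiv i p m :
  (pderiv i p)@_m = p@_(mmul m (ucm i)) *+ (m i).+1.
Proof.
rewrite /pderiv raddf_sum /=.
under eq_bigr do rewrite mcoeffU.
have [inp|ninp] := boolP (mmul m (ucm i) \in msupp p).
  rewrite (big_rem _ inp) /= divcm_mul eqxx mulr1n cmM cmUU addn1.
  rewrite big1_seq ?addr0 // => m' /andP[_]; rewrite (mem_rem_uniq _ (fset_uniq _)).
  (* [divcm] truncates, so a monomial without the variable may also land on [m]; its coefficient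
     carries the factor [m' i = 0]. *)
  rewrite inE => /andP[ne _]; case: eqP => // def_m; case: (posnP (m' i)) => [->|mi].
    by rewrite mulr0n mul0rn.
  by case/eqP: ne; rewrite -def_m mulmC -mulcm_div.
rewrite (mcoeff_outdom ninp) mul0rn big1_seq // => m' /andP[_ m'p].
case: eqP => // def_m; case: (posnP (m' i)) => [->|mi]; first by rewrite mulr0n mul0rn.
by case/negP: ninp; rewrite -def_m mulmC -mulcm_div.
Qed.

Lemma pderivD i p q : pderiv i (p + q) = pderiv i p + pderiv i q.
Proof.
apply/malgP => m; rewrite [LHS]mcoeff_pderiv [X in X *+ _ = _]mcoeffD.
rewrite [RHS]mcoeffD [X in _ = X + _]mcoeff_pderiv [X in _ = _ + X]mcoeff_pderiv.
exact: mulrnDl.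
Qed.

Lemma pderivZ i c p : pderiv i (c *: p) = c *: pderiv i p.
Proof.
apply/malgP => m; rewrite [LHS]mcoeff_pderiv [X in X *+ _ = _]mcoeffZ.
rewrite [RHS]mcoeffZ [X in _ = _ * X]mcoeff_pderiv; symmetry; exact: mulrnAr.
Qed.

Lemma pderiv_is_linear i : linear (pderiv i).
Proof. by move=> c p q; rewrite pderivD pderivZ. Qed.
HB.instance Definition _ i :=
  GRing.isLinear.Build rat Rpoly Rpoly _ (pderiv i) (pderiv_is_linear i).

Lemma pderivX i m : pderiv i (Xm m) = (m i)%:R *: Xm (divcm m (ucm i)).
Proof.
rewrite /pderiv msuppU1 big_seq_fset1 mcoeffUU malgUZ; by [].
Qed.

Lemma pderivQ i j : pderiv i (Qvar j) = (i.+1 == j)%:R.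
Proof.
case: j => [|j]; first by rewrite /= pderivX cm1 scale0r.
rewrite pderivX cmU eqSS eq_sym; case: eqP => [->|_]; last by rewrite scale0r.
by rewrite scale1r divcmU.
Qed.

Lemma pderivM i p q : pderiv i (p * q) = pderiv i p * q + p * pderiv i q.
Proof.
elim/Rpoly_lin_ind: p => [p1 p2 h1 h2|c m].
  exact: (leibnizDl (pderivD i) h1 h2).
apply: (leibnizZl (pderivZ i)); elim/Rpoly_lin_ind: q => [q1 q2 h1 h2|d n].
  exact: (leibnizDr (pderivD i) h1 h2).
(* For [m1 i = 0] the two truncated quotients may differ, but then the coefficient vanishes. *)
have aux (m1 n1 : cmon) : (m1 i)%:R *: Xm (divcm (mmul m1 n1) (ucm i)) =
    (m1 i)%:R *: Xm (mmul (divcm m1 (ucm i)) n1).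
  case: (posnP (m1 i)) => [->|mi].
    by rewrite mulr0n [LHS]scale0r [RHS]scale0r.
  suff -> : divcm (mmul m1 n1) (ucm i) = mmul (divcm m1 (ucm i)) n1 by [].
  apply/eqP/cmP => j; rewrite divcmE !cmM divcmE ucmE.
  by case: eqP => [<-|_]; rewrite ?subn0 // addnBAC.
suff h : pderiv i (Xm m * Xm n) = pderiv i (Xm m) * Xm n + Xm m * pderiv i (Xm n).
  exact: (leibnizZr (pderivZ i) d h).
rewrite [X in pderiv i X = _]malgUM [LHS]pderivX.
rewrite [X in _ = X * _ + _]pderivX [X in _ = _ + _ * X]pderivX.
rewrite -[X in _ = X + _]scalerAl -[X in _ = _ + X]scalerAr.
rewrite [X in _ = _ *: X + _]malgUM [X in _ = _ + _ *: X]malgUM.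
pose x := Xm (divcm (mmul m n) (ucm i)).
transitivity ((m i)%:R *: x + (n i)%:R *: x).
  by rewrite cmM natrD; exact: scalerDl.
apply: (congr2 +%R); first exact: aux.
by rewrite /x (mulmC m n) (mulmC m (divcm n _)); exact: aux.
Qed.

End PDeriv.

(* The substitution Q_1 = 0. *)
Definition pi0_mon (m : cmon) : Rpoly := if m 0%N == 0%N then Xm m else 0.

Lemma pi0_mon_mmorphism : mmorphism pi0_mon.
Proof.
split=> [m n|]; last by rewrite /pi0_mon cm1.
rewrite /pi0_mon cmM addn_eq0; case: eqP => _; last by rewrite mul0r.
by case: eqP => _; rewrite ?mulr0 // -malgUM.
Qed.
HB.instance Definition _ := isMultiplicative.Build _ _ pi0_mon pi0_mon_mmorphism.

Definition pi0 : Rpoly -> Rpoly := mmap (@malgC {cmonom nat} rat) pi0_mon.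

Lemma pi0D p q : pi0 (p + q) = pi0 p + pi0 q.
Proof. exact: raddfD. Qed.
Lemma pi0M p q : pi0 (p * q) = pi0 p * pi0 q.
Proof. exact: rmorphM. Qed.
Lemma pi0_1 : pi0 1 = 1.
Proof. exact: rmorph1. Qed.
Lemma pi0Z c p : pi0 (c *: p) = c *: pi0 p.
Proof. by rewrite -!mul_malgC pi0M; congr (_ * _); rewrite /pi0 mmapC. Qed.
Lemma pi0X m : pi0 (Xm m) = pi0_mon m.
Proof. by rewrite /pi0 mmapU; exact: mul1r. Qed.
Lemma pi0Q i : pi0 (Qvar i) = if i == 1%N then 0 else Qvar i.
Proof.
case: i => [|i]; first exact: pi0_1.
by rewrite pi0X /pi0_mon cmU eqSS; case: (i == 0%N).
Qed.

(** * Substitution of values for the variables *)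

Section Substitution.
Context (S : comNzRingType) (f : {rmorphism rat -> S}) (y : nat -> S).

Definition subst_mon (m : cmon) : S := \prod_(i <- finsupp (cmonom_val m)) y i ^+ m i.

Lemma subst_mon_mmorphism : mmorphism subst_mon.
Proof.
have widen (m : cmon) (d : {fset nat}) : (finsupp (cmonom_val m) `<=` d)%fset ->
    subst_mon m = \prod_(i <- d) y i ^+ m i.
  move=> le; rewrite /subst_mon (big_fset_incl _ le) //= => i _.
  by rewrite -cmE_eq0 => /eqP ->.
split=> [m n|]; last by rewrite /subst_mon mdom1 big_seq_fset0.
pose d := (finsupp (cmonom_val m) `|` finsupp (cmonom_val n))%fset.
rewrite !(@widen _ d) ?fsubsetUl ?fsubsetUr ?mdomD ?fsubset_refl //.
by rewrite -big_split; apply: eq_bigr => i _; rewrite cmM exprD.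
Qed.
HB.instance Definition _ := isMultiplicative.Build _ _ subst_mon subst_mon_mmorphism.

Definition subst (p : Rpoly) : S := mmap f subst_mon p.

Lemma substD p q : subst (p + q) = subst p + subst q.
Proof. exact: raddfD. Qed.
Lemma substM p q : subst (p * q) = subst p * subst q.
Proof. exact: rmorphM. Qed.
Lemma subst1 : subst 1 = 1.
Proof. exact: rmorph1. Qed.
Lemma substZ c p : subst (c *: p) = f c * subst p.
Proof. exact: mmapZ. Qed.
Lemma substQ k : subst (Qvar k.+1) = y k.
Proof.
have -> : subst (Qvar k.+1) = f 1 * subst_mon (ucm k) by exact: mmapU.
by rewrite rmorph1 mul1r /subst_mon mdomU big_seq_fset1 cmUU.
Qed.
End Substitution.

Lemma in_Lambda_starE p : in_Lambda_star p <-> pderiv 0 p = 0.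
Proof.
split=> [Lp|dp m mp].
  apply/malgP => m; rewrite mcoeff_pderiv mcoeff0.
  rewrite mcoeff_outdom ?mul0rn //; apply/negP => /Lp.
  by rewrite cmM cmUU addn1.
apply/eqP; rewrite -leqn0 leqNgt; apply/negP => m0.
have := congr1 (mcoeff (divcm m (ucm 0%N))) dp.
rewrite mcoeff_pderiv mcoeff0 mulmC -mulcm_div // => /eqP.
by rewrite mulrn_eq0 /= mcoeff_eq0 mp.
Qed.

(** * sl2-triples and derivations of a polynomial ring *)

Section SL2.
Context (V : lmodType rat) (L U H : V -> V) (S : V -> Prop).
Context (LP : forall c x y, L (c *: x + y) = c *: L x + L y).
Context (UP : forall c x y, U (c *: x + y) = c *: U x + U y).
Context (SL : forall x, S x -> S (L x)) (SU : forall x, S x -> S (U x)).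
Context (LU : forall x, S x -> L (U x) = U (L x) + H x).
Context (HU : forall a x, S x -> H x = a *: x -> H (U x) = (a + 2%:R) *: U x).
Context (HL : forall a x, S x -> H x = a *: x -> H (L x) = (a - 2%:R) *: L x).

Let UD x y : U (x + y) = U x + U y. Proof. by rewrite -{1}[x]scale1r UP scale1r. Qed.
Let U0 : U 0 = 0. Proof. by apply: (addrI (U 0)); rewrite -UD !addr0. Qed.
Let UZ c x : U (c *: x) = c *: U x. Proof. by rewrite -[c *: x]addr0 UP U0 !addr0. Qed.
Let LD x y : L (x + y) = L x + L y. Proof. by rewrite -{1}[x]scale1r LP scale1r. Qed.
Let L0 : L 0 = 0. Proof. by apply: (addrI (L 0)); rewrite -LD !addr0. Qed.
Let LZ c x : L (c *: x) = c *: L x. Proof. by rewrite -[c *: x]addr0 LP L0 !addr0. Qed.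

Let SUn n x : S x -> S (iter n U x). Proof. by move=> Sx; elim: n => //= n /SU. Qed.
Let SLn n x : S x -> S (iter n L x). Proof. by move=> Sx; elim: n => //= n /SL. Qed.

Let HUn a n x : S x -> H x = a *: x -> H (iter n U x) = (a + n.*2%:R) *: iter n U x.
Proof.
move=> Sx Hx; elim: n => [|n IH] /=; first by rewrite addr0.
rewrite (HU (SUn n Sx) IH) doubleS -addrA; congr ((_ + _) *: _).
by rewrite -natrD addn2.
Qed.

Let HLn a n x : S x -> H x = a *: x -> H (iter n L x) = (a - n.*2%:R) *: iter n L x.
Proof.
move=> Sx Hx; elim: n => [|n IH] /=; first by rewrite subr0.
rewrite (HL (SLn n Sx) IH) doubleS -addrA; congr ((_ + _) *: _).
by rewrite -opprD -natrD addn2.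
Qed.

(** Moving [L] through [n] copies of [U] collects the [H]-weights [a + 2 j] for [j < n], whose sum
    is [n (a + n - 1)]. *)
Lemma sl2_lower_raise a n x : S x -> H x = a *: x ->
  L (iter n U x) = iter n U (L x) + (n%:R * (a + n%:R - 1)) *: iter n.-1 U x.
Proof.
move=> Sx Hx; elim: n => [|n IH]; first by rewrite /= mul0r scale0r addr0.
rewrite iterS (LU (SUn n Sx)) IH (HUn n Sx Hx) UD UZ -addrA iterS; congr (_ + _).
case: n {IH} => [|n] /=; first by rewrite mul0r scale0r add0r !addr0 addrK mul1r.
by rewrite -scalerDl; congr (_ *: _); rewrite -muln2 natrM -!natr1; ring.
Qed.

(* w is built as sum_j a_j U^(j+1) L^j v; the a_j are forced one at a time. *)
Lemma sl2_lowering_surj (P : V -> Prop) a v N :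
  P 0 -> (forall x y, P x -> P y -> P (x + y)) -> (forall c x, P x -> P (c *: x)) ->
  (forall j, P (iter j.+1 U (iter j L v))) ->
  S v -> H v = a *: v -> iter N L v = 0 -> (forall j, (j < N)%N -> a != j%:R) ->
  exists2 w, P w & L w = v.
Proof.
move=> P0 PD PZ PU Sv Hv Nv ne.
suff [w [c [Pw Lw]]] : exists w c, P w /\ L w = v + c *: iter N U (iter N L v).
  exists w => //; rewrite Lw Nv.
  suff -> : iter N U 0 = 0 by rewrite scaler0 addr0.
  by elim: (N) => //= n ->.
elim: N ne {Nv} => [|m IH] ne.
  exists 0, (-1); split=> //=; rewrite L0 scaleN1r subrr; by [].
have [j lt_j|w [c [Pw Lw]]] := IH; first by apply: ne; rewrite ltnW.
have am : a - m%:R != 0 by rewrite subr_eq0 ne.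
(* [H] acts on [L^m v] by [a - 2 m], so lowering [U^(m+1) L^m v] gives [U^(m+1) L^(m+1) v] plus
   [(m+1)(a - m)] times [U^m L^m v]; this [b] cancels the error left by [w]. *)
pose b := - c / ((m.+1)%:R * (a - m%:R)).
exists (w + b *: iter m.+1 U (iter m L v)), b; split; first exact/PD/PZ/PU.
rewrite LD LZ Lw (sl2_lower_raise _ (SLn m Sv) (HLn m Sv Hv)) /= -addrA; congr (_ + _).
rewrite scalerDr addrCA -[RHS]addr0; congr (_ + _).
rewrite scalerA -scalerDl -[RHS](scale0r (iter m U (iter m L v))); congr (_ *: _).
have -> : a - m.*2%:R + m.+1%:R - 1 = a - m%:R by rewrite -muln2 natrM -natr1; ring.
by rewrite /b divfK ?addrN // mulf_neq0 // pnatr_eq0.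
Qed.

End SL2.

(* A polynomial algebra rat[Q_1, Q_2, ...] presented by its partial derivatives
   pd i = d/dQ_(i+1), its structural induction and the substitution Q_1 = 0. *)
Record polyops := PolyOps {
  pcar :> comAlgType rat;
  PQ : nat -> pcar;
  pd : nat -> pcar -> pcar;
  pnv : pcar -> nat;
  ppi : pcar -> pcar;
  PQ0 : PQ 0 = 1;
  pdD : forall i x y, pd i (x + y) = pd i x + pd i y;
  pdZ : forall i c x, pd i (c *: x) = c *: pd i x;
  pdM : forall i x y, pd i (x * y) = pd i x * y + x * pd i y;
  pdQ : forall i j, pd i (PQ j) = (i.+1 == j)%:R;
  pnvP : forall p i, (pnv p <= i)%N -> pd i p = 0;
  pcar_ind : forall P : pcar -> Prop,
    (forall p q, P p -> P q -> P (p + q)) -> (forall c p, P p -> P (c *: p)) ->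
    P 1 -> (forall i p, P p -> P (PQ i.+1 * p)) -> forall p, P p;
  ppiD : forall x y, ppi (x + y) = ppi x + ppi y;
  ppiZ : forall c x, ppi (c *: x) = c *: ppi x;
  ppiM : forall x y, ppi (x * y) = ppi x * ppi y;
  ppi1 : ppi 1 = 1;
  ppiQ : forall i, ppi (PQ i) = if i == 1%N then 0 else PQ i
}.

(** * Derivations determined by their values on the generators *)

Section Ops.
Context (R : polyops).
Local Notation Q := (PQ R).
Local Notation pi := (@ppi R).
Local Notation pd := (@pd R).
Local Notation nv := (@pnv R).
Implicit Types (p q x y f g : R) (v w : nat -> R).

Lemma pd_is_linear i : linear (pd i).
Proof. by move=> c p q; rewrite pdD pdZ. Qed.
HB.instance Definition _ i := GRing.isLinear.Build rat R R _ (pd i) (pd_is_linear i).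

Lemma ppi_is_linear : linear pi.
Proof. by move=> c p q; rewrite ppiD ppiZ. Qed.
HB.instance Definition _ := GRing.isLinear.Build rat R R _ pi ppi_is_linear.

Definition der v p : R := \sum_(i < nv p) v i * pd i p.

Lemma derE v p N : (nv p <= N)%N -> der v p = \sum_(i < N) v i * pd i p.
Proof.
move=> le_N; rewrite /der (big_ord_widen _ (fun i => v i * pd i p) le_N).
rewrite big_mkcond; apply: eq_bigr => i _; case: ltnP => // /pnvP ->.
by rewrite mulr0.
Qed.

Lemma der_is_linear v : linear (der v).
Proof.
move=> c p q; pose N := maxn (nv (c *: p + q)) (maxn (nv p) (nv q)).
rewrite !(@derE _ _ N) ?leq_max ?leqnn ?orbT //.
rewrite scaler_sumr -big_split; apply: eq_bigr => i _ /=.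
by rewrite linearP mulrDr scalerAr.
Qed.
HB.instance Definition _ v := GRing.isLinear.Build rat R R _ (der v) (der_is_linear v).

Lemma derM v p q : der v (p * q) = der v p * q + p * der v q.
Proof.
pose N := maxn (nv (p * q)) (maxn (nv p) (nv q)).
rewrite !(@derE _ _ N) ?leq_max ?leqnn ?orbT //.
rewrite mulr_suml mulr_sumr -big_split; apply: eq_bigr => i _ /=.
by rewrite pdM; ring.
Qed.

Lemma derQ v i : der v (Q i.+1) = v i.
Proof.
pose N := maxn (nv (Q i.+1)) i.+1.
rewrite (@derE _ _ N) ?leq_maxl //.
have lt_i : (i < N)%N by rewrite leq_maxr.
rewrite (bigD1 (Ordinal lt_i)) //= pdQ eqxx mulr1 big1 ?addr0 // => j ne.
rewrite pdQ eqSS (_ : (_ == _) = false) ?mulr0 //.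
by apply/negbTE; move: ne; rewrite -val_eqE.
Qed.

Lemma der1 v : der v 1 = 0.
Proof.
by have /eqP := derM v 1 1; rewrite !(mulr1, mul1r) -subr_eq subrr => /eqP <-.
Qed.

Lemma pd1 i : pd i 1 = 0.
Proof.
have := pdM i (1 : R) 1; rewrite !(mulr1, mul1r) => e.
by apply: (addrI (pd i 1)); rewrite addr0 -e.
Qed.

Lemma pdnat i n : pd i n%:R = 0.
Proof. by rewrite (raddfMn (pd i)) /= pd1 mul0rn. Qed.

Lemma natrZ n x : n%:R *: x = n%:R * x.
Proof. by rewrite scaler_nat mulr_natl. Qed.

Lemma dernat v n : der v n%:R = 0.
Proof. by rewrite raddfMn /= der1 mul0rn. Qed.

(** Linearity and the product rule propagate equality from the generators. The commutators of
    first-order operators below are computed this way, on the variables alone. *)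
Lemma derivation_ext (d1 d2 : R -> R) :
  (forall c p q, d1 (c *: p + q) = c *: d1 p + d1 q) ->
  (forall c p q, d2 (c *: p + q) = c *: d2 p + d2 q) ->
  (forall p q, d1 (p * q) = d1 p * q + p * d1 q) ->
  (forall p q, d2 (p * q) = d2 p * q + p * d2 q) ->
  (forall i, d1 (Q i.+1) = d2 (Q i.+1)) -> d1 =1 d2.
Proof.
move=> L1 L2 M1 M2 dQ.
have D (d : R -> R) (L : forall c p q, d (c *: p + q) = c *: d p + d q) :
    (d 0 = 0) * (forall p q, d (p + q) = d p + d q).
  have dD p q : d (p + q) = d p + d q by rewrite -[p]scale1r L !scale1r.
  split=> //; have /eqP := dD 0 0; rewrite addr0 -subr_eq subrr => /eqP <- //.
have O (d : R -> R) (M : forall p q, d (p * q) = d p * q + p * d q) : d 1 = 0.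
  have /eqP := M 1 1; rewrite !(mulr1, mul1r) -subr_eq subrr => /eqP <- //.
elim/pcar_ind => [p q hp hq|c p hp||i p hp].
- by rewrite (D _ L1).2 (D _ L2).2 hp hq.
- by rewrite -[c *: p]addr0 L1 L2 (D _ L1).1 (D _ L2).1 hp.
- by rewrite (O _ M1) (O _ M2).
by rewrite M1 M2 dQ hp.
Qed.

Lemma der_comm v w u :
  (forall i, der v (w i) - der w (v i) = u i) ->
  forall p, der v (der w p) - der w (der v p) = der u p.
Proof.
move=> h; apply: derivation_ext.
- by move=> c p q; rewrite !linearP /= addrACA -scalerDr.
- by move=> c p q; rewrite linearP.
- by move=> p q; rewrite !derM !linearD /= !derM; ring.
- exact: derM.
by move=> i; rewrite !derQ h.
Qed.

Lemma pd_comm i v u :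
  (forall j, pd i (v j) = u j) ->
  forall p, pd i (der v p) = der v (pd i p) + der u p.
Proof.
move=> h p; apply/eqP; rewrite addrC -subr_eq; apply/eqP.
move: p; apply: derivation_ext.
- by move=> c p q; rewrite !linearP /= addrACA -scalerDr.
- by move=> c p q; rewrite linearP.
- by move=> p q; rewrite !(derM, pdM) !linearD /= !(derM, pdM); ring.
- exact: derM.
move=> j; rewrite !derQ pdQ h eqSS; case: eqP => _; last by rewrite linear0 subr0.
by rewrite der1 subr0.
Qed.

Lemma pdC i j p : pd i (pd j p) = pd j (pd i p).
Proof.
apply/eqP; rewrite -subr_eq0; apply/eqP; move: p.
apply: (derivation_ext (d2 := fun=> 0)).
- by move=> c p q; rewrite !linearP /= addrACA -scalerDr.
- by move=> c p q; rewrite scaler0 addr0.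
- by move=> p q; rewrite !pdM !linearD /= !pdM; ring.
- by move=> p q; rewrite mul0r mulr0 addr0.
by move=> k; rewrite !pdQ !pdnat subrr.
Qed.

(** * Weight, raising and lowering operators *)

Definition euler (c : nat -> nat) : nat -> R := fun i => (c i)%:R * Q i.+1.
Local Notation E := (der (euler succn)).
(** The coefficient [i (i+1)] makes the commutator with [lower] act on Q_(i+1) by [2 i], which gives
    an sl2-triple. *)
Definition raise : nat -> R := fun i => (i.+1 * i)%:R * Q i.+2.
(** On Lambda* this is [del] followed by Q_1 = 0, hence the value 0 at Q_2; it is extended by 0 to
    Q_1. *)
Definition lower : nat -> R := fun i => if (i <= 1)%N then 0 else Q i.
Local Notation U := (der raise).
Local Notation d0 := (der lower).
Local Notation Hh := (der (euler (fun i => 2 * i)%N)).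
Local Notation del := (der Q).

Lemma eulerQ c i : der (euler c) (Q i.+1) = (c i)%:R * Q i.+1.
Proof. exact: derQ. Qed.

Lemma eulerM c x y (a b : nat) :
  der (euler c) x = a%:R * x -> der (euler c) y = b%:R * y ->
  der (euler c) (x * y) = (a + b)%:R * (x * y).
Proof. by move=> hx hy; rewrite derM hx hy natrD; ring. Qed.

Lemma derMnat v n x : der v (n%:R * x) = n%:R * der v x.
Proof. by rewrite derM dernat mul0r add0r. Qed.

Lemma ER i : E (Q i) = i%:R * Q i.
Proof. by case: i => [|i]; rewrite ?PQ0 ?der1 ?mul0r // eulerQ. Qed.

Lemma delQ i : del (Q i.+1) = Q i. Proof. exact: derQ. Qed.

Lemma E_del p : E (del p) = del (E p) - del p.
Proof.
rewrite -[X in _ = _ - X](@der_comm Q (euler succn)) ?subKr // => i.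
by rewrite /euler derMnat ER delQ -natr1; ring.
Qed.

Lemma pd_E i p : E (pd i p) = pd i (E p) - (i.+1)%:R * pd i p.
Proof.
pose u j := (j.+1)%:R * ((i == j)%:R : R).
have h j : pd i (euler succn j) = u j.
  by rewrite /u /euler pdM pdQ eqSS pdnat mul0r add0r.
rewrite (pd_comm h) -addrA (_ : der u p = (i.+1)%:R * pd i p) ?subrr ?addr0 //.
move: p; apply: derivation_ext.
- by move=> c p q; rewrite linearP.
- by move=> c p q; rewrite linearP mulrDr scalerAr.
- exact: derM.
- by move=> p q; rewrite pdM; ring.
by move=> j; rewrite derQ pdQ eqSS /u; case: eqP => [->|_] //; rewrite !mulr0.
Qed.

Lemma pd_del i p : pd i (del p) = del (pd i p) + pd i.+1 p.
Proof.
pose u j : R := (i.+1 == j)%:R.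
rewrite (@pd_comm i Q u) => [|j]; last exact: pdQ.
congr (_ + _); move: p; apply: derivation_ext.
- by move=> c p q; rewrite linearP.
- by move=> c p q; rewrite linearP.
- exact: derM.
- by move=> p q; rewrite pdM.
by move=> j; rewrite derQ pdQ eqSS.
Qed.

(** * The second-order operator *)

Definition opD p : R :=
  \sum_(k < nv p) \sum_(l < nv p) 'C(k + l, k)%:R *: (Q (k + l) * pd k (pd l p)).

Lemma scrDE p N : (nv p <= N)%N ->
  opD p = \sum_(k < N) \sum_(l < N) 'C(k + l, k)%:R *: (Q (k + l) * pd k (pd l p)).
Proof.
move=> le; pose F k l := 'C(k + l, k)%:R *: (Q (k + l) * pd k (pd l p)).
have F0 k l : (nv p <= k)%N || (nv p <= l)%N -> F k l = 0.
  case/orP => /pnvP e; first by rewrite /F pdC e linear0 mulr0 scaler0.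
  by rewrite /F e linear0 mulr0 scaler0.
rewrite /opD -/(\sum_(k < nv p) \sum_(l < nv p) F k l).
rewrite (big_ord_widen _ (fun k => \sum_(l < nv p) F k l) le) big_mkcond /=.
apply: eq_bigr => k _; case: ltnP => lek; last first.
  by rewrite big1 // => l _; rewrite -/(F k l) F0 ?lek.
rewrite (big_ord_widen _ (F k) le) big_mkcond; apply: eq_bigr => l _.
by case: ltnP => // lel; rewrite -/(F k l) F0 ?lel ?orbT.
Qed.

Lemma scrD_is_linear : linear opD.
Proof.
move=> c p q; pose N := maxn (nv (c *: p + q)) (maxn (nv p) (nv q)).
rewrite !(@scrDE _ N) ?leq_max ?leqnn ?orbT //.
rewrite scaler_sumr -big_split; apply: eq_bigr => i _ /=.
rewrite scaler_sumr -big_split; apply: eq_bigr => j _ /=.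
by rewrite !linearP mulrDr scalerDr -scalerAr !scalerA [c * _]mulrC.
Qed.
HB.instance Definition _ := GRing.isLinear.Build rat R R _ opD scrD_is_linear.

(** The commutator of a second-order operator with multiplication by a variable is a derivation. For
    [j = 0] and [j = 1] the binomials turn it into twice [del] and twice the weight [E]. *)
Lemma scrD_Qmul j p : opD (Q j.+1 * p) =
  Q j.+1 * opD p + 2%:R * der (fun k => 'C(k + j, k)%:R * Q (k + j)) p.
Proof.
pose N := maxn (maxn (nv (Q j.+1 * p)) (nv p)) j.+1.
have ltj : (j < N)%N by rewrite leq_max leqnn orbT.
rewrite (@derE _ _ N) ?(@scrDE _ N) ?leq_max ?leqnn ?orbT //.
have pdpd k l : pd k (pd l (Q j.+1 * p)) =
    Q j.+1 * pd k (pd l p) + ((l == j)%:R * pd k p + (k == j)%:R * pd l p).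
  rewrite pdM pdQ eqSS linearD /= !pdM pdQ eqSS pdnat mul0r.
  by rewrite add0r; ring.
under eq_bigr => k _ do under eq_bigr => l _ do
  rewrite pdpd natrZ !mulrDr.
under eq_bigr => k _ do rewrite !big_split /=.
rewrite !big_split /= mulr_sumr; congr (_ + _).
  apply: eq_bigr => k _; rewrite mulr_sumr; apply: eq_bigr => l _.
  by rewrite natrZ; ring.
rewrite mulr_natl mulr2n; congr (_ + _).
  apply: eq_bigr => k _; rewrite (bigD1 (Ordinal ltj)) //= eqxx big1 ?addr0.
    by rewrite mul1r mulrA.
  move=> l; rewrite -val_eqE /= => /negPf ->; by rewrite mul0r !mulr0.
rewrite exchange_big /=; apply: eq_bigr => k _.
rewrite (bigD1 (Ordinal ltj)) //= eqxx big1 ?addr0.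
  by rewrite mul1r mulrA addnC -bin_sub ?leq_addl // addnK.
by move=> l; rewrite -val_eqE /= => /negPf ->; rewrite mul0r !mulr0.
Qed.

Lemma eq_der v w p : v =1 w -> der v p = der w p.
Proof. by move=> e; apply: eq_bigr => i _; rewrite e. Qed.

Lemma scrD_Q1 p : opD (Q 1 * p) = Q 1 * opD p + 2%:R * del p.
Proof.
rewrite scrD_Qmul; congr (_ + _ * _); apply: eq_der => k.
by rewrite addn0 binn mul1r.
Qed.

Lemma scrD_Q2 p : opD (Q 2 * p) = Q 2 * opD p + 2%:R * E p.
Proof.
rewrite scrD_Qmul; congr (_ + _ * _); apply: eq_der => k.
by rewrite addn1 binSn.
Qed.

Lemma sum_shift (N : nat) (F : nat -> R) :
  F N = 0 -> \sum_(k < N) F k.+1 + F 0%N = \sum_(k < N) F k.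
Proof.
move=> FN; transitivity (\sum_(k < N.+1) F k).
  by rewrite big_ord_recl addrC.
by rewrite big_ord_recr /= FN addr0.
Qed.

(** On one side [del] lowers the index of the coefficient Q_(k+l), on the other it shifts one of the
    two partial derivatives; Pascal's rule matches the binomials. *)
Lemma scrD_del p : opD (del p) = del (opD p).
Proof.
pose N := (maxn (nv (del p)) (nv p)).+1.
have leN : (nv p <= N)%N by rewrite leqW // leq_maxr.
rewrite !(@scrDE _ N) ?leqW ?leq_max ?leqnn ?orbT //.
rewrite raddf_sum /=; under [RHS]eq_bigr do rewrite raddf_sum.
have pdpd k l : pd k (pd l (del p)) =
    del (pd k (pd l p)) + (pd k.+1 (pd l p) + pd k (pd l.+1 p)).
  by rewrite pd_del linearD /= pd_del -addrA.
have z k l : (N <= k)%N || (N <= l)%N -> pd k (pd l p) = 0.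
  case/orP => le; last by rewrite (pnvP (leq_trans leN le)) linear0.
  by rewrite pdC (pnvP (leq_trans leN le)) linear0.
pose B k l : R := 'C(k + l, k)%:R.
pose A k l := B k l * (Q (k + l) * del (pd k (pd l p))).
(* [F] and [G] are the two shifted sums, reindexed by the derivatives that occur in them and
   extended by zero. *)
pose F k l := match k with 0 => 0 | k'.+1 => B k' l * (Q (k' + l) * pd k (pd l p)) end.
pose G k l := match l with 0 => 0 | l'.+1 => B k l' * (Q (k + l') * pd k (pd l p)) end.
transitivity (\sum_(k < N) \sum_(l < N) (A k l + F k l + G k l)).
  under eq_bigr => k _ do under eq_bigr => l _ do
    rewrite pdpd natrZ !mulrDr.
  under eq_bigr => k _ do rewrite !big_split /=.
  rewrite !big_split /= addrA.
  under [in RHS]eq_bigr => k _ do rewrite !big_split /=.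
  rewrite !big_split /=; congr (_ + _ + _).
    rewrite [LHS]exchange_big [RHS]exchange_big /=; apply: eq_bigr => l _.
    rewrite -[RHS](@sum_shift N (F ^~ l)) /= ?addr0 //.
    by rewrite z ?leqnn ?mulr0.
  apply: eq_bigr => k _; rewrite -[RHS](@sum_shift N (G k)) /= ?addr0 //.
  by rewrite z ?leqnn ?orbT ?mulr0.
apply: eq_bigr => k _; apply: eq_bigr => l _.
rewrite /= linearZ /= derM natrZ mulrDr -addrA [RHS]addrC /A; congr (_ + _).
rewrite /F /G /B.
have dQ0 : del (Q 0) = 0 by rewrite PQ0 der1.
case: k l => [[|k] ?] [[|l] ?] /=; rewrite ?dQ0 ?mul0r ?mulr0 ?add0r ?addr0 //.
- by rewrite delQ !bin0; ring.
- by rewrite !addn0 delQ !binn; ring.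
rewrite !addSn !addnS delQ (binS (k + l).+1 k) natrD; ring.
Qed.

Lemma E_scrD p : E (opD p) = opD (E p) - 2%:R * opD p.
Proof.
pose N := maxn (nv (E p)) (nv p).
rewrite !(@scrDE _ N) ?leq_max ?leqnn ?orbT //.
rewrite raddf_sum mulr_sumr -sumrB; apply: eq_bigr => k _ /=.
rewrite raddf_sum mulr_sumr -sumrB; apply: eq_bigr => l _ /=.
rewrite linearZ /= derM ER pd_E.
have -> : pd k (pd l (E p)) = pd k (E (pd l p)) + l.+1%:R * pd k (pd l p).
  by rewrite [E (pd l p)]pd_E linearB /= pdM pdnat mul0r add0r subrK.
rewrite !natrZ -!natr1 natrD; ring.
Qed.

End Ops.

Section Ops2.
Context (R : polyops).
Local Notation Q := (PQ R).
Local Notation pi := (@ppi R).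
Local Notation pd := (@pd R).
Local Notation E := (der (euler R succn)).
Local Notation U := (der (raise R)).
Local Notation d0 := (der (lower R)).
Local Notation Hh := (der (euler R (fun i => 2 * i)%N)).
Local Notation del := (der Q).
Implicit Types (p q x y f g : R) (v : nat -> R).

Section EulerEq0.
Context (c : nat -> nat).
Let T n x : R := der (euler R c) x - n%:R * x.
Let TD n x y : T n (x + y) = T n x + T n y.
Proof. by rewrite /T linearD /= mulrDr opprD addrACA. Qed.
Let TZ n a x : T n (a *: x) = a *: T n x.
Proof. by rewrite /T linearZ /= -scalerAr scalerBr. Qed.
Let T0 n : T n 0 = 0. Proof. by rewrite /T linear0 mulr0 subrr. Qed.
Let TC n m x : T n (T m x) = T m (T n x).
Proof. by rewrite /T !linearB /= !derMnat; ring. Qed.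
Let Ts (s : seq nat) x := foldr T x s.
Let TsD s x y : Ts s (x + y) = Ts s x + Ts s y.
Proof. by elim: s => //= n s ->; rewrite TD. Qed.
Let TsZ s a x : Ts s (a *: x) = a *: Ts s x.
Proof. by elim: s => //= n s ->; rewrite TZ. Qed.
Let Ts0 s : Ts s 0 = 0. Proof. by elim: s => //= n s ->; rewrite T0. Qed.
Let TsC s n x : T n (Ts s x) = Ts s (T n x).
Proof. by elim: s => //= m s <-; rewrite TC. Qed.
Let TsTs s t x : Ts s (Ts t x) = Ts t (Ts s x).
Proof. by elim: s => //= n s ->; rewrite TsC. Qed.
Let Ts_cat s t x : Ts (s ++ t) x = Ts s (Ts t x).
Proof. exact: foldr_cat. Qed.

(** An element has finitely many homogeneous components, all of natural weight, and multiplication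
    by Q_(i+1) shifts these weights by [c i]. The purpose is [euler_eq0]: an eigenvector whose
    eigenvalue is not natural vanishes. *)
Lemma euler_annihilated p : exists s, Ts s p = 0.
Proof.
elim/pcar_ind: p => [p q [s sp] [t tq]|a p [s sp]||i p [s sp]].
- exists (s ++ t); rewrite TsD !Ts_cat tq Ts0 TsTs sp Ts0 addr0; by [].
- by exists s; rewrite TsZ sp scaler0.
- by exists [:: 0%N]; rewrite /= /T der1 mul0r subrr.
exists (map (addn (c i)) s).
suff -> x : Ts (map (addn (c i)) s) (Q i.+1 * x) = Q i.+1 * Ts s x by rewrite sp mulr0.
elim: s {sp} => //= n s ->; rewrite /T derM eulerQ natrD; ring.
Qed.

Lemma euler_eq0 p (a : rat) :
  der (euler R c) p = a *: p -> (forall n : nat, n%:R != a) -> p = 0.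
Proof.
move=> Ep ne; have [s] := euler_annihilated p.
suff -> : Ts s p = (\prod_(n <- s) (a - n%:R)) *: p.
  move/eqP; rewrite scaler_eq0 => /orP[|/eqP //]; rewrite prodf_seq_eq0 => /hasP[n _] /=.
  by rewrite subr_eq0 eq_sym (negPf (ne n)).
elim: s => /= [|n s IH]; first by rewrite big_nil scale1r.
by rewrite IH TZ big_cons /T Ep -natrZ -scalerBl scalerA mulrC.
Qed.
End EulerEq0.

Lemma ppi_idem p : pi (pi p) = pi p.
Proof.
elim/pcar_ind: p => [p q hp hq|c p hp||i p hp].
- by rewrite !ppiD hp hq.
- by rewrite !ppiZ hp.
- by rewrite !ppi1.
by rewrite !ppiM hp ppiQ; case: eqP => [_|ne]; rewrite ?linear0 // ppiQ; case: eqP ne.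
Qed.

Lemma pd0_ppi p : pd 0 (pi p) = 0.
Proof.
elim/pcar_ind: p => [p q hp hq|c p hp||i p hp].
- by rewrite ppiD pdD hp hq addr0.
- by rewrite ppiZ pdZ hp scaler0.
- by rewrite ppi1 pd1.
rewrite ppiM pdM hp mulr0 addr0 ppiQ; case: i => [|i] /=; first by rewrite linear0 mul0r.
by rewrite pdQ mul0r.
Qed.

Lemma ppi_decomp p : exists g, p = pi p + Q 1 * g.
Proof.
elim/pcar_ind: p => [p q [g hp] [h hq]|c p [g hp]||i p [g hp]].
- by exists (g + h); rewrite {1}hp {1}hq ppiD mulrDr addrACA.
- by exists (c *: g); rewrite {1}hp ppiZ scalerDr scalerAr.
- by exists 0; rewrite ppi1 mulr0 addr0.
rewrite ppiM ppiQ; case: i => [|i] /=; first by exists p; rewrite mul0r add0r.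
by exists (Q i.+2 * g); rewrite {1}hp; ring.
Qed.

Lemma ppi_id f : pd 0 f = 0 -> pi f = f.
Proof.
move=> f0; have [g hf] := ppi_decomp f.
suff g0 : g = 0 by rewrite {2}hf g0 mulr0 addr0.
(* Differentiating [f = pi f + Q_1 g] in Q_1 gives [Q_1 dg/dQ_1 = - g], whereas the degree in Q_1 is
   never negative. *)
have eg : der (euler R (fun i => i == 0%N)) g = Q 1 * pd 0 g.
  move: g {hf}; apply: derivation_ext.
  - by move=> c p q; rewrite linearP.
  - by move=> c p q; rewrite linearP mulrDr scalerAr.
  - exact: derM.
  - by move=> p q; rewrite pdM; ring.
  by case=> [|i]; rewrite derQ /euler pdQ ?mul1r ?mulr1 // mul0r mulr0.
apply: (@euler_eq0 (fun i => i == 0%N) _ (-1)); last first.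
  by move=> n; rewrite -subr_eq0 opprK natr1 pnatr_eq0.
rewrite eg scaleN1r; apply/eqP; rewrite -addr_eq0 addrC; apply/eqP.
have := congr1 (pd 0) hf; rewrite f0 pdD pd0_ppi add0r pdM pdQ mul1r.
by move=> <-.
Qed.

Lemma ppi_nat n : pi n%:R = n%:R.
Proof. by elim: n => [|n IH]; rewrite ?linear0 // -natr1 ppiD IH ppi1. Qed.

Lemma E_ppi p : E (pi p) = pi (E p).
Proof.
elim/pcar_ind: p => [p q hp hq|c p hp||i p hp].
- by rewrite ppiD !linearD /= hp hq.
- by rewrite ppiZ !linearZ /= hp.
- by rewrite ppi1 !der1 linear0.
rewrite ppiM !derM ppiD !ppiM hp eulerQ ppiM ppiQ; congr (_ * _ + _).
rewrite ppi_nat.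
case: eqP => [_|_]; last by rewrite eulerQ.
by rewrite linear0 mulr0.
Qed.

Lemma lower_ppi_del f : pd 0 f = 0 -> pi (del f) = d0 f.
Proof.
move/ppi_id <-; elim/pcar_ind: f => [p q hp hq|c p hp||i p hp].
- by rewrite ppiD !linearD /= hp hq.
- by rewrite ppiZ !linearZ /= hp.
- by rewrite ppi1 !der1 linear0.
rewrite ppiM ppiQ; case: i => [|i] /=; first by rewrite mul0r !linear0.
rewrite !derM ppiD !ppiM hp ppi_idem !derQ !ppiQ /= /lower.
by case: i.
Qed.

Lemma pd0_comm v f : pd 0 f = 0 -> (forall i, (0 < i)%N -> pd 0 (v i) = 0) ->
  pd 0 (der v f) = 0.
Proof.
move=> f0 hv; pose u i := if i is 0%N then pd 0 (v 0%N) else 0.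
rewrite (@pd_comm _ 0 v u) => [|[|j]] //; last exact: hv.
rewrite f0 linear0 add0r.
rewrite (@derE _ _ _ (pnv f).+1) // big_ord_recl /= f0 mulr0 add0r big1 // => i _.
by rewrite mul0r.
Qed.

Lemma pd0_E f : pd 0 f = 0 -> pd 0 (E f) = 0.
Proof. by move=> f0; apply: pd0_comm => // -[] // i _; rewrite /euler pdM pdnat pdQ mul0r mulr0 addr0. Qed.
Lemma pd0_U f : pd 0 f = 0 -> pd 0 (U f) = 0.
Proof. by move=> f0; apply: pd0_comm => // -[] // i _; rewrite /raise pdM pdnat pdQ mul0r mulr0 addr0. Qed.
Lemma pd0_d0 f : pd 0 f = 0 -> pd 0 (d0 f) = 0.
Proof. by move=> f0; rewrite -lower_ppi_del // pd0_ppi. Qed.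

Lemma pd0_scrD f : pd 0 f = 0 -> pd 0 (opD f) = 0.
Proof.
move=> f0; rewrite /opD raddf_sum big1 // => k _; rewrite raddf_sum big1 // => l _ /=.
rewrite pdZ pdM [pd 0 (pd k _)]pdC [pd 0 (pd l f)]pdC f0 !linear0 mulr0 addr0 pdQ.
case: l => [[|l] hl] /=; first by rewrite f0 linear0 mulr0 scaler0.
case: k => [[|k] hk] /=; last by rewrite addSn addnS mul0r scaler0.
by rewrite pdC f0 linear0 mulr0 scaler0.
Qed.

(** * The sl2-triple of [lower] and [raise] *)

Lemma eulerE c i : euler R c i = (c i)%:R * Q i.+1. Proof. by []. Qed.
Lemma raiseE i : raise R i = (i.+1 * i)%:R * Q i.+2. Proof. by []. Qed.
Lemma lower0 : lower R 0 = 0. Proof. by []. Qed.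
Lemma lower1 : lower R 1 = 0. Proof. by []. Qed.
Lemma lowerSS i : lower R i.+2 = Q i.+2. Proof. by []. Qed.
Let lowerE := (lower0, lower1, lowerSS).

Lemma LU_comm x : d0 (U x) = U (d0 x) + Hh x.
Proof.
apply/eqP; rewrite addrC -subr_eq; apply/eqP; apply: der_comm => i.
rewrite !(raiseE, eulerE) derMnat derQ.
case: i => [|[|i]]; rewrite !lowerE ?linear0 ?muln0 ?mul0r ?mulr0 ?subr0 ?addr0 //.
rewrite derQ raiseE -mulrBl -natrB; last by nia.
by congr (_%:R * _); lia.
Qed.

Lemma HU_comm x : Hh (U x) = U (Hh x) + 2%:R * U x.
Proof.
suff h : Hh (U x) - U (Hh x) = der (fun i => 2%:R * raise R i) x.
  rewrite -[LHS](subrK (U (Hh x))) h addrC; congr (_ + _).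
  by rewrite mulr_sumr; apply: eq_bigr => i _; rewrite mulrA.
apply: der_comm => i; rewrite !(eulerE, raiseE) !derMnat !derQ !(eulerE, raiseE).
by rewrite !mulnS !natrD !natrM; ring.
Qed.

Lemma HL_comm x : Hh (d0 x) = d0 (Hh x) - 2%:R * d0 x.
Proof.
suff h : d0 (Hh x) - Hh (d0 x) = der (fun i => 2%:R * lower R i) x.
  have -> : 2%:R * d0 x = der (fun i => 2%:R * lower R i) x.
    by rewrite mulr_sumr; apply: eq_bigr => i _; rewrite mulrA.
  by rewrite -h subKr.
apply: der_comm => i; rewrite !eulerE !derMnat derQ.
case: i => [|[|i]]; rewrite !lowerE ?linear0 ?mulr0 ?subr0 ?addr0 //.
rewrite eulerQ -mulrBl -natrB; last by lia.
by congr (_%:R * _); lia.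
Qed.

Lemma EU_comm x : E (U x) = U (E x) + U x.
Proof.
suff h : E (U x) - U (E x) = U x by rewrite -[X in _ = _ + X]h addrC subrK.
apply: der_comm => i; rewrite !(eulerE, raiseE) !derMnat !derQ !(eulerE, raiseE).
by rewrite -[i.+2%:R]natr1; ring.
Qed.

Lemma EL_comm x : E (d0 x) = d0 (E x) - d0 x.
Proof.
suff h : d0 (E x) - E (d0 x) = d0 x by rewrite -[X in _ = _ - X]h subKr.
apply: der_comm => i; rewrite !eulerE !derMnat derQ.
case: i => [|[|i]]; rewrite !lowerE ?linear0 ?mulr0 ?subr0 ?addr0 //.
by rewrite eulerQ -mulrBl -natrB // subSn // subnn mul1r.
Qed.

(** Joint eigenvectors in Lambda* for the weight and for [Hh]. Lowering reaches every vector of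
    positive [Hh]-weight; the last clause separates off the constants. *)
Definition eigenvec x (w l : nat) :=
  [/\ pd 0 x = 0, E x = w%:R * x, Hh x = l%:R * x
    & (0 < l)%N \/ exists c : rat, x = c *: 1].

(** Monomials are joint eigenvectors. The induction generalises the predicate, so that the factor
    already split off can be moved into it. *)
Lemma Lambda_ind (P : R -> Prop) :
  (forall x y, P x -> P y -> P (x + y)) -> (forall x w l, eigenvec x w l -> P x) ->
  forall f, pd 0 f = 0 -> P f.
Proof.
move=> PD PE f /ppi_id <-; elim/pcar_ind: f P PD PE => [p q hp hq|c p hp||i p hp] P PD PE.
- by rewrite ppiD; apply: (PD _ _ (hp P PD PE) (hq P PD PE)).
- rewrite ppiZ; apply: (hp (fun x => P (c *: x))) => [x y|x w l [x0 Ex Hx alt]].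
    by rewrite scalerDr; apply: PD.
  apply: (PE _ w l); split; rewrite ?linearZ /= ?x0 ?scaler0 ?Ex ?Hx -?scalerAr //.
  by case: alt => [|[a ->]]; [left | right; exists (c * a); rewrite scalerA].
- by apply: (PE _ 0%N 0%N); rewrite ppi1; split; rewrite ?pd1 ?der1 ?mul0r //; right; exists 1; rewrite scale1r.
rewrite ppiM ppiQ; case: i => [|i] /=.
  rewrite mul0r; apply: (PE _ 0%N 0%N); split; rewrite ?linear0 ?mulr0 //.
  by right; exists 0; rewrite scale0r.
apply: (hp (fun x => P (Q i.+2 * x))) => [x y|x w l [x0 Ex Hx alt]].
  by rewrite mulrDr; apply: PD.
apply: (PE _ (i.+2 + w)%N (2 * i.+1 + l)%N); split.
- by rewrite pdM x0 pdQ mul0r mulr0 addr0.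
- by apply: eulerM => //; rewrite eulerQ.
- by apply: eulerM => //; rewrite eulerQ.
by left.
Qed.

Lemma iter_stable (P : R -> Prop) (d : R -> R) n x :
  (forall y, P y -> P (d y)) -> P x -> P (iter n d x).
Proof. by move=> hd Px; elim: n => //= n /hd. Qed.

(* In each positive weight, lowering is onto: every Q_m with m >= 2 has a
   positive H-weight, so no obstruction occurs in sl2_lowering_surj. *)
Lemma lower_surj x w l : eigenvec x w l -> (0 < l)%N ->
  exists f, [/\ pd 0 f = 0, E f = w.+1%:R * f & d0 f = x].
Proof.
move=> [x0 Ex Hx _] l0.
pose P y := pd 0 y = 0 /\ E y = w.+1%:R * y.
suff [f [f0 Ef] Lf] : exists2 f, P f & d0 f = x by exists f.
(* Each [d0] lowers the [Hh]-weight by 2, so [N] applications kill [x]; the forbidden weights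
   [j < N] differ from [l] because [0 < l]. *)
pose N := (l./2).+1.
have Hn n : Hh (iter n d0 x) = (l%:R - n.*2%:R) * iter n d0 x.
  elim: n => [|n IH]; first by rewrite subr0.
  rewrite iterS HL_comm IH mulrBl !linearB /= !derMnat doubleS -addn2 natrD; ring.
have En n : E (iter n d0 x) = (w%:R - n%:R) * iter n d0 x.
  elim: n => [|n IH]; first by rewrite subr0.
  by rewrite iterS EL_comm IH mulrBl !linearB /= !derMnat -natr1; ring.
have EUn n y (a : R) : (forall v, der v a = 0) -> E y = a * y -> E (iter n U y) = (a + n%:R) * iter n U y.
  move=> a0 Ey; elim: n => [|n IH]; first by rewrite addr0.
  by rewrite iterS EU_comm IH derM linearD /= a0 dernat -natr1; ring.
apply: (@sl2_lowering_surj _ d0 U Hh (fun y => pd 0 y = 0) _ _ _ _ _ _ _ P (l%:R) x N).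
- by move=> c y z; rewrite linearP.
- by move=> c y z; rewrite linearP.
- exact: pd0_d0.
- exact: pd0_U.
- by move=> y _; rewrite LU_comm.
- by move=> a y _ Hy; rewrite HU_comm Hy linearZ /= scalerDl natrZ.
- by move=> a y _ Hy; rewrite HL_comm Hy linearZ /= scalerBl natrZ.
- by split; rewrite ?linear0 ?mulr0.
- by move=> y z [y0 Ey] [z0 Ez]; split; rewrite ?linearD /= ?y0 ?z0 ?addr0 // Ey Ez mulrDr.
- by move=> c y [y0 Ey]; split; rewrite ?linearZ /= ?y0 ?scaler0 // Ey scalerAr.
- move=> j; split; first by apply: (iter_stable (P := fun y => pd 0 y = 0)) pd0_U _;
    apply: (iter_stable (P := fun y => pd 0 y = 0)) pd0_d0 x0.
  have a0 v : der v (w%:R - j%:R) = 0 by rewrite linearB /= !dernat subr0.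
  rewrite (EUn _ _ _ a0 (En j)).
  by congr (_ * _); rewrite -!natr1; ring.
- exact: x0.
- by rewrite Hx natrZ.
- apply: (@euler_eq0 (fun i => 2 * i)%N _ (l%:R - N.*2%:R)).
    by rewrite Hn scalerBl !natrZ mulrBl.
  move=> n; rewrite eq_sym subr_eq -natrD eqr_nat.
  by rewrite /N; apply/eqP; have := odd_double_half l; lia.
by move=> j lt_j; rewrite eqr_nat /N in lt_j *; apply/eqP; have := odd_double_half l; lia.
Qed.

(** * The Laplacian *)

Definition opDelta p : R := 2%:R^-1 *: (opD p - del (del p)).

Lemma Delta_is_linear : linear opDelta.
Proof.
by move=> c p q; rewrite /opDelta !linearP /= addrACA -scalerDr linearP.
Qed.
HB.instance Definition _ := GRing.isLinear.Build rat R R _ opDelta Delta_is_linear.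

Lemma DeltaE p : opD p = 2%:R * opDelta p + del (del p).
Proof. by rewrite /opDelta -natrZ scalerA mulfV ?scale1r ?subrK // pnatr_eq0. Qed.

Lemma two_inj x y : 2%:R * x = 2%:R * y -> x = y.
Proof.
rewrite -!natrZ => /(congr1 (fun z : R => 2%:R^-1 *: z)).
by rewrite !scalerA mulVf ?scale1r ?pnatr_eq0.
Qed.

Lemma Delta_Q1 p : opDelta (Q 1 * p) = Q 1 * opDelta p.
Proof.
apply: two_inj; apply: (addIr (del (del (Q 1 * p)))); rewrite -DeltaE scrD_Q1 DeltaE.
by rewrite !derM !delQ PQ0 !linearD /= !derM delQ PQ0 der1; ring.
Qed.

(** Everything is doubled to keep natural coefficients. Modulo Q_1 the commutator of [opDelta] with
    Q_2 is the weight minus 1/2, and the half comes from [del (del Q_2) = 1]. *)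
Lemma Delta_Q2 p : 2%:R * opDelta (Q 2 * p) =
  2%:R * (Q 2 * opDelta p) + (2%:R * E p - p - 2%:R * (Q 1 * del p)).
Proof.
apply: (addIr (del (del (Q 2 * p)))); rewrite -DeltaE scrD_Q2 DeltaE.
by rewrite !derM !delQ !linearD /= !derM !delQ PQ0; ring.
Qed.

Lemma E_Delta p : E (opDelta p) = opDelta (E p) - 2%:R * opDelta p.
Proof.
apply: two_inj; rewrite -[LHS]derMnat.
have -> : 2%:R * opDelta p = opD p - del (del p) by rewrite DeltaE addrK.
have e : 2%:R * opDelta (E p) = opD (E p) - del (del (E p)) by rewrite DeltaE addrK.
by rewrite mulrBr e linearB /= E_scrD E_del E_del linearB /=; ring.
Qed.

Lemma Delta1 c : opDelta (c *: 1) = 0.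
Proof.
have z : opD (1 : R) = 0.
  by rewrite /opD big1 // => k _; rewrite big1 // => l _; rewrite pd1 linear0 mulr0 scaler0.
have -> : opDelta (c *: 1) = c *: opDelta 1 by rewrite linearZ.
by rewrite /opDelta z der1 linear0 subr0 !scaler0.
Qed.

(** [opDelta] commutes with multiplication by Q_1, so it descends to the quotient by Q_1. *)
Lemma ppi_Delta p : pi (opDelta (pi p)) = pi (opDelta p).
Proof.
have [g hp] := ppi_decomp p.
by rewrite [in RHS]hp linearD /= Delta_Q1 ppiD ppiM ppiQ mul0r addr0.
Qed.

Lemma ppi_Delta_eq0 p : (pi (opDelta p) = 0) <-> exists g, opDelta p = Q 1 * g.
Proof.
split=> [h|[g ->]]; last by rewrite ppiM ppiQ mul0r.
by have [g hg] := ppi_decomp (opDelta p); exists g; rewrite hg h add0r.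
Qed.

End Ops2.

(** * Homogeneous components *)

Section Graded.
Context (R : polyops).
Local Notation Q := (PQ R).
Local Notation pd := (@pd R).
Local Notation E := (der (euler R succn)).
Local Notation Hh := (der (euler R (fun i => 2 * i)%N)).
Local Notation del := (der Q).
Implicit Types (p q x y f g : R).

Lemma sum_widen (m n : nat) (F : nat -> R) : (m <= n)%N ->
  \sum_(i < m) F i = \sum_(i < n) (if (i < m)%N then F i else 0).
Proof. by move=> le; rewrite (big_ord_widen _ F le) big_mkcond. Qed.

Lemma graded (c : nat -> nat) p : exists m (F : nat -> R),
  p = \sum_(i < m) F i /\ forall i, der (euler R c) (F i) = i%:R * F i.
Proof.
elim/pcar_ind: p => [p q [m [F [-> hF]]] [n [G [-> hG]]]|a p [m [F [-> hF]]]||j p [m [F [-> hF]]]].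
- exists (maxn m n), (fun i => (if (i < m)%N then F i else 0) + (if (i < n)%N then G i else 0)).
  split=> [|i]; last by rewrite linearD /=; do 2!case: ifP => _; rewrite ?hF ?hG ?linear0; ring.
  by rewrite big_split /= -!sum_widen ?leq_maxl ?leq_maxr.
- exists m, (fun i => a *: F i); split=> [|i]; first by rewrite scaler_sumr.
  by rewrite linearZ /= hF scalerAr.
- exists 1%N, (fun i => if i is 0%N then 1 else 0); split=> [|[|i]]; first by rewrite big_ord1.
    by rewrite der1 mul0r.
  by rewrite linear0 mulr0.
exists (c j + m)%N, (fun i => if (i < c j)%N then 0 else Q j.+1 * F (i - c j)%N).
split=> [|i]; last first.
  case: ltnP => le; first by rewrite linear0 mulr0.
  by rewrite (eulerM (eulerQ _ _ _) (hF _)) subnKC.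
rewrite big_split_ord /= [X in _ = X + _]big1 ?add0r; last by move=> i _; rewrite ltn_ord.
rewrite mulr_sumr; apply: eq_bigr => i _.
by rewrite ltnNge leq_addr /= addKn.
Qed.

Section Stable.
Context (c : nat -> nat) (K : R -> Prop).
Context (KD : forall x y, K x -> K y -> K (x + y)) (KZ : forall a x, K x -> K (a *: x)).
Context (KE : forall x, K x -> K (der (euler R c) x)).

(** The weight operator minus [m] removes the top component and multiplies the others by nonzero
    scalars, so induction on the number of components applies. *)
Lemma graded_stable m (F : nat -> R) :
  (forall i, der (euler R c) (F i) = i%:R * F i) -> K (\sum_(i < m) F i) ->
  forall i, (i < m)%N -> K (F i).
Proof.
move=> hF; elim: m F hF => // m IH F hF Km.
have KB x y : K x -> K y -> K (x - y) by move=> Kx Ky; rewrite -scaleN1r; apply/KD/KZ.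
have Ki i : (i < m)%N -> K (F i).
  move=> lt_i; pose G j := (j%:R - m%:R) *: F j.
  have KG : K (G i).
    apply: (IH G) => // [j|]; first by rewrite linearZ /= hF scalerAr.
    have -> : \sum_(j < m) G j = der (euler R c) (\sum_(j < m.+1) F j) - m%:R *: \sum_(j < m.+1) F j.
      rewrite raddf_sum scaler_sumr -sumrB big_ord_recr /= hF natrZ subrr addr0.
      by apply: eq_bigr => j _; rewrite /G scalerBl hF !natrZ.
    by apply: KB; [exact: KE | exact: KZ].
  have := KZ (i%:R - m%:R)^-1 KG; rewrite /G scalerA mulVf ?scale1r //.
  by rewrite subr_eq0 eqr_nat (ltn_eqF lt_i).
move=> i; rewrite ltnS leq_eqVlt => /predU1P[->|/Ki //].
have -> : F m = \sum_(j < m.+1) F j - \sum_(j < m) F j by rewrite big_ord_recr /= addrAC subrr add0r.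
apply: (KB) => //; have K0 : K 0 by rewrite -(scale0r (\sum_(j < m.+1) F j)); exact: KZ.
by elim/big_ind: _ => // j _; exact: Ki.
Qed.
End Stable.

Lemma H0_const x : pd 0 x = 0 -> Hh x = 0 -> exists a : rat, x = a *: 1.
Proof.
move=> x0 Hx.
pose P g := exists a m (F : nat -> R), [/\ g = a *: 1 + \sum_(i < m) F i,
   forall i, Hh (F i) = i%:R * F i & F 0%N = 0].
have [a [m [F [ex hF F0]]]] : P x.
  apply: (Lambda_ind _ _ x0) => [f g [a [m [F [-> hF F0]]]] [b [n [G [-> hG G0]]]]|y w l].
    exists (a + b), (maxn m n), (fun i => (if (i < m)%N then F i else 0) + (if (i < n)%N then G i else 0)).
    split=> [|i|]; first by rewrite big_split /= -!sum_widen ?leq_maxl ?leq_maxr // scalerDl addrACA.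
      by rewrite linearD /=; do 2!case: ifP => _; rewrite ?hF ?hG ?linear0; ring.
    by rewrite F0 G0 !if_same addr0.
  case=> _ _ Hy [l0|[a ->]]; last first.
    by exists a, 0%N, (fun=> 0); rewrite big_ord0 addr0; split=> // i; rewrite linear0 mulr0.
  exists 0, l.+1, (fun i => if i == l then y else 0); split=> [|i|].
  - rewrite scale0r add0r big_ord_recr /= eqxx big1 ?add0r // => i _.
    by rewrite (ltn_eqF (ltn_ord i)).
  - by case: eqP => [->|_]; rewrite ?linear0 ?mulr0.
  by rewrite (ltn_eqF l0).
have z i : (i < m)%N -> i%:R * F i = 0.
  apply: (@graded_stable (fun i => 2 * i)%N (fun y => y = 0) _ _ _ m (fun i => i%:R * F i)) => [u v -> ->|b u ->|u ->|j|].
  - by rewrite addr0.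
  - by rewrite scaler0.
  - by rewrite linear0.
  - by rewrite derMnat hF.
  move: Hx; rewrite ex linearD /= linearZ /= der1 scaler0 add0r raddf_sum /= => Hx.
  by rewrite -[RHS]Hx; apply: eq_bigr => j _; rewrite hF.
exists a; rewrite ex big1 ?addr0 // => i _; have := z i (ltn_ord i).
case: i => [[|i] hi] /=; first by rewrite F0.
by rewrite -natrZ => /eqP; rewrite scaler_eq0 pnatr_eq0 => /eqP.
Qed.

Lemma EH_comm x : E (Hh x) = Hh (E x).
Proof.
apply/eqP; rewrite -subr_eq0; apply/eqP.
rewrite (@der_comm _ _ _ (fun=> 0)) => [|i].
  by rewrite /der big1 // => i _; rewrite mul0r.
by rewrite !eulerE !derMnat !eulerQ; ring.
Qed.

Lemma pd0_H f : pd 0 f = 0 -> pd 0 (Hh f) = 0.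
Proof.
move=> f0; apply: pd0_comm => // -[] // i _.
by rewrite eulerE pdM pdnat pdQ mul0r mulr0 addr0.
Qed.

(** [Hh] commutes with the weight, so the [Hh]-components of an element of weight [w] are again of
    weight [w]. *)
Lemma Lambda_hom_ind (P : R -> Prop) (w : nat) :
  (forall x y, P x -> P y -> P (x + y)) -> (forall x l, eigenvec x w l -> P x) ->
  forall f, pd 0 f = 0 -> E f = w%:R * f -> P f.
Proof.
move=> PD PE f f0 Ef.
have [m [F [ef hF]]] := graded (fun i => 2 * i)%N f.
pose K y := pd 0 y = 0 /\ E y = w%:R * y.
have KF i : (i < m)%N -> K (F i).
  apply: (@graded_stable (fun i => 2 * i)%N K) => //; rewrite -?ef //.
  - by move=> x y [x0 Ex] [y0 Ey]; split; rewrite ?linearD /= ?x0 ?y0 ?addr0 // Ex Ey mulrDr.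
  - by move=> a x [x0 Ex]; split; rewrite ?linearZ /= ?x0 ?scaler0 // Ex scalerAr.
  by move=> x [x0 Ex]; split; [exact: pd0_H | rewrite EH_comm Ex derMnat].
have P0 : P 0.
  apply: (PE 0 0%N); split; rewrite ?linear0 ?mulr0 //.
  by right; exists 0; rewrite scale0r.
rewrite ef; elim/big_ind: _ => // i _; have [i0 Ei] := KF i (ltn_ord i).
apply: (PE _ i); split=> //; case: (posnP i) => [iz|]; last by left.
by right; apply: H0_const => //; rewrite hF iz mul0r.
Qed.

Lemma E_iter_del x w n : E x = w%:R * x -> E (iter n del x) = (w%:R - n%:R) * iter n del x.
Proof.
move=> Ex; elim: n => [|n IH]; first by rewrite subr0.
by rewrite iterS E_del IH derM linearB /= !dernat -natr1; ring.
Qed.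

Lemma del_hom_nilp x (w n : nat) : E x = w%:R * x -> (w < n)%N -> iter n del x = 0.
Proof.
move=> Ex lt; apply: (@euler_eq0 R succn _ (w%:R - n%:R)).
  by rewrite (E_iter_del _ Ex) mulrBl scalerBl !natrZ.
by move=> i; rewrite eq_sym subr_eq -natrD eqr_nat; apply/eqP; lia.
Qed.

End Graded.

(** * Formal power series *)

(** A separate name for [fps], so that the ring structure attached to it is the Cauchy product; its
    decidable equality and choice are classical. *)
Definition FPS : Type := nat -> rat.

HB.instance Definition _ := gen_eqMixin FPS.
HB.instance Definition _ := gen_choiceMixin FPS.

Section FPSRing.
Implicit Types (a b c : FPS) (n : nat).

Lemma fpsP a b : (forall n, a n = b n) -> a = b.
Proof. exact: funext. Qed.

Definition fps_add a b : FPS := fun n => a n + b n.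
Definition fps_opp a : FPS := fun n => - a n.
Definition fps_zero : FPS := fun=> 0.
Definition fps_one : FPS := fun n => (n == 0%N)%:R.
Definition fps_scale (k : rat) a : FPS := fun n => k * a n.

Fact fps_addA : associative fps_add.
Proof. by move=> a b c; apply: fpsP => n; rewrite /fps_add addrA. Qed.
Fact fps_addC : commutative fps_add.
Proof. by move=> a b; apply: fpsP => n; rewrite /fps_add addrC. Qed.
Fact fps_add0 : left_id fps_zero fps_add.
Proof. by move=> a; apply: fpsP => n; rewrite /fps_add add0r. Qed.
Fact fps_addN : left_inverse fps_zero fps_opp fps_add.
Proof. by move=> a; apply: fpsP => n; rewrite /fps_add addNr. Qed.

HB.instance Definition _ :=
  GRing.isZmodule.Build FPS fps_addA fps_addC fps_add0 fps_addN.

(** The ring laws are read off from polynomials: coefficient [n] of a product depends only on the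
    truncations at degree [n]. *)
Let tr n a : {poly rat} := \poly_(i < n.+1) a i.
Let trE n a i : (i <= n)%N -> (tr n a)`_i = a i.
Proof. by move=> le; rewrite coef_poly ltnS le. Qed.
Let trM n a b i : (i <= n)%N -> (tr n a * tr n b)`_i = fps_mul a b i.
Proof.
move=> le; rewrite coefM; apply: eq_bigr => j _.
by rewrite !trE // ?(leq_trans (leq_subr _ _)) // (leq_trans _ le) // -ltnS.
Qed.

Definition fps_times a b : FPS := fps_mul a b.

Fact fps_mulA : associative fps_times.
Proof.
move=> a b c; apply: fpsP => n; transitivity ((tr n a * (tr n b * tr n c))`_n).
  rewrite coefM; apply: eq_bigr => i _.
  by rewrite trM ?leq_subr // trE // -ltnS.
rewrite mulrA coefM; apply: eq_bigr => i _.
by rewrite trM ?trE ?leq_subr // -ltnS.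
Qed.
Fact fps_mulC : commutative fps_times.
Proof. by move=> a b; apply: fpsP => n; rewrite /fps_times -!(@trM n) // mulrC. Qed.
Fact fps_mul1 : left_id fps_one fps_times.
Proof.
move=> a; apply: fpsP => n; rewrite /fps_times /fps_mul big_ord_recl /= mul1r subn0.
by rewrite big1 ?addr0 // => i _; rewrite /fps_one mul0r.
Qed.
Fact fps_mulDl : left_distributive fps_times fps_add.
Proof.
move=> a b c; apply: fpsP => n; rewrite /fps_add /fps_times /fps_mul -big_split.
by apply: eq_bigr => i _; rewrite mulrDl.
Qed.
Fact fps_1neq0 : fps_one != 0 :> FPS.
Proof. by apply/eqP => /(congr1 (fun a : FPS => a 0%N)). Qed.

HB.instance Definition _ := GRing.Zmodule_isComNzRing.Build FPS
  fps_mulA fps_mulC fps_mul1 fps_mulDl fps_1neq0.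

Fact fps_scaleA x y a : fps_scale x (fps_scale y a) = fps_scale (x * y) a.
Proof. by apply: fpsP => n; rewrite /fps_scale mulrA. Qed.
Fact fps_scale1 : left_id 1 fps_scale.
Proof. by move=> a; apply: fpsP => n; rewrite /fps_scale mul1r. Qed.
Fact fps_scaleDr : right_distributive fps_scale +%R.
Proof. by move=> x a b; apply: fpsP => n; rewrite /fps_scale mulrDr. Qed.
Fact fps_scaleDl a : {morph fps_scale^~ a : x y / x + y}.
Proof. by move=> x y; apply: fpsP => n; rewrite /fps_scale mulrDl. Qed.
HB.instance Definition _ := GRing.Zmodule_isLmodule.Build rat FPS
  fps_scaleA fps_scale1 fps_scaleDr fps_scaleDl.

Fact fps_scaleAl x a b : x *: (a * b) = (x *: a) * b.
Proof.
apply: fpsP => n; rewrite [LHS]mulr_sumr; apply: eq_bigr => i _.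
by rewrite mulrA.
Qed.
HB.instance Definition _ := GRing.Lmodule_isLalgebra.Build rat FPS fps_scaleAl.
HB.instance Definition _ := GRing.Lalgebra_isComAlgebra.Build rat FPS.

Lemma fpsD a b n : (a + b) n = a n + b n. Proof. by []. Qed.
Lemma fpsN a n : (- a) n = - a n. Proof. by []. Qed.
Lemma fps0 n : (0 : FPS) n = 0. Proof. by []. Qed.
Lemma fps1 n : (1 : FPS) n = (n == 0%N)%:R. Proof. by []. Qed.
Lemma fpsZ k a n : (k *: a) n = k * a n. Proof. by []. Qed.
Lemma fpsM a b n : (a * b) n = \sum_(i < n.+1) a i * b (n - i)%N. Proof. by []. Qed.
Lemma fps_sum I (r : seq I) (P : pred I) (F : I -> FPS) n :
  (\sum_(i <- r | P i) F i) n = \sum_(i <- r | P i) F i n.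
Proof. by elim/big_rec2: _ => // i x y _ <-. Qed.

Lemma fps_powE a m : fps_pow a m = a ^+ m.
Proof. by elim: m => //= m IH; rewrite exprS /fps_pow /= -IH. Qed.

Lemma fps_mulVr a : a 0%N != 0 -> a * fps_inv a = 1.
Proof. by move=> a0; apply: fpsP => n; exact: fps_mulV. Qed.

Definition fD a : FPS := fun n => n%:R * a n.

Lemma fD_is_linear : linear fD.
Proof. by move=> k a b; apply: fpsP => n; rewrite /fD fpsD fpsD !fpsZ /fD; ring. Qed.
HB.instance Definition _ := GRing.isLinear.Build rat FPS FPS _ fD fD_is_linear.

Lemma fDM a b : fD (a * b) = fD a * b + a * fD b.
Proof.
apply: fpsP => n; rewrite fpsD !fpsM /fD fpsM mulr_sumr -big_split /=.
apply: eq_bigr => i _; have le : (i <= n)%N by rewrite -ltnS.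
by rewrite -{1}(subnKC le) natrD; ring.
Qed.

Lemma fD1 : fD 1 = 0.
Proof. by apply: fpsP => -[|n]; rewrite /fD fps1 ?mul0r // mulr0. Qed.

Lemma fDX a n : fD (a ^+ n) = n%:R * a ^+ n.-1 * fD a.
Proof.
elim: n => [|n IH]; first by rewrite expr0 fD1 !mul0r.
rewrite exprS fDM IH; case: n {IH} => [|n]; first by rewrite /= !expr0; ring.
by rewrite -[n.+1.-1]/n -[n.+2.-1]/n.+1 exprS -[n.+2%:R]natr1; ring.
Qed.

Lemma fps_low a b m n : (forall i, (i < m)%N -> a i = 0) ->
  (forall i, (i < n)%N -> b i = 0) -> (a * b) (m + n)%N = a m * b n.
Proof.
move=> am bn; have lt_m : (m < (m + n).+1)%N by rewrite ltnS leq_addr.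
rewrite fpsM (bigD1 (Ordinal lt_m)) //= addKn big1 ?addr0 // => i.
rewrite -val_eqE neq_ltn /= => /orP[/am ->|lt_i]; first by rewrite mul0r.
by rewrite bn ?mulr0 // ltn_subLR ?ltn_add2r // -ltnS.
Qed.

Lemma fps_low0 a b m n i : (forall i, (i < m)%N -> a i = 0) ->
  (forall i, (i < n)%N -> b i = 0) -> (i < m + n)%N -> (a * b) i = 0.
Proof.
move=> am bn lt_i; rewrite fpsM big1 // => j _.
case: (ltnP j m) => [/am ->|lejm]; first by rewrite mul0r.
rewrite bn ?mulr0 // ltn_subLR; last by rewrite -ltnS.
by apply: leq_trans lt_i _; rewrite leq_add2r.
Qed.

Lemma fps_neq0 a : a != 0 ->
  exists m, a m != 0 /\ forall i, (i < m)%N -> a i = 0.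
Proof.
move=> a0; have [n an] : exists n, a n != 0.
  apply: contrapT => na; case/eqP: a0; apply: fpsP => n; apply/eqP.
  by apply: contrapT => /negP an; apply: na; exists n.
case: (ex_minnP (P := fun n => a n != 0)); first by exists n.
move=> m am min_m; exists m; split=> // i lt_i; apply/eqP.
by apply: contraTT lt_i => /min_m; rewrite -leqNgt.
Qed.

Lemma fps_mul_neq0 a b : a != 0 -> b != 0 -> a * b != 0.
Proof.
move=> /fps_neq0[m [am ma]] /fps_neq0[n [bn nb]].
by apply/eqP => /(congr1 (fun c : FPS => c (m + n)%N))/eqP; rewrite fps_low // mulf_eq0 (negPf am) (negPf bn).
Qed.

Lemma fps_mulI a b c : a != 0 -> a * b = a * c -> b = c.
Proof.
move=> a0 e; apply/eqP; rewrite -subr_eq0; apply: contraT => bc.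
by have := fps_mul_neq0 a0 bc; rewrite mulrBr e subrr eqxx.
Qed.

(* q d/dq has no solution of D(x) = nonzero constant: there is no logarithm. *)
Lemma fps_no_log a b (k : rat) :
  k != 0 -> a * fD b - b * fD a = k *: (a * a) -> a = 0.
Proof.
move=> k0 e; apply/eqP; apply: contraT => a0.
have [m [am ma]] := fps_neq0 a0.
have b0 : b != 0.
  apply/eqP => b0; move/eqP: e; rewrite b0 linear0 mulr0 mul0r subrr eq_sym.
  by rewrite scaler_eq0 (negPf k0) (negPf (fps_mul_neq0 a0 a0)).
have [n [bn nb]] := fps_neq0 b0.
have Da i : (i < m)%N -> fD a i = 0 by move=> /ma; rewrite /fD => ->; rewrite mulr0.
have Db i : (i < n)%N -> fD b i = 0 by move=> /nb; rewrite /fD => ->; rewrite mulr0.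
have ev i : (a * fD b - b * fD a) i = k * (a * a) i by rewrite e.
have z i : (i < n + m)%N -> (a * fD b - b * fD a) i = 0.
  by move=> lt; rewrite fpsD fpsN (fps_low0 nb Da lt) (fps_low0 ma Db) ?subrr // addnC.
(* Compare the orders [m] of [a] and [n] of [b]. The right side has order [2 m]; the left side
   vanishes below [m + n], where its coefficient is [(n - m) a_m b_n]. *)
case: (ltngtP m n) => [lt_mn|lt_nm|eq_mn].
- have := z (m + m)%N; rewrite ltn_add2r lt_mn => /(_ isT); rewrite ev fps_low // => /eqP.
  by rewrite !mulf_eq0 (negPf k0) (negPf am).
- have := ev (m + n)%N; rewrite (@fps_low0 a a m m) ?ltn_add2l // mulr0.
  rewrite fpsD fpsN fps_low // addnC fps_low // /fD => /eqP.
  have -> : a m * (n%:R * b n) - b n * (m%:R * a m) = (n%:R - m%:R) * (a m * b n) by ring.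
  by rewrite !mulf_eq0 (negPf am) (negPf bn) !orbF subr_eq0 eqr_nat => /eqP en; rewrite en ltnn in lt_nm.
have := ev (m + m)%N; rewrite fps_low // fpsD fpsN [in X in X - _]eq_mn -{1}eq_mn.
rewrite -eq_mn in bn nb Db *.
rewrite !fps_low // /fD => /eqP; rewrite (_ : _ - _ = 0); last by ring.
by rewrite eq_sym !mulf_eq0 (negPf k0) (negPf am).
Qed.

Lemma fD_eq a : fD a = a -> forall n, n != 1%N -> a n = 0.
Proof.
move=> e n n1; have /eqP := congr1 (fun b : FPS => b n) e; rewrite /fD -subr_eq0.
rewrite -[X in _ - X]mul1r -mulrBl mulf_eq0 subr_eq0 pnatr_eq1 (negPf n1); exact/eqP.
Qed.

End FPSRing.

(** * Ramanujan's differential equations *)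

Section Skoruppa.
Context (n : nat).
Local Notation I := ('I_n.+1).
Local Notation T := (I * I * (I * I))%type.

Definition quad (t : T) : bool :=
  let: ((a, b), (x, y)) := t in
  [&& (0 < a)%N, (0 < b)%N, (0 < x)%N, (0 < y)%N & (a * x + b * y == n)%N].

Definition qsum (F : nat -> nat -> rat) : rat :=
  \sum_(t : T | quad t) F t.1.1 t.1.2.

Lemma quad_shear (F : nat -> nat -> rat) :
  \sum_(t : T | quad t && (t.1.2 < t.1.1)%N) F t.1.1 t.1.2 =
  \sum_(t : T | quad t && (t.2.1 < t.2.2)%N) F (t.1.1 + t.1.2)%N t.1.2.
Proof.
pose h (t : T) : T :=
  ((inord (t.1.1 + t.1.2), t.1.2), (t.2.1, inord (t.2.2 - t.2.1))).
pose h' (t : T) : T :=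
  ((inord (t.1.1 - t.1.2), t.1.2), (t.2.1, inord (t.2.1 + t.2.2))).
rewrite (reindex_onto h h') /=; last first.
  move=> [[a b] [x y]] /andP[/and5P[a0 b0 x0 y0 /eqP e] /= lt_ba].
  rewrite /h /h' /=; have := ltn_ord a; have := ltn_ord b.
  have le1 : (a - b < n.+1)%N by apply: leq_ltn_trans (leq_subr _ _) (ltn_ord a).
  have le2 : (x + y < n.+1)%N by nia.
  by move=> _ _; rewrite !inordK // subnK ?(ltnW lt_ba) // addKn !inord_val.
apply: eq_big => [[[a b] [x y]]|[[a b] [x y]]] /=; rewrite /h /h' /=; last first.
  by move=> /andP[/andP[/and5P[_ _ _ _ /eqP e] lt_ba] _]; rewrite inordK //
    ltnNge; apply/negP => lt; move: e lt_ba; rewrite /inord /insubd insubN /= -?leqNgt //; nia.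
apply/andP/andP => [[/andP[/and5P[a0 b0 x0 y0 /eqP e] lt_ba] /eqP[ha hy]]|[/and5P[a0 b0 x0 y0 /eqP e] lt_xy]].
  have lt1 : (a + b < n.+1)%N.
    (* Out of range, [inord] returns 0, against the positivity of the entry. *)
    rewrite ltnNge; apply/negP => lt; move: a0; rewrite /inord /insubd insubN /= -?leqNgt //.
  move: a0 lt_ba e ha; rewrite inordK // => a0 lt_ba e ha.
  have yx : (y - x < n.+1)%N by apply: leq_ltn_trans (leq_subr _ _) (ltn_ord y).
  move: y0 e; rewrite inordK // subn_gt0 => lt_xy e; split=> //.
  have a0' : (0 < a)%N by move: lt_ba; lia.
  by rewrite a0' b0 x0 (leq_trans _ lt_xy) //=; apply/eqP; nia.
have lt1 : (a + b < n.+1)%N by nia.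
have yx : (y - x < n.+1)%N by apply: leq_ltn_trans (leq_subr _ _) (ltn_ord y).
rewrite !inordK // addnK subnKC ?(ltnW lt_xy) // !inord_val eqxx; split=> //.
rewrite addn_gt0 a0 b0 x0 subn_gt0 lt_xy /=; apply/andP; split; last by lia.
by apply/eqP; nia.
Qed.

Lemma quad_swap (P : T -> bool) (F : nat -> nat -> rat) :
  \sum_(t : T | quad t && P t) F t.1.1 t.1.2 =
  \sum_(t : T | quad t && P ((t.1.2, t.1.1), (t.2.2, t.2.1))) F t.1.2 t.1.1.
Proof.
pose h (t : T) : T := ((t.1.2, t.1.1), (t.2.2, t.2.1)).
have hK : involutive h by case=> [[a b] [x y]].
rewrite (reindex_inj (inv_inj hK)) /=; apply: eq_bigl => -[[a b] [x y]] /=.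
rewrite addnC; congr (_ && _); by do !bool_congr.
Qed.

Lemma sum3 (A : finType) (P : pred A) (f g : A -> nat) (F : A -> rat) :
  \sum_(t | P t) F t = \sum_(t | P t && (g t < f t)%N) F t +
    (\sum_(t | P t && (f t < g t)%N) F t + \sum_(t | P t && (f t == g t)) F t).
Proof.
rewrite (bigID (fun t => (g t < f t)%N)) /=; congr (_ + _).
rewrite (bigID (fun t => (f t < g t)%N)) /=; congr (_ + _); apply: eq_bigl => t.
  by case: (P t) => //=; case: ltngtP.
by case: (P t) => //=; case: ltngtP.
Qed.

(* Skoruppa's shear (a,b,x,y) |-> (a-b,b,x,x+y) identifies the solutions of
   ax + by = n with a > b and those with x < y. *)
Lemma skoruppa (g u : nat -> nat -> rat) :
  (forall a b, g (a + b)%N b = u a b) -> (forall a b, g a (a + b)%N = u a b) ->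
  qsum g - qsum u = \sum_(t : T | quad t && (t.1.1 == t.1.2)) g t.1.1 t.1.1
                  - \sum_(t : T | quad t && (t.2.1 == t.2.2)) u t.1.1 t.1.2.
Proof.
move=> gu1 gu2.
rewrite /qsum (sum3 quad (fun t : T => t.1.1) (fun t : T => t.1.2)).
rewrite [X in _ - X](sum3 quad (fun t : T => t.2.2) (fun t : T => t.2.1)).
rewrite quad_shear.
have -> : \sum_(t : T | quad t && (t.1.1 < t.1.2)%N) g t.1.1 t.1.2 =
    \sum_(t : T | quad t && (t.2.2 < t.2.1)%N) u t.1.1 t.1.2.
  rewrite (quad_swap (fun t => (t.1.1 < t.1.2)%N)) /=.
  rewrite (quad_shear (fun a b => g b a)).
  rewrite [RHS](quad_swap (fun t => (t.2.2 < t.2.1)%N)) /=.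
  by apply: eq_bigr => t _; rewrite addnC gu2.
have -> : \sum_(t : T | quad t && (t.2.1 < t.2.2)%N) g (t.1.1 + t.1.2)%N t.1.2 =
    \sum_(t : T | quad t && (t.2.1 < t.2.2)%N) u t.1.1 t.1.2.
  by apply: eq_bigr => t _; rewrite gu1.
have -> : \sum_(t : T | quad t && (t.1.1 == t.1.2 :> nat)) g t.1.1 t.1.2 =
    \sum_(t : T | quad t && (t.1.1 == t.1.2)) g t.1.1 t.1.1.
  by apply: eq_big => [t|t /andP[_ /eqP ->]].
have -> : \sum_(t : T | quad t && (t.2.2 == t.2.1 :> nat)) u t.1.1 t.1.2 =
    \sum_(t : T | quad t && (t.2.1 == t.2.2)) u t.1.1 t.1.2.
  by apply: eq_bigl => t; rewrite eq_sym.
ring.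
Qed.

(* The case distinction is needed since [divisors 0 = [:: 1]]. *)
Definition dsum (f : nat -> rat) (m : nat) : rat :=
  if m is 0%N then 0 else \sum_(d <- divisors m) f d.

Lemma sum_divisors (f : nat -> rat) m : (m <= n)%N ->
  dsum f m =
  \sum_(a : I) \sum_(x : I) (if [&& (0 < a)%N, (0 < x)%N & (a * x == m)%N] then f a else 0).
Proof.
move=> le_mn; case: (posnP m) => [->|m0].
  rewrite [RHS]big1 // => a _; rewrite big1 // => x _.
  by rewrite muln_eq0; case: a x => [[|a] ?] [[|x] ?].
have -> : dsum f m = \sum_(d <- divisors m) f d by case: (m) m0.
transitivity (\sum_(a : I) if (a : nat) \in divisors m then f a else 0).
  rewrite -big_mkcond /= -(big_mkord (fun a => a \in divisors m) f).
  rewrite -[RHS]big_filter; apply: perm_big; apply: uniq_perm.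
  - exact: divisors_uniq.
  - by rewrite filter_uniq // iota_uniq.
  move=> d; rewrite mem_filter mem_index_iota /=.
  case dm: (d \in divisors m) => //=; rewrite -dvdn_divisors // in dm.
  by rewrite ltnS (leq_trans (dvdn_leq m0 dm)).
apply: eq_bigr => a _; rewrite -dvdn_divisors //.
case: (boolP (a %| m)%N) => [dv|ndv]; last first.
  rewrite big1 // => x _; case: ifP => // /and3P[_ _ /eqP e].
  by case/negP: ndv; rewrite -e dvdn_mulr.
have a0 : (0 < a)%N by apply: dvdn_gt0 dv.
have lt_x : (m %/ a < n.+1)%N by rewrite ltnS (leq_trans (leq_div _ _)).
rewrite (bigD1 (Ordinal lt_x)) //= a0 mulnC divnK // eqxx.
rewrite divn_gt0 // (dvdn_leq m0 dv) /= big1 ?addr0 // => x; rewrite -val_eqE /= => ne.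
by case: ifP => // /andP[_ /eqP e]; case/eqP: ne; rewrite -e mulKn.
Qed.

Lemma qsum_prod (f g : nat -> rat) :
  qsum (fun a b => f a * g b) =
  \sum_(i < n.+1) dsum f i * dsum g (n - i)%N.
Proof.
transitivity (\sum_(i < n.+1) \sum_(t : T)
   (if [&& (0 < t.1.1)%N, (0 < t.2.1)%N & (t.1.1 * t.2.1 == i)%N] then f t.1.1 else 0) *
   (if [&& (0 < t.1.2)%N, (0 < t.2.2)%N & (t.1.2 * t.2.2 == n - i)%N] then g t.1.2 else 0)).
  rewrite exchange_big /= /qsum big_mkcond; apply: eq_bigr => -[[a b] [x y]] _ /=.
  case: ifP => [/and5P[a0 b0 x0 y0 /eqP e]|nq].
    have lt_i : (a * x < n.+1)%N by nia.
    rewrite (bigD1 (Ordinal lt_i)) //= a0 b0 x0 y0 eqxx /= -[X in (X - _)%N]e addKn eqxx.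
    rewrite big1 ?addr0 // => i; rewrite -val_eqE /= eq_sym => /negPf ->.
    by rewrite mul0r.
  rewrite big1 // => i _; case: ifP => [/and3P[a0 x0 /eqP ei]|]; last by rewrite mul0r.
  case: ifP => [/and3P[b0 y0 /eqP e]|]; last by rewrite mulr0.
  by move: nq; rewrite a0 b0 x0 y0 ei e subnKC ?eqxx // -ltnS.
apply: eq_bigr => i _; have le_i : (i <= n)%N by rewrite -ltnS.
rewrite (@sum_divisors f i) // (@sum_divisors g (n - i)) ?leq_subr //.
rewrite -(pair_bigA _ (fun ab xy => (if [&& (0 < (ab : I * I).1)%N, (0 < (xy : I * I).1)%N & (ab.1 * xy.1 == i)%N] then f ab.1 else 0) *
   (if [&& (0 < ab.2)%N, (0 < xy.2)%N & (ab.2 * xy.2 == n - i)%N] then g ab.2 else 0))) /=.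
rewrite -(pair_bigA _ (fun a b => \sum_(xy : I * I) (if [&& (0 < (a : I))%N, (0 < (xy : I * I).1)%N & (a * xy.1 == i)%N] then f a else 0) *
   (if [&& (0 < (b : I))%N, (0 < xy.2)%N & (b * xy.2 == n - i)%N] then g b else 0))) /=.
rewrite mulr_suml; apply: eq_bigr => a _; rewrite mulr_sumr; apply: eq_bigr => b _.
rewrite -(pair_bigA _ (fun x y => (if [&& (0 < a)%N, (0 < (x : I))%N & (a * x == i)%N] then f a else 0) *
   (if [&& (0 < b)%N, (0 < (y : I))%N & (b * y == n - i)%N] then g b else 0))) /=.
by rewrite mulr_suml; apply: eq_bigr => x _; rewrite mulr_sumr.
Qed.

Lemma sum_divisors_inv (f : nat -> rat) :
  dsum (fun d => f (n %/ d)%N) n = dsum f n.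
Proof.
rewrite !sum_divisors //.
rewrite exchange_big /=; apply: eq_bigr => x _; apply: eq_bigr => a _.
rewrite mulnC; case: (posnP x) => //= x0; case: posnP => //= a0.
by case: eqP => // e; rewrite -[X in (X %/ _)%N]e mulnK.
Qed.

Lemma sum_quad (P : T -> bool) (F : T -> rat) : \sum_(t | P t) F t =
  \sum_(a : I) \sum_(b : I) \sum_(x : I) \sum_(y : I)
    (if P ((a, b), (x, y)) then F ((a, b), (x, y)) else 0).
Proof.
rewrite big_mkcond.
rewrite (eq_bigr (fun t => if P (t.1, t.2) then F (t.1, t.2) else 0)); last by case.
rewrite -(pair_bigA _ (fun ab xy => if P (ab, xy) then F (ab, xy) else 0)) /=.
rewrite (eq_bigr (fun ab => \sum_xy if P (ab.1, ab.2, xy) then F (ab.1, ab.2, xy) else 0)); last by case.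
rewrite -(pair_bigA _ (fun a b => \sum_xy if P (a, b, xy) then F (a, b, xy) else 0)) /=.
apply: eq_bigr => a _; apply: eq_bigr => b _.
rewrite (eq_bigr (fun t => if P (a, b, (t.1, t.2)) then F (a, b, (t.1, t.2)) else 0)); last by case.
by rewrite -(pair_bigA _ (fun x y => if P (a, b, (x, y)) then F (a, b, (x, y)) else 0)).
Qed.

Lemma sum_triple (V : nat -> nat -> nat -> rat) :
  \sum_(c : I) \sum_(p : I) \sum_(r : I)
    (if [&& (0 < c)%N, (0 < p)%N, (0 < r)%N & (c * (p + r) == n)%N] then V c p r else 0)
  = dsum (fun c => \sum_(p < n %/ c | (0 < p)%N) V c p (n %/ c - p)%N) n.
Proof.
rewrite (@sum_divisors (fun c => \sum_(p < n %/ c | (0 < p)%N) V c p (n %/ c - p)%N) n) //.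
apply: eq_bigr => c _; case: (posnP c) => [_|c0] /=.
  by rewrite [RHS]big1 // big1 // => p _; rewrite big1.
transitivity (\sum_(x : I) \sum_(p : I) \sum_(r : I)
    (if [&& (0 < p)%N, (0 < r)%N, (p + r == x)%N & (c * x == n)%N] then V c p r else 0)).
  rewrite [RHS]exchange_big; apply: eq_bigr => p _.
  rewrite [RHS]exchange_big; apply: eq_bigr => r _.
  case: (posnP p) => p0; first by rewrite big1.
  case: (posnP r) => r0; first by rewrite big1.
  case: eqP => e; last first.
    rewrite /= big1 // => x _; case: eqP => //= ex; rewrite -ex; by case: eqP.
  have ltx : (p + r < n.+1)%N by nia.
  rewrite (bigD1 (Ordinal ltx)) //= eqxx e eqxx big1 ?addr0 // => x.
  by rewrite -val_eqE /= eq_sym => /negPf ->.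
apply: eq_bigr => x _; case: (posnP x) => x0 /=.
  rewrite big1 // => p _; rewrite big1 // => r _; case: (posnP p) => //= p0.
  by rewrite x0 addn_eq0 (gtn_eqF p0) andbF.
case: eqP => e; last by rewrite big1 // => p _; rewrite big1 // => r _; rewrite !andbF.
rewrite -[X in (X %/ _)%N]e mulKn //.
have le_x : (x <= n.+1)%N by rewrite ltnW.
rewrite (big_ord_widen_cond _ (fun p => 0 < p)%N (fun p => V c p (x - p)%N) le_x) [RHS]big_mkcond.
apply: eq_bigr => p _; case: (posnP p) => p0 /=; first by rewrite big1.
case: ltnP => lt_px; last first.
  rewrite big1 // => r _; case: (posnP r) => //= r0; rewrite andbT.
  by case: eqP => // e2; move: lt_px r0 e2; lia.
have ltr : (x - p < n.+1)%N by rewrite (leq_ltn_trans (leq_subr _ _)).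
rewrite (bigD1 (Ordinal ltr)) //= subn_gt0 lt_px subnKC ?(ltnW lt_px) // eqxx /=.
rewrite big1 ?addr0 // => r; rewrite -val_eqE /= => ne; case: ifP => // /and3P[_ /eqP e2 _].
by case/eqP: ne; rewrite -e2 addKn.
Qed.

Lemma eq_dsum (f g : nat -> rat) m :
  (forall d, (0 < m)%N -> (d %| m)%N -> f d = g d) -> dsum f m = dsum g m.
Proof.
move=> e; case: m e => // m e; apply: eq_big_seq => d dm; apply: e => //.
by rewrite dvdn_divisors.
Qed.

(** On either diagonal the equation reads [c (p + r) = n]: the common entry is a divisor [c], and
    the other two entries split its codivisor. The first diagonal only counts the [n/c - 1]
    splittings, the second sums [u] over them. *)
Lemma skoruppa_div (g u : nat -> nat -> rat) :
  (forall a b, g (a + b)%N b = u a b) -> (forall a b, g a (a + b)%N = u a b) ->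
  qsum g - qsum u = dsum (fun d => ((n %/ d)%:R - 1) * g d d) n
                  - dsum (fun e => \sum_(p < e | (0 < p)%N) u p (e - p)%N) n.
Proof.
move=> gu1 gu2; rewrite (skoruppa gu1 gu2); congr (_ - _).
  rewrite sum_quad.
  transitivity (\sum_(c : I) \sum_(p : I) \sum_(r : I)
    (if [&& (0 < c)%N, (0 < p)%N, (0 < r)%N & (c * (p + r) == n)%N] then g c c else 0)).
    apply: eq_bigr => a _; rewrite (bigD1 a) //= [X in _ + X]big1 ?addr0.
      apply: eq_bigr => x _; apply: eq_bigr => y _.
      by rewrite eqxx andbT -mulnDr; case: (0 < a)%N.
    move=> b ne; rewrite big1 // => x _; rewrite big1 // => y _.
    by rewrite [a == b]eq_sym (negPf ne) andbF.
  rewrite (sum_triple (fun c _ _ => g c c)).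
  apply: eq_dsum => d n0 dn; have d0 := dvdn_gt0 n0 dn.
  have q0 : (0 < n %/ d)%N by rewrite divn_gt0 // dvdn_leq.
  rewrite -(ltn_predK q0) -natr1 addrK big_mkcond big_ord_recl /= add0r.
  by rewrite sumr_const card_ord mulr_natl.
rewrite sum_quad.
transitivity (\sum_(c : I) \sum_(p : I) \sum_(r : I)
    (if [&& (0 < c)%N, (0 < p)%N, (0 < r)%N & (c * (p + r) == n)%N] then u p r else 0)).
  rewrite [RHS]exchange_big; apply: eq_bigr => a _.
  rewrite [RHS]exchange_big; apply: eq_bigr => b _.
  apply: eq_bigr => x _; rewrite (bigD1 x) //= [X in _ + X]big1 ?addr0.
    by rewrite eqxx andbT mulnC [(b * x)%N]mulnC -mulnDr; case: (0 < a)%N; case: (0 < b)%N; case: (0 < x)%N.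
  by move=> y ne; rewrite [x == y]eq_sym (negPf ne) andbF.
by rewrite (sum_triple (fun _ p r => u p r)) (sum_divisors_inv (fun e => \sum_(p < e | (0 < p)%N) u p (e - p)%N)).
Qed.

End Skoruppa.

Definition sg (k : nat) : FPS := dsum (fun d => d%:R ^+ k).

Lemma sgM k l n : (sg k * sg l) n = qsum n (fun a b => a%:R ^+ k * b%:R ^+ l).
Proof. by rewrite qsum_prod. Qed.

Lemma fD_sg k n :
  fD (sg k) n = dsum (fun d => (n %/ d)%:R * d%:R ^+ k.+1) n.
Proof.
rewrite /fD /sg; case: n => [|n]; first by rewrite mul0r.
rewrite mulr_sumr; apply: eq_big_seq => d; rewrite -dvdn_divisors // => dn.
by rewrite exprS mulrA -natrM divnK.
Qed.

Lemma dsumD f g n : dsum (fun d => f d + g d) n = dsum f n + dsum g n.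
Proof. by case: n => [|n] /=; rewrite ?addr0 // big_split. Qed.
Lemma dsumZ c f n : dsum (fun d => c * f d) n = c * dsum f n.
Proof. by case: n => [|n] /=; rewrite ?mulr0 // mulr_sumr. Qed.

Lemma dsum_lin4 c1 c2 c3 c4 f1 f2 f3 f4 n :
  dsum (fun d => c1 * f1 d + c2 * f2 d + c3 * f3 d + c4 * f4 d) n =
  c1 * dsum f1 n + c2 * dsum f2 n + c3 * dsum f3 n + c4 * dsum f4 n.
Proof. by rewrite !dsumD !dsumZ. Qed.

(** For [g(d,d) = c d^(k+1)] the divisor sum of [(n/d) g(d,d)] is [c n sigma_k(n)], a derivative.
    The remaining [- g(d,d)] is the missing term [p = 0] of the other sum. *)
Lemma skoruppa_conv (g u : nat -> nat -> rat) (k n : nat) (c : rat) :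
  (forall a b, g (a + b)%N b = u a b) -> (forall a b, g a (a + b)%N = u a b) ->
  (forall a, g a a = c * a%:R ^+ k.+1) -> (forall e, u 0%N e = c * e%:R ^+ k.+1) ->
  qsum n (fun a b => g a b - u a b) = c * fD (sg k) n - dsum (fun e => \sum_(p < e) u p (e - p)%N) n.
Proof.
move=> gu1 gu2 gd u0; have := skoruppa_div n gu1 gu2.
rewrite /qsum -sumrB => ->; rewrite fD_sg.
have -> : dsum (fun d => ((n %/ d)%:R - 1) * g d d) n =
    c * dsum (fun d => (n %/ d)%:R * d%:R ^+ k.+1) n - dsum (fun e => u 0%N e) n.
  rewrite -dsumZ -[- dsum _ _]mulN1r -dsumZ -dsumD; apply: eq_dsum => d _ _.
  by rewrite gd u0; ring.
rewrite -addrA; congr (_ + _); rewrite -opprD -dsumD; congr (- _); apply: eq_dsum => e n0 en.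
have e0 := dvdn_gt0 n0 en; rewrite -(ltn_predK e0) big_mkcond /= !big_ord_recl /= subn0 add0r.
by congr (_ + _).
Qed.

(** * The convolution identities in weights 4, 6 and 8 *)

Section Convolutions.

(** In this and the next three sums [e] and [m] are kept apart for the induction on [m]; they
    coincide in the applications. The right sides are written with Faulhaber's power sums. *)
Lemma sum_quadratic (e : rat) (m : nat) : \sum_(p < m) (e ^+ 2 - e * p%:R + p%:R ^+ 2) =
  e ^+ 2 * m%:R - e * (m%:R * (m%:R - 1) / 2%:R)
  + (m%:R - 1) * m%:R * (2%:R * m%:R - 1) / 6%:R.
Proof.
elim: m => [|m IH]; first by rewrite big_ord0; field.
by rewrite big_ord_recr /= IH -natr1; field.
Qed.

Lemma sum_quartic (e : rat) (m : nat) : \sum_(p < m) (e ^+ 2 - e * p%:R + p%:R ^+ 2) ^+ 2 =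
  e ^+ 4 * m%:R - 2%:R * e ^+ 3 * (m%:R * (m%:R - 1) / 2%:R)
  + 3%:R * e ^+ 2 * ((m%:R - 1) * m%:R * (2%:R * m%:R - 1) / 6%:R)
  - 2%:R * e * (m%:R * (m%:R - 1) / 2%:R) ^+ 2
  + m%:R * (m%:R - 1) * (2%:R * m%:R - 1) * (3%:R * m%:R ^+ 2 - 3%:R * m%:R - 1) / 30%:R.
Proof.
elim: m => [|m IH]; first by rewrite big_ord0; field.
by rewrite big_ord_recr /= IH -natr1; field.
Qed.

Lemma sum_sextic (e : rat) (m : nat) : \sum_(p < m) (e ^+ 2 - e * p%:R + p%:R ^+ 2) ^+ 3 =
  e ^+ 6 * m%:R - 3%:R * e ^+ 5 * (m%:R * (m%:R - 1) / 2%:R)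
  + 6%:R * e ^+ 4 * ((m%:R - 1) * m%:R * (2%:R * m%:R - 1) / 6%:R)
  - 7%:R * e ^+ 3 * (m%:R * (m%:R - 1) / 2%:R) ^+ 2
  + 6%:R * e ^+ 2 * (m%:R * (m%:R - 1) * (2%:R * m%:R - 1) * (3%:R * m%:R ^+ 2 - 3%:R * m%:R - 1) / 30%:R)
  - 3%:R * e * (m%:R ^+ 2 * (m%:R - 1) ^+ 2 * (2%:R * m%:R ^+ 2 - 2%:R * m%:R - 1) / 12%:R)
  + m%:R * (m%:R - 1) * (2%:R * m%:R - 1) * (3%:R * m%:R ^+ 4 - 6%:R * m%:R ^+ 3 + 3%:R * m%:R + 1) / 42%:R.
Proof.
elim: m => [|m IH]; first by rewrite big_ord0; field.
by rewrite big_ord_recr /= IH -natr1; field.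
Qed.

Lemma sum_disc (e : rat) (m : nat) : \sum_(p < m) (p%:R ^+ 2 * (e - p%:R) ^+ 2 * e ^+ 2) =
  e ^+ 4 * ((m%:R - 1) * m%:R * (2%:R * m%:R - 1) / 6%:R)
  - 2%:R * e ^+ 3 * (m%:R * (m%:R - 1) / 2%:R) ^+ 2
  + e ^+ 2 * (m%:R * (m%:R - 1) * (2%:R * m%:R - 1) * (3%:R * m%:R ^+ 2 - 3%:R * m%:R - 1) / 30%:R).
Proof.
elim: m => [|m IH]; first by rewrite big_ord0; field.
by rewrite big_ord_recr /= IH -natr1; field.
Qed.

(** Both shears turn this norm form into [uu]. As [uu(a, b)] is [gg(a, -b)], a difference of equal
    powers of [gg] and [uu] contains only odd powers of [a] and of [b]: exactly the products of odd
    divisor sums. *)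
Let gg (a b : nat) : rat := a%:R ^+ 2 - a%:R * b%:R + b%:R ^+ 2.
Let uu (a b : nat) : rat := a%:R ^+ 2 + a%:R * b%:R + b%:R ^+ 2.
Let gu1 a b : gg (a + b) b = uu a b. Proof. by rewrite /gg /uu natrD; ring. Qed.
Let gu2 a b : gg a (a + b) = uu a b. Proof. by rewrite /gg /uu natrD; ring. Qed.
Let uuB (e : nat) (p : 'I_e) : uu p (e - p)%N = e%:R ^+ 2 - e%:R * p%:R + p%:R ^+ 2.
Proof. by rewrite /uu natrB ?(ltnW (ltn_ord p)) //; ring. Qed.

Lemma conv11 n : - 2%:R * (sg 1 * sg 1) n =
  1 * fD (sg 1) n - (6%:R^-1 * sg 1 n + 5%:R / 6%:R * sg 3 n).
Proof.
have <- : dsum (fun e => \sum_(p < e) uu p (e - p)%N) n =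
    6%:R^-1 * sg 1 n + 5%:R / 6%:R * sg 3 n.
  rewrite /sg -!dsumZ -dsumD; apply: eq_dsum => d _ _.
  by under eq_bigr do rewrite uuB; rewrite sum_quadratic; field.
rewrite -(@skoruppa_conv gg uu 1 n 1) // => [|a|a]; rewrite ?/gg ?/uu; try by ring.
by rewrite sgM /qsum mulr_sumr; apply: eq_bigr => t _; ring.
Qed.

Lemma conv13 n : - 8%:R * (sg 1 * sg 3) n =
  1 * fD (sg 3) n - (- 30%:R^-1 * sg 1 n + 3%:R^-1 * sg 3 n + 7%:R / 10%:R * sg 5 n).
Proof.
have <- : dsum (fun e => \sum_(p < e) uu p (e - p)%N ^+ 2) n =
    - 30%:R^-1 * sg 1 n + 3%:R^-1 * sg 3 n + 7%:R / 10%:R * sg 5 n.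
  rewrite /sg -!dsumZ -!dsumD; apply: eq_dsum => d _ _.
  by under eq_bigr do rewrite uuB; rewrite sum_quartic; field.
rewrite -(@skoruppa_conv (fun a b => gg a b ^+ 2) (fun a b => uu a b ^+ 2) 3 n 1).
- have -> : - 8%:R * (sg 1 * sg 3) n = - 4%:R * (sg 1 * sg 3) n + - 4%:R * (sg 3 * sg 1) n.
    by rewrite [sg 3 * sg 1]mulrC; ring.
  by rewrite !sgM /qsum !mulr_sumr -big_split; apply: eq_bigr => t _; rewrite /gg /uu /=; ring.
- by move=> a b; rewrite gu1.
- by move=> a b; rewrite gu2.
- by move=> a; rewrite /gg; ring.
by move=> a; rewrite /uu; ring.
Qed.

Lemma conv15 n : - (12%:R * (sg 1 * sg 5) n + 14%:R * (sg 3 * sg 3) n) =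
  1 * fD (sg 5) n - (42%:R^-1 * sg 1 n + - (7%:R / 60%:R) * sg 3 n + 2%:R^-1 * sg 5 n
    + 83%:R / 140%:R * sg 7 n).
Proof.
have <- : dsum (fun e => \sum_(p < e) uu p (e - p)%N ^+ 3) n =
    42%:R^-1 * sg 1 n + - (7%:R / 60%:R) * sg 3 n + 2%:R^-1 * sg 5 n + 83%:R / 140%:R * sg 7 n.
  transitivity (dsum (fun d => 42%:R^-1 * d%:R ^+ 1 + - (7%:R / 60%:R) * d%:R ^+ 3
      + 2%:R^-1 * d%:R ^+ 5 + 83%:R / 140%:R * d%:R ^+ 7) n); last exact: dsum_lin4.
  apply: eq_dsum => d _ _.
  by under eq_bigr do rewrite uuB; rewrite sum_sextic; field.
rewrite -(@skoruppa_conv (fun a b => gg a b ^+ 3) (fun a b => uu a b ^+ 3) 5 n 1).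
- have -> : - (12%:R * (sg 1 * sg 5) n + 14%:R * (sg 3 * sg 3) n) =
      - 6%:R * (sg 1 * sg 5) n + - 6%:R * (sg 5 * sg 1) n + - 14%:R * (sg 3 * sg 3) n.
    by rewrite [sg 5 * sg 1]mulrC; ring.
  by rewrite !sgM /qsum !mulr_sumr -!big_split; apply: eq_bigr => t _; rewrite /gg /uu /=; ring.
- by move=> a b; rewrite gu1.
- by move=> a b; rewrite gu2.
- by move=> a; rewrite /gg; ring.
by move=> a; rewrite /uu; ring.
Qed.

(** This choice of [g] vanishes on the diagonal, so no derivative appears. It is the second relation
    in weight 8, with which [sg 7] is eliminated. *)
Lemma conv33 n : - 4%:R * (sg 3 * sg 3) n =
  0 * fD (sg 0) n - (- 30%:R^-1 * sg 3 n + 30%:R^-1 * sg 7 n).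
Proof.
pose g (a b : nat) : rat := a%:R ^+ 2 * b%:R ^+ 2 * (a%:R - b%:R) ^+ 2.
pose u (a b : nat) : rat := a%:R ^+ 2 * b%:R ^+ 2 * (a%:R + b%:R) ^+ 2.
have <- : dsum (fun e => \sum_(p < e) u p (e - p)%N) n =
    - 30%:R^-1 * sg 3 n + 30%:R^-1 * sg 7 n.
  rewrite /sg -!dsumZ -!dsumD; apply: eq_dsum => d _ _.
  rewrite (eq_bigr (fun p : 'I_d => p%:R ^+ 2 * (d%:R - p%:R) ^+ 2 * d%:R ^+ 2)).
    by rewrite sum_disc; field.
  by move=> p _; rewrite /u natrB ?(ltnW (ltn_ord p)) //; ring.
rewrite -(@skoruppa_conv g u 0 n 0).
- by rewrite sgM /qsum mulr_sumr; apply: eq_bigr => t _; rewrite /g /u /=; ring.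
- by move=> a b; rewrite /g /u natrD; ring.
- by move=> a b; rewrite /g /u natrD; ring.
- by move=> a; rewrite /g; ring.
by move=> a; rewrite /u; ring.
Qed.

End Convolutions.

Lemma fps_natM k (a : FPS) n : (k%:R * a) n = k%:R * a n.
Proof. by rewrite -scaler_nat -scalerAl mul1r fpsZ. Qed.

Lemma fDnat k (a : FPS) : fD (k%:R * a) = k%:R * fD a.
Proof. by rewrite -!scaler_nat -!scalerAl !mul1r linearZ. Qed.

(** * The Eisenstein series and their derivatives *)

Definition Pser : FPS := 1 - 24%:R * sg 1.
Definition Qser : FPS := 1 + 240%:R * sg 3.
Definition Rser : FPS := 1 - 504%:R * sg 5.

Lemma sigmaE k n : (0 < n)%N -> (sigma k n)%:R = sg k n.
Proof.
case: n => // n _; rewrite /sigma /sg /= natr_sum.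
by apply: eq_bigr => d _; rewrite natrX.
Qed.

Lemma QserE : Qser = E4.
Proof.
apply: fpsP => -[|n]; rewrite /Qser fpsD fps1 fps_natM /=; first by rewrite mulr0 addr0.
by rewrite add0r sigmaE.
Qed.

Lemma RserE : Rser = E6.
Proof.
apply: fpsP => -[|n]; rewrite /Rser fpsD fpsN fps1 fps_natM /=; first by rewrite mulr0 subr0.
by rewrite add0r sigmaE.
Qed.

(** Certificate form: the goal is [c] times a known identity, a claim that [ring] can settle. *)
Lemma lincomb (A : comPzRingType) (c a b x y : A) : a = b -> x - y = c * (a - b) -> x = y.
Proof. by move=> ->; rewrite subrr mulr0 => /eqP; rewrite subr_eq0 => /eqP. Qed.

Lemma sg11 : 12%:R * (sg 1 * sg 1) = 5%:R * sg 3 + sg 1 - 6%:R * fD (sg 1).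
Proof.
apply: fpsP => n; rewrite !(fpsD, fpsN, fps_natM); have h := conv11 n.
have -> : 12%:R * (sg 1 * sg 1) n = - 6%:R * (- 2%:R * (sg 1 * sg 1) n) by ring.
by rewrite h; field.
Qed.

Lemma sg13 : 240%:R * (sg 1 * sg 3) = 21%:R * sg 5 + 10%:R * sg 3 - sg 1 - 30%:R * fD (sg 3).
Proof.
apply: fpsP => n; rewrite !(fpsD, fpsN, fps_natM); have h := conv13 n.
have -> : 240%:R * (sg 1 * sg 3) n = - 30%:R * (- 8%:R * (sg 1 * sg 3) n) by ring.
by rewrite h; field.
Qed.

Lemma sg15 : 504%:R * (sg 1 * sg 5) =
  2400%:R * (sg 3 * sg 3) + sg 1 + 20%:R * sg 3 + 21%:R * sg 5 - 42%:R * fD (sg 5).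
Proof.
apply: fpsP => n; rewrite !(fpsD, fpsN, fps_natM); have h := conv15 n; have h' := conv33 n.
by move: h h'; lra.
Qed.

Lemma ramanujanP : 12%:R * fD Pser = Pser ^+ 2 - Qser.
Proof.
rewrite /Pser /Qser linearB /= fD1 fDnat sub0r.
by apply: (lincomb (c := - 48%:R) sg11); ring.
Qed.

Lemma ramanujanQ : 3%:R * fD Qser = Pser * Qser - Rser.
Proof.
rewrite /Pser /Qser /Rser linearD /= fD1 fDnat add0r.
by apply: (lincomb (c := 24%:R) sg13); ring.
Qed.

Lemma ramanujanR : 2%:R * fD Rser = Pser * Rser - Qser ^+ 2.
Proof.
rewrite /Pser /Qser /Rser linearB /= fD1 fDnat sub0r.
by apply: (lincomb (c := - 24%:R) sg15); ring.
Qed.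

(** * Generating series of partitions *)

Definition num (f : ipartition -> rat) : FPS := fun n => \sum_(l <- partitions n) f l.
Definition pser : FPS := num (fun=> 1).
Definition br (f : ipartition -> rat) : FPS := qbracket f.

Lemma brE f : br f = num f * fps_inv pser.
Proof. by []. Qed.

Lemma pser0 : pser 0%N != 0.
Proof.
have h : IPartition (isT : is_part [::]) \in partitions 0 by rewrite mem_partitions.
rewrite /pser /num (big_rem _ h) /=; apply: lt0r_neq0; apply: ltr_pwDl => //.
by apply: sumr_ge0.
Qed.

Lemma pserV : pser * fps_inv pser = 1.
Proof. exact: fps_mulVr pser0. Qed.

Lemma pser_neq0 : pser != 0.
Proof. by apply: contraNneq pser0 => ->. Qed.

Lemma num_br f : num f = br f * pser.
Proof. by rewrite brE -mulrA [_ * pser]mulrC pserV mulr1. Qed.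

Lemma eq_num f g : f =1 g -> num f = num g.
Proof. by move=> e; apply: fpsP => n; apply: eq_bigr => l _; rewrite e. Qed.

Lemma eq_br f g : f =1 g -> br f = br g.
Proof. by move=> e; rewrite !brE (eq_num e). Qed.

Lemma numD f g : num (fun l => f l + g l) = num f + num g.
Proof. by apply: fpsP => n; rewrite fpsD /num big_split. Qed.

Lemma numZ c f : num (fun l => c * f l) = c *: num f.
Proof. by apply: fpsP => n; rewrite fpsZ /num mulr_sumr. Qed.

Lemma brD f g : br (fun l => f l + g l) = br f + br g.
Proof. by rewrite !brE numD mulrDl. Qed.

Lemma brZ c f : br (fun l => c * f l) = c *: br f.
Proof. by rewrite !brE numZ scalerAl. Qed.

Lemma br1 : br (fun=> 1) = 1.
Proof. exact: pserV. Qed.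

Lemma num_psize f : num (fun l => (psize l)%:R * f l) = fD (num f).
Proof.
apply: fpsP => n; rewrite /fD /num mulr_sumr; apply: eq_big_seq => l.
by rewrite mem_partitions => /eqP ->.
Qed.

(** * Counting parts of a given size *)

Section RemovePart.
Context (j : nat) (j0 : (0 < j)%N).

Let geq_total : total geq. Proof. by move=> a b; exact: leq_total. Qed.
Let geq_tr : transitive geq. Proof. by move=> a b c ba ac; exact: leq_trans ac ba. Qed.
Let geq_anti : antisymmetric geq. Proof. by move=> a b; rewrite andbC => /anti_leq. Qed.

Lemma ins_is_part (l : ipartition) : is_part (sort geq (j :: l)).
Proof.
have /andP[_ l0] := valP l; rewrite /is_part sort_sorted //= mem_sort inE negb_or l0.
by rewrite eq_sym -lt0n j0.
Qed.
Definition ins_part (l : ipartition) : ipartition := IPartition (ins_is_part l).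

Lemma perm_ins l : perm_eq (ins_part l) (j :: l).
Proof. by rewrite perm_sort. Qed.

Lemma psize_ins l : psize (ins_part l) = (j + psize l)%N.
Proof. by rewrite /psize (perm_sumn (perm_ins l)). Qed.

Lemma count_ins l : count_mem j (ins_part l) = (count_mem j l).+1.
Proof. by move/permP: (perm_ins l) => ->; rewrite /= eqxx. Qed.

Lemma ins_inj : injective ins_part.
Proof.
move=> l1 l2 e; apply/val_inj => /=.
have /andP[s1 _] := valP l1; have /andP[s2 _] := valP l2.
apply: (sorted_eq geq_tr geq_anti s1 s2).
by rewrite -(perm_cons j) -(permPl (perm_ins l1)) e (permPl (perm_ins l2)).
Qed.

Lemma rem_is_part (l : ipartition) : is_part (rem j l).
Proof.
have /andP[sl l0] := valP l; rewrite /is_part (subseq_sorted geq_tr (rem_subseq j l) sl) /=.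
by apply: contra l0; apply: mem_rem.
Qed.

Lemma ins_surj (l : ipartition) : j \in (l : seq nat) -> exists l', l = ins_part l'.
Proof.
move=> jl; exists (IPartition (rem_is_part l)); apply/val_inj => /=.
have /andP[sl _] := valP l.
apply: (sorted_eq geq_tr geq_anti sl); first exact: sort_sorted.
by rewrite (permPr (permEl (perm_sort _ _))) perm_to_rem.
Qed.

Lemma sum_ins (f : ipartition -> rat) n :
  \sum_(l <- partitions n | j \in (l : seq nat)) f l =
  if (j <= n)%N then \sum_(l <- partitions (n - j)) f (ins_part l) else 0.
Proof.
case: leqP => [le_jn|lt_nj]; last first.
  rewrite big_seq_cond big1 // => l /andP[]; rewrite mem_partitions => /eqP sl jl.
  have [l' el] := ins_surj jl; move: sl; rewrite el psize_ins; lia.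
rewrite -big_filter -[RHS](big_map ins_part xpredT).
apply: perm_big; apply: uniq_perm.
- by rewrite filter_uniq // partitions_uniq.
- by rewrite (map_inj_uniq ins_inj) partitions_uniq.
move=> l; rewrite mem_filter mem_partitions; apply/andP/mapP => [[jl /eqP sl]|[l' l'n ->]].
  have [l' el] := ins_surj jl; exists l' => //.
  by rewrite mem_partitions -sl el psize_ins addKn.
rewrite mem_partitions in l'n; rewrite psize_ins (eqP l'n) subnKC // eqxx; split=> //.
by rewrite (perm_mem (perm_ins l')) mem_head.
Qed.

Let e (n : nat) : rat := num (fun l => (count_mem j l)%:R) n.

(** Removing one part [j] is a bijection from the partitions of [n] containing [j] to all partitions
    of [n - j], and it lowers the multiplicity of [j] by one. *)
Lemma mult_rec n : e n = if (j <= n)%N then e (n - j)%N + pser (n - j)%N else 0.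
Proof.
rewrite /e /num (bigID (fun l : ipartition => j \in (l : seq nat))) /=.
rewrite [X in _ + X]big1 ?addr0; last by move=> l /count_memPn ->.
rewrite sum_ins; case: leqP => // _; rewrite -big_split /=; apply: eq_bigr => l _.
by rewrite count_ins -natr1.
Qed.

Lemma mult_sum N n : (n <= N)%N ->
  e n = \sum_(x < N) (if (j * x.+1 <= n)%N then pser (n - j * x.+1)%N else 0).
Proof.
elim: N n => [|N IH] n le_n.
  by rewrite big_ord0 mult_rec; move: le_n; rewrite leqn0 => /eqP ->; rewrite leqNgt j0.
rewrite mult_rec big_ord_recl muln1; case: leqP => [le_jn|lt_nj]; last first.
  by rewrite big1 ?addr0 // => x _; case: ifP => //; rewrite /bump /=; nia.
rewrite addrC IH; last by lia.
congr (_ + _); apply: eq_bigr => x _; rewrite lift0 [(j * x.+2)%N]mulnS.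
by rewrite (leq_subRL _ le_jn) subnDA.
Qed.
End RemovePart.

(** The size of a partition is the sum of [a] times the multiplicity of [a]. Over all partitions of
    [n] the multiplicity of [a] adds up to the sum of [p(n - a x)] over [x >= 1], and the pairs with
    [a x = i] form a divisor sum. *)
Lemma fD_pser : fD pser = sg 1 * pser.
Proof.
apply: fpsP => n.
transitivity (\sum_(a < n.+1) \sum_(x < n.+1)
   (if [&& (0 < a)%N, (0 < x)%N & (a * x <= n)%N] then a%:R * pser (n - a * x)%N else 0)).
  transitivity (\sum_(a < n.+1) a%:R * num (fun l => (count_mem (a : nat) l)%:R) n).
    rewrite /fD /pser /num mulr_sumr.
    under [RHS]eq_bigr do rewrite mulr_sumr.
    rewrite exchange_big; apply: eq_big_seq => l; rewrite mem_partitions => /eqP sl.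
    rewrite mulr1 -[in LHS]sl /psize.
    have hl : all (fun x => x < n.+1)%N l.
      apply/allP => x xl; rewrite ltnS -sl /psize sumnE (big_rem x) //= leq_addr //.
    elim: (l : seq nat) hl {sl} => [|y s IH] /=.
      by rewrite big1 // => a _; rewrite mulr0.
    case/andP => lt_y /IH {}IH; rewrite natrD IH.
    under [RHS]eq_bigr do rewrite natrD mulrDr.
    rewrite big_split /=; congr (_ + _).
    rewrite (bigD1 (Ordinal lt_y)) //= eqxx mulr1 big1 ?addr0 // => a.
    by rewrite -val_eqE /= eq_sym => /negPf ->; rewrite mulr0.
  apply: eq_bigr => a _; case: (posnP a) => [->|a0] /=.
    by rewrite mul0r big1.
  rewrite (mult_sum a0 (leqnn n)) mulr_sumr big_ord_recl add0r.
  apply: eq_bigr => x _; rewrite lift0.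
  by case: ifP => _; rewrite ?mulr0.
rewrite fpsM.
transitivity (\sum_(i < n.+1) \sum_(a < n.+1) \sum_(x < n.+1)
   (if [&& (0 < a)%N, (0 < x)%N & (a * x == i)%N] then a%:R * pser (n - i)%N else 0)).
  rewrite [RHS]exchange_big; apply: eq_bigr => a _.
  rewrite [RHS]exchange_big; apply: eq_bigr => x _.
  case: (posnP a) => a0 /=; first by rewrite big1.
  case: (posnP x) => x0 /=; first by rewrite big1.
  case: leqP => le; last first.
    rewrite big1 // => i _; case: eqP => // ei; have := ltn_ord i; rewrite -ei; lia.
  rewrite (bigD1 (Ordinal (le : (a * x < n.+1)%N))) //= eqxx big1 ?addr0 // => i.
  by rewrite -val_eqE /= eq_sym => /negPf ->.
apply: eq_bigr => i _; have le_i : (i <= n)%N by rewrite -ltnS.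
rewrite /sg (sum_divisors _ le_i) mulr_suml.
apply: eq_bigr => a _; rewrite mulr_suml; apply: eq_bigr => x _.
by case: ifP => _; rewrite ?mul0r ?expr1.
Qed.

(** * Beta sets and the toggle identity *)

Lemma size_le_psize (l : ipartition) : (size l <= psize l)%N.
Proof.
case: l => s sP; change (size s <= sumn s)%N; case/andP: sP => _; elim: s => //= x s IH.
by rewrite inE negb_or eq_sym -lt0n => /andP[x0 /IH]; lia.
Qed.

Section BetaSets.
Context (M k : nat).
Local Notation I := ('I_M.+1).

(** The increasing list of the numbers [lambda_i + k - i] for [i = 1, ..., k]. It determines a
    partition with at most [k] parts. *)
Definition beta (l : seq nat) : seq nat := rev (mkseq (fun i => nth 0%N l i + (k - i.+1))%N k).

Definition beta_set (l : seq nat) : {set I} := [set a : I | (a : nat) \in beta l].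

Implicit Types (A : {set I}).

Definition vals A : seq nat := map val (enum A).

Lemma vals_sorted A : sorted ltn (vals A).
Proof.
rewrite /vals; apply: (subseq_sorted ltn_trans (s2 := map val (enum I))).
  by apply: map_subseq; rewrite [enum A]/enum_mem [enum I]enumT; exact: filter_subseq.
by rewrite val_enum_ord iota_ltn_sorted.
Qed.

Lemma mem_vals A x : (x \in vals A) = [exists a : I, (a \in A) && (val a == x)].
Proof.
apply/mapP/existsP => [[a]|[a /andP[aA /eqP <-]]].
  by rewrite mem_enum => aA ->; exists a; rewrite aA /=.
by exists a; rewrite ?mem_enum.
Qed.

Lemma sum_vals A (G : nat -> rat) : \sum_(a in A) G a = \sum_(x <- vals A) G x.
Proof. by rewrite /vals big_map big_enum. Qed.

Lemma sumn_vals A : (\sum_(a in A) (a : nat) = sumn (vals A))%N.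
Proof. by rewrite sumnE /vals big_map big_enum. Qed.

Lemma size_vals A : size (vals A) = #|A|.
Proof. by rewrite size_map -cardE. Qed.

Lemma vals_inj : injective vals.
Proof.
move=> A B e; apply/setP => a; have := mem_vals A (val a); rewrite e mem_vals.
have h (C : {set I}) : [exists b : I, (b \in C) && (val b == val a)] = (a \in C).
  apply/existsP/idP => [[b /andP[bC /eqP/val_inj <-]] //|aC]; by exists a; rewrite aC eqxx.
by rewrite !h.
Qed.

Lemma nth_nonincr (l : ipartition) i j : (i <= j)%N -> (nth 0%N l j <= nth 0%N l i)%N.
Proof.
move=> le_ij; rewrite -(subnKC le_ij); elim: (j - i)%N => [|d IH]; first by rewrite addn0.
rewrite addnS; apply: leq_trans IH; have := partition_noninc l (i + d)%N.
by rewrite lez_nat.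
Qed.

Lemma size_beta l : size (beta l) = k.
Proof. by rewrite size_rev size_mkseq. Qed.

Lemma beta_sorted (l : ipartition) : sorted ltn (beta l).
Proof.
rewrite /beta rev_sorted; apply/(sortedP 0%N) => i; rewrite size_mkseq => lt_i.
rewrite !nth_mkseq ?(ltnW lt_i) //; have := nth_nonincr l (leqnSn i).
by move: lt_i => /=; lia.
Qed.

Lemma beta_vals (l : ipartition) :
  (nth 0%N l 0 + k <= M.+1)%N -> vals (beta_set l) = beta l.
Proof.
move=> le_M; apply: (irr_sorted_eq ltn_trans ltnn (vals_sorted _) (beta_sorted l)).
move=> x; rewrite mem_vals; apply/existsP/idP => [[a /andP[]]|xb].
  by rewrite inE => ab /eqP <-.
have lt_x : (x < M.+1)%N.
  move: xb; rewrite mem_rev => /mapP[i]; rewrite mem_iota add0n => /andP[_ lt_i] ->.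
  by have := nth_nonincr l (leq0n i); lia.
by exists (Ordinal lt_x); rewrite inE /= xb eqxx.
Qed.

Lemma beta_inj (l1 l2 : ipartition) : (size l1 <= k)%N -> (size l2 <= k)%N ->
  beta l1 = beta l2 -> l1 = l2.
Proof.
move=> s1 s2 /(congr1 rev); rewrite !revK => e; apply/val_inj => /=.
have en i : nth 0%N l1 i = nth 0%N l2 i.
  case: (ltnP i k) => lt_i; last by rewrite !nth_default // (leq_trans _ lt_i).
  have := congr1 (nth 0%N ^~ i) e; rewrite !nth_mkseq //; lia.
have sz (l : ipartition) i : (i < size l)%N = (0 < nth 0%N l i)%N.
  have /andP[_ l0] := valP l; case: ltnP => [lt_i|/(nth_default 0%N) -> //].
  by rewrite lt0n; symmetry; apply: contra l0 => /eqP <-; rewrite mem_nth.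
have es : size l1 = size l2.
  case: (ltngtP (size l1) (size l2)) => // lt.
    by have := sz l2 (size l1); rewrite lt -en nth_default.
  by have := sz l1 (size l2); rewrite lt en nth_default.
by apply: (@eq_from_nth _ 0%N) => // i _.
Qed.

Lemma nth_filter_nonincr (s : seq nat) i : sorted geq s ->
  nth 0%N [seq x <- s | x != 0%N] i = nth 0%N s i.
Proof.
have geq_tr : transitive geq by move=> a b c ba ac; exact: leq_trans ac ba.
elim: s i => // x s IH i /= ss; have {}IH j := IH j (path_sorted ss).
case: eqP => [x0|_] /=; last by case: i => //= i; rewrite IH.
have z j : nth 0%N s j = 0%N.
  case: (ltnP j (size s)) => [lt|/(nth_default 0%N) //].
  have := order_path_min geq_tr ss => /allP /(_ _ (mem_nth 0%N lt)) /=.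
  by rewrite x0 leqn0 => /eqP.
by rewrite IH z; case: i => [|i] //=; rewrite z.
Qed.

Lemma sorted_ltn_nth (s : seq nat) i j : sorted ltn s -> (i <= j < size s)%N ->
  (nth 0%N s i + (j - i) <= nth 0%N s j)%N.
Proof.
move=> ss /andP[le_ij]; rewrite -(subnKC le_ij) addKn.
elim: (j - i)%N => [|d IH]; first by rewrite !addn0.
rewrite addnS => lt_d; move/(sortedP 0%N): (ss) => /(_ _ lt_d) /= h.
by have := IH (ltnW lt_d); lia.
Qed.

Lemma beta_surj (A : {set I}) : #|A| = k ->
  exists l : ipartition, beta l = vals A /\ (size l <= k)%N.
Proof.
move=> cA; pose b := vals A; have sb : size b = k by rewrite size_vals.
pose c := mkseq (fun i => nth 0%N b (k - i.+1) - (k - i.+1))%N k.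
have ge i : (i < k)%N -> (i <= nth 0%N b i)%N.
  move=> lt_i; have := @sorted_ltn_nth b 0 i (vals_sorted A); rewrite sb lt_i leq0n subn0 => /(_ isT).
  lia.
have sc : sorted geq c.
  apply/(sortedP 0%N) => i; rewrite size_mkseq => lt_i; rewrite !nth_mkseq ?(ltnW lt_i) //=.
  have := @sorted_ltn_nth b (k - i.+2) (k - i.+1) (vals_sorted A); rewrite sb.
  have -> : (k - i.+2 <= k - i.+1 < k)%N by lia.
  move=> /(_ isT); lia.
have pc : is_part [seq x <- c | x != 0%N].
  rewrite /is_part mem_filter eqxx andbT; apply: sorted_filter sc.
  by move=> x y z yx xz; exact: leq_trans xz yx.
exists (IPartition pc); split; last first.
  by rewrite /= size_filter (leq_trans (count_size _ _)) // size_mkseq.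
apply: (@eq_from_nth _ 0%N); first by rewrite size_beta.
rewrite size_beta => i lt_i; rewrite /beta nth_rev size_mkseq // nth_mkseq /=; last by lia.
rewrite nth_filter_nonincr // nth_mkseq; last by lia.
have -> : (k - (k - i.+1).+1 = i)%N by lia.
by rewrite subnK // ge.
Qed.

Lemma sumn_beta (l : ipartition) : (size l <= k)%N ->
  sumn (beta l) = (psize l + 'C(k, 2))%N.
Proof.
move=> sl; rewrite /beta sumn_rev sumnE /mkseq big_map big_split /=.
rewrite -[X in iota 0 X]subn0 -/(index_iota 0 k) !big_mkord; congr (_ + _)%N.
  rewrite /psize sumnE [RHS](big_nth 0%N) big_mkord.
  rewrite (big_ord_widen _ (fun i => nth 0%N l i) sl) [RHS]big_mkcond.
  by apply: eq_bigr => i _; case: ltnP => // /(nth_default 0%N).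
by rewrite -[RHS]bin2_sum big_mkord [RHS](reindex_inj rev_ord_inj).
Qed.

Lemma sum_beta (l : ipartition) (G : nat -> rat) :
  \sum_(x <- beta l) G x = \sum_(i < k) G (nth 0%N l i + (k - i.+1))%N.
Proof.
rewrite /beta big_rev /= /mkseq big_map -[X in iota 0 X]subn0 -/(index_iota 0 k).
by rewrite big_mkord.
Qed.

(** The bounds make every partition of [m] fit: it has at most [m <= k] parts, and its largest beta
    number is at most [m + k - 1 <= M]. *)
Lemma sum_beta_sets m (Phi : {set I} -> rat) : (m <= k)%N -> (m + k <= M.+1)%N ->
  \sum_(A : {set I} | (#|A| == k) && (\sum_(a in A) (a : nat) == m + 'C(k, 2))%N) Phi A =
  \sum_(l <- partitions m) Phi (beta_set l).
Proof.
move=> le_mk le_M.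
have size_le (l : ipartition) : psize l = m -> (size l <= k)%N.
  by move=> pl; apply: leq_trans le_mk; rewrite -pl size_le_psize.
have fst_le (l : ipartition) : psize l = m -> (nth 0%N l 0 + k <= M.+1)%N.
  move=> pl; apply: leq_trans le_M; rewrite -pl leq_add2r /psize.
  by case: (l : seq nat) => //= x s; rewrite leq_addr.
have inj : {in partitions m &, injective (fun l : ipartition => beta_set l)}.
  move=> l1 l2; rewrite !mem_partitions => /eqP p1 /eqP p2 e.
  by apply: beta_inj; rewrite ?size_le // -!beta_vals ?fst_le // e.
rewrite -[RHS](big_map (fun l : ipartition => beta_set l) xpredT) -[LHS]big_filter.
apply: perm_big; apply: uniq_perm.
- by rewrite filter_uniq // index_enum_uniq.
- by rewrite map_inj_in_uniq // partitions_uniq.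
move=> A; rewrite mem_filter mem_index_enum andbT; apply/andP/mapP => [[/eqP cA]|[l]].
  have [l [bl szl]] := beta_surj cA; rewrite sumn_vals -bl sumn_beta // eqn_add2r => pl.
  exists l; first by rewrite mem_partitions.
  by apply: vals_inj; rewrite beta_vals ?bl // fst_le //; apply/eqP.
rewrite mem_partitions => /eqP pl ->; rewrite -size_vals sumn_vals !beta_vals ?fst_le //.
by rewrite size_beta eqxx sumn_beta ?size_le // pl.
Qed.

End BetaSets.

(** * Exponential series and the generating series of the Q_k *)

Definition ex (c : rat) : FPS := fps_exp c.
Definition Zv : FPS := fun n => (n == 1%N)%:R.
Definition bern : FPS := fps_bernoulli.
Definition Qs (l : ipartition) : FPS := fun k => Qfun k (evseq_of_partition l).
Local Notation half := (2%:R^-1 : rat).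

Lemma ex0 : ex 0 = 1.
Proof.
apply: fpsP => n; rewrite fps1 /ex /fps_exp expr0n; case: n => [|n] //=.
by rewrite mul0r.
Qed.

Lemma exM a b : ex a * ex b = ex (a + b).
Proof.
apply: fpsP => n; rewrite fpsM /ex /fps_exp addrC exprDn mulr_suml; apply: eq_bigr => i _.
have le_i : (i <= n)%N by rewrite -ltnS.
rewrite -[_ *+ 'C(n, i)]mulr_natr.
have := bin_fact le_i => /(congr1 (fun m : nat => m%:R : rat)); rewrite !natrM => e.
have i0 : i`!%:R != 0 :> rat by rewrite pnatr_eq0 -lt0n fact_gt0.
have ni0 : (n - i)`!%:R != 0 :> rat by rewrite pnatr_eq0 -lt0n fact_gt0.
have n0 : n`!%:R != 0 :> rat by rewrite pnatr_eq0 -lt0n fact_gt0.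
have -> : 'C(n, i)%:R = n`!%:R / (i`!%:R * (n - i)`!%:R) :> rat.
  by rewrite -e mulfK // mulf_neq0.
move: (a ^+ i) (b ^+ (n - i)) (i`!%:R : rat) ((n - i)`!%:R : rat) (n`!%:R : rat) i0 ni0 n0.
by move=> x y u v w u0 v0 w0; field; rewrite ?u0 ?v0 ?w0.
Qed.

Lemma ZvM a n : (Zv * a) n = fps_mulX a n.
Proof.
rewrite fpsM; case: n => [|n]; first by rewrite big_ord1 mul0r.
rewrite big_ord_recl mul0r add0r big_ord_recl /= mul1r subSS subn0 big1 ?addr0 //.
by move=> i _; rewrite mul0r.
Qed.

Lemma bern_sinh : bern * (ex half - ex (- half)) = Zv.
Proof.
pose s : FPS := fun n => fps_exp half n.+1 - fps_exp (- half) n.+1.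
have -> : ex half - ex (- half) = Zv * s.
  apply: fpsP => n; by rewrite ZvM fpsD fpsN /ex; case: n.
have s0 : s 0%N != 0 by vm_compute.
by rewrite mulrCA /bern /fps_bernoulli [_ * s]mulrC (fps_mulVr s0) mulr1.
Qed.

Lemma QsE (l : ipartition) K : (size l <= K)%N ->
  Qs l = bern + Zv * \sum_(i < K) (ex ((nth 0%N l i)%:R - i.+1%:R + half) - ex (- i.+1%:R + half)).
Proof.
move=> le_K; apply: fpsP => k; rewrite /Qs /Qfun /=.
rewrite -[LHS]/((ex 0 * _) k) ex0 mul1r fpsD; congr (_ + _).
rewrite ZvM /fps_mulX; case: k => // k; rewrite fps_sum.
rewrite (big_ord_widen _ (fun i => fps_exp ((nth 0%N l i)%:~R - 0%:~R - i.+1%:R + half) k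
            - fps_exp (- i.+1%:R + half) k) le_K) big_mkcond; apply: eq_bigr => i _.
case: ltnP => [_|/(nth_default 0%N) ->]; first by rewrite subr0.
by rewrite fpsD fpsN sub0r subrr.
Qed.

(** The exponents on the right are the elements of the beta set minus [N], and the first term
    depends neither on [K] nor on the partition. Beta sets of different sizes thus become
    comparable. *)
Lemma shifted_Qs (l : ipartition) (N K : nat) (c : rat) :
  (size l <= K)%N -> c = K%:R - N%:R ->
  ex (c - half) * Qs l = ex (- N%:R - half) * bern
    + Zv * \sum_(i < K) ex ((nth 0%N l i + (K - i.+1))%:R - N%:R).
Proof.
move=> le_K ->; rewrite (QsE le_K) mulrDr mulrCA.
(* Lowering the exponent in front of the Bernoulli series by 1 releases one exponential, because
   [bern] times [e^(z/2) - e^(-z/2)] is [z]. *)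
have tele m : (m <= K)%N ->
    ex (K%:R - N%:R - half) * bern = ex (K%:R - m%:R - N%:R - half) * bern
      + Zv * \sum_(i < m) ex (K%:R - i.+1%:R - N%:R).
  elim: m => [|m IH] le_m; first by rewrite big_ord0 subr0 mulr0 addr0.
  rewrite (IH (ltnW le_m)) big_ord_recr /= mulrDr addrA addrAC; congr (_ + _).
  pose c0 : rat := K%:R - m.+1%:R - N%:R.
  have -> : Zv * ex c0 = bern * (ex half * ex c0 - ex (- half) * ex c0).
    by rewrite -bern_sinh; ring.
  rewrite !exM /c0.
  have -> : half + (K%:R - m.+1%:R - N%:R) = K%:R - m%:R - N%:R - half :> rat.
    by rewrite -natr1; field.
  have -> : - half + (K%:R - m.+1%:R - N%:R) = K%:R - m.+1%:R - N%:R - half :> rat by ring.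
  ring.
rewrite (tele K) // subrr sub0r -addrA -mulrDr; congr (_ + _ * _).
rewrite mulr_sumr -big_split; apply: eq_bigr => i _ /=.
rewrite mulrBr !exM natrD natrB //.
have -> : K%:R - N%:R - half + (- i.+1%:R + half) = K%:R - i.+1%:R - N%:R :> rat by ring.
rewrite addrC subrK; congr (ex _); ring.
Qed.

Lemma toggle_sum (T : finType) (z : T) (F : {set T} -> rat) :
  (forall A : {set T}, z \notin A -> F (z |: A) = - F A) -> \sum_(A : {set T}) F A = 0.
Proof.
move=> hF; pose h (A : {set T}) := if z \in A then A :\ z else z |: A.
have hK : involutive h.
  move=> A; rewrite /h; case: (boolP (z \in A)) => zA; first by rewrite setD11 setD1K.
  by rewrite setU11 setU1K.
have hh A : F (h A) = - F A.
  rewrite /h; case: ifP => zA; last by rewrite hF ?zA.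
  by rewrite -{2}(setD1K zA) hF ?opprK // setD11.
have : \sum_(A : {set T}) F A = - \sum_(A : {set T}) F A.
  rewrite {1}(reindex_inj (inv_inj hK)) -sumrN; apply: eq_bigr => A _; exact: hh.
by move=> e; lra.
Qed.

(* c(c-1)/2 for c = k - N *)
Definition tri (N k : nat) : nat := ('C(k - N, 2) + 'C((N - k).+1, 2))%N.

(** Translates the condition [wt] on a subset with [k] elements into the size of the partition it
    encodes. *)
Lemma triE N k : ('C(k, 2) + 'C(N.+1, 2) = N * k + tri N k)%N.
Proof.
have b2 m : ('C(m.+1, 2) * 2 = m * m.+1)%N.
  by rewrite bin2 /= muln2 -[RHS]odd_double_half oddM /= andbN add0n mulnC.
have b2' m : ('C(m, 2) * 2 = m * m.-1)%N by case: m => // m; rewrite b2 mulnC.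
suff : (('C(k, 2) + 'C(N.+1, 2)) * 2 = (N * k + tri N k) * 2)%N by lia.
move: (b2 N) (b2' k) (b2' (k - N)%N) (b2 (N - k)%N); rewrite /tri.
move: 'C(N.+1, 2) 'C(k, 2) 'C(k - N, 2) 'C((N - k).+1, 2) => C1 C2 C3 C4.
case: (leqP N k) => le.
  rewrite -(subnKC le); set d := (k - N)%N; rewrite addKn.
  have -> : (N - (N + d) = 0)%N by lia.
  by move=> h1 h2 h3 h4; case: d h2 h3 => [|d]; case: N {le} h1 => [|N'] /=; nia.
have -> : (k - N = 0)%N by lia.
rewrite -(subnKC (ltnW le)) addKn; move: (N - k)%N => d.
by move=> h1 h2 h3 h4; case: k {le} h1 h2 => [|k'] /=; nia.
Qed.

(** * The toggle identity *)

Section Toggle.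
Context (n : nat) (F : FPS -> rat).
Context (F2 : forall a b : FPS, (forall j, (1 < j)%N -> a j = b j) -> F a = F b).
(** Large enough that for each charge [c] with [c(c-1)/2 <= n] the partitions involved fit into
    [2 N] positions; even, so that [(-1)^k] is also the sign of the charge [k - N]. *)
Let N := (2 * n + 2)%N.
Let M := (2 * N).-1.

Definition charge (k : nat) : rat := k%:R - N%:R.

(** Sum over all subsets of fixed energy. Adding or removing the element [N], whose exponent is 0,
    reverses the sign and changes the series only in degree 1, which [F] does not see. *)
Lemma toggle_identity :
  \sum_(k < (2 * N).+1) (-1) ^+ k * (if (tri N k <= n)%N then
     \sum_(l <- partitions (n - tri N k)) F (ex (charge k - half) * Qs l) else 0) = 0.
Proof.
have lt_N : (N < M.+1)%N by rewrite /M /N; lia.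
pose z : 'I_M.+1 := Ordinal lt_N.
pose kap := ex (- N%:R - half) * bern.
pose Y (A : {set 'I_M.+1}) : FPS := kap + Zv * \sum_(a in A) ex ((a : nat)%:R - N%:R).
(* Unchanged when [N] is added to [A], as both sides grow by [N]. *)
pose wt (A : {set 'I_M.+1}) := (\sum_(a in A) (a : nat) + 'C(N.+1, 2) == n + N * #|A|)%N.
have tog : \sum_(A : {set 'I_M.+1}) (if wt A then (-1) ^+ #|A| * F (Y A) else 0) = 0.
  apply: (@toggle_sum _ z) => A zA.
  have -> : wt (z |: A) = wt A.
    rewrite /wt big_setU1 //= cardsU1 zA mulnDr muln1.
    move: (\sum_(a in A) _)%N (N * #|A|)%N 'C(N.+1, 2) => S X C.
    by apply/eqP/eqP; lia.
  case: ifP => _; last by rewrite oppr0.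
  rewrite cardsU1 zA add1n exprS mulN1r mulNr; congr (- (_ * _)).
  apply: F2 => j j1; rewrite /Y big_setU1 //= subrr ex0 mulrDr mulr1 addrCA fpsD.
  by rewrite /Zv (gtn_eqF j1) add0r.
rewrite -[RHS]tog (partition_big (fun A : {set 'I_M.+1} => inord #|A| : 'I_(2 * N).+1) xpredT) //=.
apply: eq_bigr => k _.
have cardE (A : {set 'I_M.+1}) : (inord #|A| == k) = (#|A| == k).
  rewrite -val_eqE /= inordK // ltnS (leq_trans (max_card _)) // card_ord /M /N; lia.
under [RHS]eq_bigl do rewrite cardE.
rewrite -big_mkcondr /=.
rewrite (eq_bigl (fun A : {set 'I_M.+1} => (#|A| == k) &&
    (\sum_(a in A) (a : nat) + tri N k == n + 'C(k, 2))%N)); last first.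
  move=> A; case: eqP => //= cA; rewrite /wt cA.
  have := triE N k; set X := (\sum_(a in A) _)%N; lia.
case: leqP => le_t; last first.
  rewrite mulr0 big_seq_cond big1 // => A /and3P[_ /eqP cA /eqP e]; exfalso.
  have h : ('C(k, 2) <= \sum_(a in A) (a : nat))%N.
    have [l [bl sl]] := beta_surj cA.
    by rewrite sumn_vals -bl sumn_beta // leq_addl.
  lia.
pose m := (n - tri N k)%N.
(* The energy bound leaves only charges of absolute value at most [n + 1]. *)
have ht : (k <= N + n.+1)%N /\ (N <= k + n.+1)%N.
  have b2 a : (a <= 'C(a.+1, 2))%N by rewrite binS bin1 leq_addl.
  have := b2 (N - k)%N; have : (k - N <= 'C(k - N, 2).+1)%N.
    case: (k - N)%N => // a; exact: (leq_trans (b2 a)).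
  rewrite /tri in le_t; lia.
have le_mk : (m <= k)%N by rewrite /m /N in ht *; lia.
have le_M : (m + k <= M.+1)%N by rewrite /m /M /N in ht *; lia.
rewrite (eq_bigl (fun A : {set 'I_M.+1} => (#|A| == k) &&
    (\sum_(a in A) (a : nat) == m + 'C(k, 2))%N)); last first.
  by move=> A; congr (_ && _); rewrite /m; set X := (\sum_(a in A) _)%N; lia.
rewrite (eq_bigr (fun A => (-1) ^+ k * F (Y A))); last by move=> A /andP[/eqP ->].
rewrite (sum_beta_sets (fun A => (-1) ^+ k * F (Y A)) le_mk le_M) -mulr_sumr.
congr (_ * _); apply: eq_big_seq => l; rewrite mem_partitions => /eqP pl.
congr F; have szl : (size l <= k)%N.
  by apply: leq_trans le_mk; rewrite /m -pl size_le_psize.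
rewrite (shifted_Qs szl (erefl : charge k = _)) /Y; congr (_ + _ * _).
apply: fpsP => j; rewrite !fps_sum.
rewrite (sum_vals _ (fun a => ex (a%:R - N%:R) j)) beta_vals ?sum_beta //.
apply: leq_trans le_M; rewrite leq_add2r /m -pl /psize.
by case: (l : seq nat) => //= x s; rewrite leq_addr.
Qed.

End Toggle.

(** * The formal ring of quasimodular forms *)

Section CoefDer.
Context (S : comNzRingType) (d : S -> S).
Context (dD : forall x y, d (x + y) = d x + d y).
Context (dM : forall x y, d (x * y) = d x * y + x * d y).
Implicit Types (p q : {poly S}).

Let d0 : d 0 = 0. Proof. by apply: (addrI (d 0)); rewrite -dD !addr0. Qed.
Let d1 : d 1 = 0.
Proof. by apply: (addrI (d 1)); rewrite addr0 -{3}[1]mulr1 dM mulr1 mul1r. Qed.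

Definition cder p : {poly S} := map_poly d p.

Lemma coef_cder p i : (cder p)`_i = d p`_i.
Proof. by rewrite coef_map_id0. Qed.

Lemma cderD p q : cder (p + q) = cder p + cder q.
Proof. by apply/polyP => i; rewrite coefD !coef_cder coefD dD. Qed.

Lemma cderC c : cder c%:P = (d c)%:P.
Proof. by apply/polyP => i; rewrite coef_cder !coefC; case: eqP. Qed.

Lemma cderX : cder 'X = 0.
Proof. by apply/polyP => i; rewrite coef_cder coefX coef0; case: eqP. Qed.

Let dsum (I : Type) (r : seq I) (F : I -> S) : d (\sum_(i <- r) F i) = \sum_(i <- r) d (F i).
Proof. by elim: r => [|i r IH]; rewrite ?big_nil ?d0 // !big_cons dD IH. Qed.

Lemma cderM p q : cder (p * q) = cder p * q + p * cder q.
Proof.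
apply/polyP => i; rewrite coef_cder coefD !coefM dsum -big_split /=.
by apply: eq_bigr => j _; rewrite dM !coef_cder.
Qed.

Lemma cder_deriv p : (cder p)^`() = cder p^`().
Proof.
apply/polyP => i; rewrite coef_deriv !coef_cder coef_deriv.
by move: p`_i.+1 => x; elim: i.+1 => [|m IH]; rewrite ?mulr0n ?d0 // !mulrS dD IH.
Qed.
End CoefDer.

(* The formal algebra rat[Q, R] = Bf, with outer variable R, and
   rat[P, Q, R] = Af, with outer variable P. *)
Notation Bf := {poly {poly rat}}.
Notation Af := {poly Bf}.

Definition vQ : Bf := ('X)%:P.
Definition vR : Bf := 'X.
Definition dQB (g : Bf) : Bf := cder (@deriv rat) g.

Lemma dQBD g h : dQB (g + h) = dQB g + dQB h.
Proof. by apply: cderD; exact: derivD. Qed.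
Lemma dQBM g h : dQB (g * h) = dQB g * h + g * dQB h.
Proof. by apply: cderM; [exact: derivD | exact: derivM]. Qed.
Lemma dQB_Q : dQB vQ = 1.
Proof. by rewrite /dQB cderC ?derivX //; exact: derivD. Qed.
Lemma dQB_R : dQB vR = 0.
Proof. by apply: cderX; [exact: derivD | exact: derivM]. Qed.
Lemma dRB_Q : vQ^`() = 0. Proof. exact: derivC. Qed.
Lemma dRB_R : vR^`() = 1. Proof. exact: derivX. Qed.

(* WB is the weight derivation, thB is 12 times the Serre derivative. *)
Definition WB : Bf -> Bf := locked (fun g => 4%:R * vQ * dQB g + 6%:R * vR * g^`()).
Definition thB : Bf -> Bf :=
  locked (fun g => - (4%:R * vR * dQB g) - 6%:R * vQ ^+ 2 * g^`()).

Lemma WBE g : WB g = 4%:R * vQ * dQB g + 6%:R * vR * g^`().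
Proof. by rewrite /WB -lock. Qed.
Lemma thBE g : thB g = - (4%:R * vR * dQB g) - 6%:R * vQ ^+ 2 * g^`().
Proof. by rewrite /thB -lock. Qed.

Lemma WBD g h : WB (g + h) = WB g + WB h.
Proof. by rewrite !WBE dQBD derivD; ring. Qed.
Lemma WBM g h : WB (g * h) = WB g * h + g * WB h.
Proof. by rewrite !WBE dQBM derivM; ring. Qed.
Lemma thBD g h : thB (g + h) = thB g + thB h.
Proof. by rewrite !thBE dQBD derivD; ring. Qed.
Lemma thBM g h : thB (g * h) = thB g * h + g * thB h.
Proof. by rewrite !thBE dQBM derivM; ring. Qed.
Lemma WB_Q : WB vQ = 4%:R * vQ. Proof. by rewrite !WBE dQB_Q dRB_Q; ring. Qed.
Lemma WB_R : WB vR = 6%:R * vR. Proof. by rewrite !WBE dQB_R dRB_R; ring. Qed.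
Lemma thB_Q : thB vQ = - (4%:R * vR). Proof. by rewrite !thBE dQB_Q dRB_Q; ring. Qed.
Lemma thB_R : thB vR = - (6%:R * vQ ^+ 2). Proof. by rewrite !thBE dQB_R dRB_R; ring. Qed.

Local Notation mW := (cder WB).
Local Notation mth := (cder thB).
Local Notation P := ('X : Af).

(* 12 times Ramanujan's derivation, and the weight derivation. *)
Definition DA : Af -> Af :=
  locked (fun a => a^`() * (P ^+ 2 - vQ%:P) + P * mW a + mth a).
Definition WA : Af -> Af := locked (fun a => 2%:R * P * a^`() + mW a).

Lemma DAE a : DA a = a^`() * (P ^+ 2 - vQ%:P) + P * mW a + mth a.
Proof. by rewrite /DA -lock. Qed.
Lemma WAE a : WA a = 2%:R * P * a^`() + mW a.
Proof. by rewrite /WA -lock. Qed.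

Local Definition mWD := cderD WBD.
Local Definition mWM := cderM WBD WBM.
Local Definition mthD := cderD thBD.
Local Definition mthM := cderM thBD thBM.

Lemma DAD a b : DA (a + b) = DA a + DA b.
Proof. by rewrite !DAE derivD mWD mthD; ring. Qed.
Lemma DAM a b : DA (a * b) = DA a * b + a * DA b.
Proof. by rewrite !DAE derivM mWM mthM; ring. Qed.
Lemma WAD a b : WA (a + b) = WA a + WA b.
Proof. by rewrite !WAE derivD mWD; ring. Qed.
Lemma WAM a b : WA (a * b) = WA a * b + a * WA b.
Proof. by rewrite !WAE derivM mWM; ring. Qed.

Lemma mWX : mW P = 0. Proof. exact: cderX WBD WBM. Qed.
Lemma mthX : mth P = 0. Proof. exact: cderX thBD thBM. Qed.
Lemma DA_P : DA P = P ^+ 2 - vQ%:P.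
Proof. by rewrite !DAE derivX mWX mthX mulr0 mul1r !addr0. Qed.
Lemma WA_P : WA P = 2%:R * P.
Proof. by rewrite !WAE derivX mWX mulr1 addr0. Qed.
Lemma DA_C g : DA g%:P = P * (WB g)%:P + (thB g)%:P.
Proof. by rewrite !DAE derivC mul0r add0r (cderC WBD) (cderC thBD). Qed.
Lemma WA_C g : WA g%:P = (WB g)%:P.
Proof. by rewrite !WAE derivC mulr0 add0r (cderC WBD). Qed.

(** With [WA_DA] and [deriv_WA] this says that d/dP, [DA] and the weight [WA] form an sl2-triple;
    the elimination of relations between P, Q and R rests on it. *)
Lemma deriv_DA a : (DA a)^`() = DA a^`() + WA a.
Proof.
rewrite !DAE WAE expr2 !(derivD, derivN, derivM, derivX, derivC) (cder_deriv WBD) (cder_deriv thBD).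
by ring.
Qed.

Lemma WBc (c : rat) : WB c%:P%:P = 0.
Proof. by rewrite !WBE /dQB (cderC (@derivD _)) !derivC rmorph0; ring. Qed.
Lemma thBc (c : rat) : thB c%:P%:P = 0.
Proof. by rewrite !thBE /dQB (cderC (@derivD _)) !derivC rmorph0; ring. Qed.

Lemma Bf_ind (K : Bf -> Prop) : (forall g h, K g -> K h -> K (g + h)) ->
  (forall c : rat, K c%:P%:P) -> (forall g, K g -> K (g * vQ)) ->
  (forall g, K g -> K (g * vR)) -> forall g, K g.
Proof.
move=> KD KC KQ KR; elim/poly_ind => [|g c Kg]; first by have := KC 0; rewrite !rmorph0.
apply: (KD); first exact: KR.
elim/poly_ind: c => [|c e Kc]; first by have := KC 0; rewrite !rmorph0.
by rewrite polyCD polyCM; apply: (KD) => //; apply: KQ.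
Qed.

Lemma Af_ind (K : Af -> Prop) : (forall a b, K a -> K b -> K (a + b)) ->
  (forall c : rat, K c%:P%:P%:P) -> (forall a, K a -> K (a * P)) ->
  (forall a, K a -> K (a * vQ%:P)) -> (forall a, K a -> K (a * vR%:P)) -> forall a, K a.
Proof.
move=> KD KC KP KQ KR; elim/poly_ind => [|a g Ka]; first by have := KC 0; rewrite !rmorph0.
apply: (KD); first exact: KP.
elim/Bf_ind: g => [g h Kg Kh|c|g Kg|g Kg].
- by rewrite polyCD; apply: KD.
- exact: KC.
- by rewrite polyCM; apply: KQ.
by rewrite polyCM; apply: KR.
Qed.

Lemma WAc (c : rat) : WA c%:P%:P%:P = 0.
Proof. by rewrite WA_C WBc rmorph0. Qed.
Lemma DAc (c : rat) : DA c%:P%:P%:P = 0.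
Proof. by rewrite DA_C WBc thBc rmorph0 mulr0 addr0. Qed.

Lemma WA0 : WA 0 = 0. Proof. by have := WAc 0; rewrite !rmorph0. Qed.
Lemma DA0 : DA 0 = 0. Proof. by have := DAc 0; rewrite !rmorph0. Qed.
Lemma WAN a : WA (- a) = - WA a.
Proof. by apply/eqP; rewrite -addr_eq0 -WAD addNr WA0. Qed.
Lemma WAnat n : WA n%:R = 0.
Proof. by have := WAc n%:R; rewrite !rmorph_nat. Qed.
Lemma DAnat n : DA n%:R = 0.
Proof. by have := DAc n%:R; rewrite !rmorph_nat. Qed.
Lemma polyCn n : (n%:R : Bf)%:P = n%:R :> Af. Proof. exact: rmorph_nat. Qed.

Lemma WA_DA a : WA (DA a) = DA (WA a) + 2%:R * DA a.
Proof.
elim/Af_ind: a => [a b ha hb|c|a ha|a ha|a ha].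
- by rewrite !(WAD, DAD) ha hb; ring.
- by rewrite WAc DAc WA0 DA0; ring.
- rewrite !(WAM, DAM, WAD, DAD) ha WA_P DA_P !(WAD, WAN, DAM, expr2, WAM, DAnat) WA_P DA_P WA_C WB_Q.
  by rewrite polyCM polyCn; ring.
- rewrite !(WAM, DAM, WAD, DAD) ha WA_C DA_C WB_Q thB_Q !polyCN !polyCM !polyCn.
  rewrite !(WAD, WAN, WAM, DAM, DAnat, WAnat) WA_P !WA_C DA_C WB_Q WB_R thB_Q !polyCN !polyCM !polyCn.
  by ring.
rewrite !(WAM, DAM, WAD, DAD) ha WA_C DA_C WB_R thB_R !polyCN !polyCM !polyCn.
rewrite !(WAD, WAN, WAM, DAM, DAnat, WAnat) WA_P !WA_C DA_C WB_Q WB_R thB_R !polyCN !polyCM !polyCn.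
by ring.
Qed.

(** * Evaluation at the Eisenstein series *)

Definition evQ : {rmorphism {poly rat} -> FPS} := horner_alg Qser.
Lemma evQ_comm : commr_rmorph evQ Rser. Proof. by move=> x; apply: mulrC. Qed.
Definition evB : {rmorphism Bf -> FPS} := horner_morph evQ_comm.
Lemma evB_comm : commr_rmorph evB Pser. Proof. by move=> x; apply: mulrC. Qed.
Definition ev : {rmorphism Af -> FPS} := horner_morph evB_comm.

Lemma ev_C g : ev g%:P = evB g. Proof. exact: horner_morphC. Qed.
Lemma ev_P : ev P = Pser. Proof. exact: horner_morphX. Qed.
Lemma evB_R : evB vR = Rser. Proof. exact: horner_morphX. Qed.
Lemma evB_Q : evB vQ = Qser.
Proof.
rewrite -[LHS]/(horner_morph evQ_comm vQ) horner_morphC.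
by rewrite -[LHS]/(horner_alg Qser 'X) horner_algX.
Qed.
Lemma evB_c (c : rat) : evB c%:P%:P = c *: 1.
Proof.
rewrite -[LHS]/(horner_morph evQ_comm c%:P%:P) horner_morphC.
by rewrite -[LHS]/(horner_alg Qser c%:P) horner_algC.
Qed.
Lemma ev_c (c : rat) : ev c%:P%:P%:P = c *: 1.
Proof. by rewrite ev_C evB_c. Qed.

Lemma ev_DA a : ev (DA a) = 12%:R * fD (ev a).
Proof.
elim/Af_ind: a => [a b ha hb|c|a ha|a ha|a ha].
- by rewrite DAD !rmorphD /= ha hb linearD mulrDr.
- by rewrite DAc rmorph0 ev_c linearZ /= fD1 scaler0 mulr0.
- rewrite DAM rmorphD !rmorphM /= ha ev_P fDM DA_P rmorphB rmorphXn /= ev_P ev_C evB_Q -ramanujanP.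
  by ring.
- rewrite DAM rmorphD !rmorphM /= ha !ev_C evB_Q fDM DA_C rmorphD rmorphM /= ev_P !ev_C WB_Q thB_Q.
  rewrite rmorphN !rmorphM !rmorph_nat /= evB_R evB_Q.
  have -> : Pser * (4%:R * Qser) + - (4%:R * Rser) = 4%:R * (3%:R * fD Qser) by rewrite ramanujanQ; ring.
  by ring.
rewrite DAM rmorphD !rmorphM /= ha !ev_C evB_R fDM DA_C rmorphD rmorphM /= ev_P !ev_C WB_R thB_R.
rewrite rmorphN !rmorphM !rmorph_nat /= evB_R evB_Q.
have -> : Pser * (6%:R * Rser) + - (6%:R * (Qser * Qser)) = 6%:R * (2%:R * fD Rser) by rewrite ramanujanR; ring.
by ring.
Qed.

(* S_k = (2 DA + 3 P)^k 1 = 24^k (D + P/8)^k 1, the normalised Taylor coefficients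
   of the theta function. *)
Fixpoint SA (k : nat) : Af := if k is k'.+1 then 2%:R * DA (SA k') + 3%:R * P * SA k' else 1.

Lemma WA_SA k : WA (SA k) = (2 * k)%:R * SA k.
Proof.
elim: k => [|k IH] /=; first by have := WAnat 1; rewrite mulr1n => ->; rewrite mul0r.
rewrite WAD !WAM !WAnat WA_DA IH WA_P DAM DAnat !natrM -!natr1; ring.
Qed.

(** Commuting d/dP past one factor [2 DA + 3 P] leaves [2 WA + 3], which acts on [SA j] by
    [4 j + 3]; for [j < k] these numbers add up to [k (2 k + 1)]. *)
Lemma deriv_SA k : (SA k)^`() = (k * (2 * k).+1)%:R * SA k.-1.
Proof.
elim: k => [|k IH]; first by rewrite /= derivC mul0r.
rewrite /= derivD !derivM deriv_DA IH WA_SA derivX -!polyCn !derivC !polyCn DAM DAnat.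
case: k {IH} => [|k]; first by rewrite /= (_ : DA 1 = 0) ?(DAnat 1) //; ring.
rewrite -[k.+1.-1]/k.
have := erefl (SA k.+1); rewrite [in LHS]/SA -/SA; move: (SA k.+1) => s <-; ring.
Qed.

(** The series of [(-1)^s (s + 1/2)^i q^(s(s+1)/2)] over [s >= 0]. Cutting at [s <= m] loses nothing
    since [s <= s(s+1)/2]. *)
Definition theta (i : nat) : FPS := fun m =>
  \sum_(s < m.+1 | 'C(s.+1, 2) == m) (-1) ^+ s * (s%:R + 2%:R^-1) ^+ i.

Lemma theta_mul i (u : FPS) n N : (n < N)%N -> (theta i * u) n =
  \sum_(s < N) (if ('C(s.+1, 2) <= n)%N then
     (-1) ^+ s * (s%:R + 2%:R^-1) ^+ i * u (n - 'C(s.+1, 2))%N else 0).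
Proof.
move=> lt_N; pose t s : rat := (-1) ^+ s * (s%:R + 2%:R^-1) ^+ i.
have leb s : (s <= 'C(s.+1, 2))%N by rewrite binS bin1 leq_addl.
have te (m : 'I_n.+1) : theta i m = \sum_(s < N | 'C(s.+1, 2) == m) t s.
  have le : (m.+1 <= N)%N by apply: leq_trans lt_N; rewrite ltn_ord.
  rewrite /theta (big_ord_widen_cond N (fun s => 'C(s.+1, 2) == m) t le).
  apply: eq_bigl => s; case: eqP => //= em; have := leb s; rewrite em => h.
  by rewrite ltnS h.
rewrite fpsM; under eq_bigr => m _ do rewrite te mulr_suml.
rewrite (exchange_big_dep xpredT) //=; apply: eq_bigr => s _.
case: leqP => le; last first.
  by rewrite big1 // => m /eqP em; have := ltn_ord m; rewrite -em ltnS leqNgt le.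
by rewrite (big_pred1 (Ordinal (le : ('C(s.+1, 2) < n.+1)%N))) //= => m; rewrite eq_sym.
Qed.

(** The heat equation: [(s + 1/2)^2 = 2 m + 1/4] for [m = s(s+1)/2]. *)
Lemma theta_rec i : theta i.+2 = 2%:R * fD (theta i) + 4%:R^-1 *: theta i.
Proof.
rewrite mulr_natl -scaler_nat; apply: fpsP => m.
rewrite fpsD !fpsZ /fD /theta !mulr_sumr -big_split /=.
apply: eq_bigr => s /eqP em.
have e : m%:R *+ 2 = (s%:R + 1) * s%:R :> rat.
  move: (s : nat) em => {}s em.
  rewrite -mulrnA muln2 -em bin2 even_halfK /= ?natrM ?natr1 //.
  by rewrite oddM /=; case: (odd s).
have -> : (s%:R + 2%:R^-1) ^+ i.+2 = (s%:R + 2%:R^-1) ^+ i * ((s%:R + 2%:R^-1) ^+ 2) :> rat.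
  by rewrite !exprS expr0; ring.
have -> : (s%:R + 2%:R^-1) ^+ 2 = m%:R *+ 2 + 4%:R^-1 :> rat by rewrite e; field.
by field.
Qed.

Lemma theta1_neq0 : theta 1 != 0.
Proof.
apply/eqP => /(congr1 (fun a : FPS => a 0%N)); rewrite /theta big_mkcond big_ord1 /=.
by move/eqP; rewrite fps0.
Qed.

Lemma sum_odd (V : nmodType) (G : nat -> V) K : (forall i, ~~ odd i -> G i = 0) ->
  \sum_(i < 2 * K) G i = \sum_(k < K) G (2 * k).+1.
Proof.
move=> G0; elim: K => [|K IH]; first by rewrite !big_ord0.
rewrite [RHS]big_ord_recr /= -IH mulnS addnC addn2 !big_ord_recr /=.
by rewrite (G0 (2 * K)%N) ?addr0 // oddM.
Qed.

Lemma fps_natZ n (x : FPS) : n%:R *: x = n%:R * x.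
Proof. by rewrite scaler_nat mulr_natl. Qed.

Lemma fps_scaleE c (x : FPS) : c *: x = (c *: 1) * x.
Proof. by rewrite -scalerAl mul1r. Qed.

Lemma sum_recl (V : nmodType) n (H : nat -> V) :
  \sum_(k < n.+1) H k = H 0%N + \sum_(k < n) H k.+1.
Proof. by rewrite big_ord_recl; congr (_ + _); apply: eq_bigr => i _; rewrite lift0. Qed.

(** * Evaluation of power series at real points *)

Local Notation real := Rdefinitions.R.
Local Notation ex_series := (@Series.ex_series Hierarchy.R_AbsRing Hierarchy.R_NormedModule).
Local Notation ex_series_ext := (@Series.ex_series_ext Hierarchy.R_AbsRing Hierarchy.R_NormedModule).

Section AbsSeries.
Implicit Types (a b : nat -> real).

Lemma RabsE (x : real) : Rbasic_fun.Rabs x = `|x|. Proof. by []. Qed.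

Definition abs_cvg a := ex_series (fun n => `|a n| : real).
Definition ser a : real := Series.Series a.

Lemma abs_cvg_ex a : abs_cvg a -> ex_series a.
Proof. exact: Series.ex_series_Rabs. Qed.

Lemma abs_cvg_le a b : (forall n, `|a n| <= b n) -> abs_cvg b -> abs_cvg a.
Proof.
move=> le /abs_cvg_ex; apply: (@Series.ex_series_le Hierarchy.R_AbsRing Hierarchy.R_CompleteNormedModule) => n; apply/RleP.
by have := le n; rewrite -{1}[ `|a n|]normr_id.
Qed.

Lemma abs_cvgZ c a : abs_cvg a -> abs_cvg (fun n => c * a n).
Proof.
move=> ca; apply: (ex_series_ext _ _ _ (@Series.ex_series_scal_l Hierarchy.R_AbsRing Hierarchy.R_NormedModule (`|c| : real) _ ca)) => n.
by rewrite [RHS]normrM.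
Qed.

Lemma serD a b : abs_cvg a -> abs_cvg b -> ser (fun n => a n + b n) = ser a + ser b.
Proof. by move=> /abs_cvg_ex ca /abs_cvg_ex cb; apply: Series.Series_plus. Qed.

Lemma serZ c a : ser (fun n => c * a n) = c * ser a.
Proof. exact: Series.Series_scal_l. Qed.

Lemma ser_ext a b : a =1 b -> ser a = ser b.
Proof. exact: Series.Series_ext. Qed.

Lemma abs_cvg_ext a b : a =1 b -> abs_cvg a -> abs_cvg b.
Proof. by move=> e; apply: ex_series_ext => n; rewrite e. Qed.

Lemma ser_le a b : (forall n, 0 <= a n <= b n) -> abs_cvg b -> ser a <= ser b.
Proof.
move=> le /abs_cvg_ex cb; apply/RleP; apply: Series.Series_le => // n.
by have /andP[/RleP ? /RleP ?] := le n.
Qed.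

Lemma ser0 : ser (fun=> 0) = 0.
Proof. by rewrite (@ser_ext _ (fun n => 0 * 0)) ?serZ ?mul0r // => n; rewrite mul0r. Qed.

Lemma abs_cvg_abs a : abs_cvg a -> abs_cvg (fun n => `|a n|).
Proof. by apply: ex_series_ext => n; rewrite [RHS]normr_id. Qed.

Lemma abs_cvg0 : abs_cvg (fun=> 0).
Proof.
have h : Rbasic_fun.Rabs 0 < 1 :> real by rewrite RabsE normr0.
apply: (@abs_cvg_ext (fun n => 0 * Rpow_def.pow 0 n)) => [n|]; first by rewrite mul0r.
apply: abs_cvgZ; apply: (ex_series_ext _ _ _ (Series.ex_series_geom 0 _)) => [n|].
  by rewrite RpowE [RHS]ger0_norm // exprn_ge0.
exact/RltP.
Qed.

Lemma ser_ge0 a : (forall n, 0 <= a n) -> abs_cvg a -> 0 <= ser a.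
Proof. by move=> a0 ca; rewrite -ser0; apply: ser_le => // n; rewrite lexx a0. Qed.

Lemma ser_norm a : abs_cvg a -> `|ser a| <= ser (fun n => `|a n|).
Proof. by move=> ca; apply/RleP; exact: Series.Series_Rabs. Qed.

Lemma abs_cvg_shift a : abs_cvg a -> abs_cvg (fun n => a n.+1).
Proof. by move=> ca; have := proj1 (@Series.ex_series_incr_1 Hierarchy.R_AbsRing Hierarchy.R_NormedModule _) ca. Qed.

Lemma abs_cvg_unshift a : abs_cvg (fun n => a n.+1) -> abs_cvg a.
Proof. by move=> ca; apply: (proj2 (@Series.ex_series_incr_1 Hierarchy.R_AbsRing Hierarchy.R_NormedModule _)). Qed.

Lemma ser_recl a : abs_cvg a -> ser a = a 0%N + ser (fun n => a n.+1).
Proof. by move/abs_cvg_ex; exact: Series.Series_incr_1. Qed.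

Lemma ser_partial n a : (forall n, 0 <= a n) -> abs_cvg a -> \sum_(i < n) a i <= ser a.
Proof.
elim: n a => [|n IH] a a0 ca; first by rewrite big_ord0 ser_ge0.
rewrite big_ord_recl ser_recl // lerD2l.
by apply: le_trans (IH _ _ (abs_cvg_shift ca)) => //.
Qed.

Definition cauchy a b n : real := \sum_(i < n.+1) a i * b (n - i)%N.

Lemma cauchyE a b n : Rfunctions.sum_f_R0 (fun k => a k * b (Nat.sub n k)) n = cauchy a b n.
Proof.
have h (F : nat -> real) m : Rfunctions.sum_f_R0 F m = \sum_(i < m.+1) F i.
  by elim: m => [|m IH]; rewrite ?big_ord1 // big_ord_recr -IH.
by rewrite h.
Qed.

Lemma abs_cvgM a b : abs_cvg a -> abs_cvg b -> abs_cvg (cauchy a b).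
Proof.
move=> ca cb; pose a' n := `|a n|; pose b' n := `|b n|.
have [ca' cb'] := (abs_cvg_abs ca, abs_cvg_abs cb).
apply: (@abs_cvg_le _ (cauchy a' b')) => [n|].
  by rewrite /cauchy (le_trans (ler_norm_sum _ _ _)) // ler_sum // => i _; rewrite normrM.
have h := Series.is_series_mult a' b' _ _ (Series.Series_correct _ ca) (Series.Series_correct _ cb) ca' cb'.
have ex : ex_series (cauchy a' b').
  by apply: (ex_series_ext _ _ _ (ex_intro _ _ h)) => n; rewrite cauchyE.
apply: (ex_series_ext _ _ _ ex) => n; rewrite [RHS]ger0_norm //.
by apply: sumr_ge0 => i _; apply: mulr_ge0; exact: normr_ge0.
Qed.

Lemma serM a b : abs_cvg a -> abs_cvg b -> ser (cauchy a b) = ser a * ser b.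
Proof.
move=> ca cb; apply: Series.is_series_unique.
apply: (@Series.is_series_ext Hierarchy.R_AbsRing Hierarchy.R_NormedModule _ _ _ (cauchyE a b)).
by apply: Series.is_series_mult => //; apply: Series.Series_correct; apply: abs_cvg_ex.
Qed.

Lemma geom_cvg (r : real) : `|r| < 1 -> abs_cvg (fun n => r ^+ n).
Proof.
move=> r1; have h : Rdefinitions.Rlt (Rbasic_fun.Rabs `|r|) 1 by apply/RltP; rewrite RabsE normr_id.
apply: (ex_series_ext _ _ _ (Series.ex_series_geom _ h)) => n.
by rewrite RpowE -normrX.
Qed.

Lemma ser_geom (r : real) : `|r| < 1 -> ser (fun n => r ^+ n) = (1 - r)^-1.
Proof.
move=> /RltP r1; rewrite -[RHS](Series.Series_geom r r1).
by apply: ser_ext => n; rewrite RpowE.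
Qed.

End AbsSeries.

(** * Series with coefficients of polynomial growth *)

Section Domination.
Implicit Types (u v : FPS).

Definition GG : FPS := fun=> 1.

Lemma GG_mul u n : (GG * u) n = \sum_(i < n.+1) u i.
Proof.
rewrite mulrC fpsM; apply: eq_bigr => i _; exact: mulr1.
Qed.

Lemma GG_ge0 K n : 0 <= (GG ^+ K) n.
Proof.
elim: K n => [|K IH] n; first by rewrite expr0 fps1 ler0n.
by rewrite exprS GG_mul sumr_ge0.
Qed.

Lemma GG_S K n : (GG ^+ K) n <= (GG ^+ K.+1) n.
Proof. by rewrite exprS GG_mul big_ord_recr /= lerDr sumr_ge0 // => i _; exact: GG_ge0. Qed.

Lemma GG_incr K n : (GG ^+ K.+1) n <= (GG ^+ K.+1) n.+1.
Proof. by rewrite exprS !GG_mul [leRHS]big_ord_recr /= lerDl GG_ge0. Qed.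

Lemma GG_mono K L n : (K <= L)%N -> (GG ^+ K) n <= (GG ^+ L) n.
Proof. by move/subnK <-; elim: (L - K)%N => // d IH; exact: le_trans IH (GG_S _ _). Qed.

Lemma fD_GG : fD GG = Zv * GG ^+ 2.
Proof.
apply: fpsP => -[|n]; rewrite ZvM /fD /fps_mulX; first by rewrite mul0r.
by rewrite expr2 GG_mul /GG mulr1 sumr_const card_ord.
Qed.

Lemma fD_GGX K : fD (GG ^+ K.+1) = K.+1%:R *: (Zv * GG ^+ K.+2).
Proof. by rewrite fDX fD_GG scaler_nat -mulr_natl -[K.+1.-1]/K !exprS; ring. Qed.

(** Growth is measured against powers of G = 1/(1 - q): products need no further estimate, and at a
    point [r] the bound becomes [C (1 - r)^(-K)]. *)
Definition dominated u := exists K (C : rat), 0 <= C /\ forall n, `|u n| <= C * (GG ^+ K) n.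

Lemma dominated_wide u K (C : rat) L : 0 <= C -> (K <= L)%N ->
  (forall n, `|u n| <= C * (GG ^+ K) n) -> forall n, `|u n| <= C * (GG ^+ L) n.
Proof. by move=> C0 le h n; apply: le_trans (h n) _; rewrite ler_wpM2l // GG_mono. Qed.

Lemma dominatedD u v : dominated u -> dominated v -> dominated (u + v).
Proof.
move=> [K [C [C0 hu]]] [L [C' [C0' hv]]]; exists (maxn K L), (C + C'); split=> [|n].
  exact: addr_ge0.
rewrite mulrDl fpsD; apply: le_trans (ler_normD _ _) _; apply: lerD.
  by apply: (dominated_wide C0 (leq_maxl _ _) hu).
by apply: (dominated_wide C0' (leq_maxr _ _) hv).
Qed.

Lemma dominatedM u v : dominated u -> dominated v -> dominated (u * v).
Proof.
move=> [K [C [C0 hu]]] [L [C' [C0' hv]]]; exists (K + L)%N, (C * C'); split=> [|n].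
  exact: mulr_ge0.
rewrite exprD !fpsM mulr_sumr; apply: le_trans (ler_norm_sum _ _ _) _.
apply: ler_sum => i _; rewrite normrM mulrACA ler_pM //.
Qed.

Lemma dominatedZ c u : dominated u -> dominated (c *: u).
Proof.
move=> [K [C [C0 hu]]]; exists K, (`|c| * C); split=> [|n]; first exact: mulr_ge0.
by rewrite fpsZ normrM -mulrA ler_wpM2l.
Qed.

Lemma dominated1 : dominated 1.
Proof.
by exists 0%N, 1; split=> // n; rewrite expr0 mul1r fps1 normr_nat.
Qed.

Lemma dominatedN u : dominated u -> dominated (- u).
Proof. by rewrite -scaleN1r; exact: dominatedZ. Qed.

Lemma dominatedX u n : dominated u -> dominated (u ^+ n).
Proof.
by move=> du; elim: n => [|n IH]; [exact: dominated1 | rewrite exprS; exact: dominatedM].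
Qed.

Lemma dominated_nat n u : dominated u -> dominated (n%:R * u).
Proof. by move=> du; rewrite mulr_natl -scaler_nat; exact: dominatedZ. Qed.

Lemma dominated_fD u : dominated u -> dominated (fD u).
Proof.
move=> [K [C [C0 hu]]]; exists K.+2, (C * K.+1%:R); split=> [|n]; first exact: mulr_ge0.
rewrite /fD normrM normr_nat.
apply: le_trans (ler_wpM2l (ler0n _ n) (dominated_wide C0 (leqnSn K) hu n)) _.
rewrite mulrCA -mulrA ler_wpM2l // -[X in X <= _]/(fD (GG ^+ K.+1) n) fD_GGX fpsZ ler_wpM2l //.
by rewrite ZvM /fps_mulX; case: n => [|n]; [exact: GG_ge0 | exact: GG_incr].
Qed.

Lemma dominated_le u v : (forall n, `|u n| <= `|v n|) -> dominated v -> dominated u.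
Proof.
move=> le [K [C [C0 hv]]]; exists K, C; split=> // n; exact: le_trans (le n) (hv n).
Qed.

(** [sigma_k(n)] is at most [n n^k], and [n^(k+1)] is the coefficient of [D^(k+1) G]. *)
Lemma dominated_sg k : dominated (sg k).
Proof.
apply: (@dominated_le _ (iter k.+1 fD GG)) => [n|]; last first.
  elim: k.+1 => [|j IH]; last exact: dominated_fD.
  by exists 1%N, 1; split=> // n; rewrite mul1r expr1 ger0_norm.
have -> : iter k.+1 fD GG n = n%:R ^+ k.+1.
  elim: k.+1 => [|j IH] //; by rewrite iterS /fD IH exprS.
case: n => [|n]; first by rewrite /sg /dsum normr0.
rewrite /sg /dsum ger0_norm ?sumr_ge0 // => [|d _]; last by rewrite exprn_ge0.
rewrite normrX normr_nat exprS.
have sz : (size (divisors n.+1) <= n.+1)%N.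
  rewrite -{2}(size_iota 1 n.+1) uniq_leq_size ?divisors_uniq // => d.
  by rewrite -dvdn_divisors // mem_iota => dv; rewrite (dvdn_gt0 _ dv) // add1n ltnS dvdn_leq.
apply: (@le_trans _ _ (\sum_(d <- divisors n.+1) n.+1%:R ^+ k)).
  rewrite big_seq [leRHS]big_seq; apply: ler_sum => d.
  by rewrite -dvdn_divisors // => /dvdn_leq le; rewrite lerXn2r ?nnegrE // ler_nat le.
rewrite big_const_seq count_predT iter_addr_0 -[X in X <= _]mulr_natl ler_wpM2r ?exprn_ge0 //.
by rewrite ler_nat.
Qed.

Lemma dominated_Pser : dominated Pser.
Proof. exact: dominatedD dominated1 (dominatedN (dominated_nat _ (dominated_sg _))). Qed.
Lemma dominated_Qser : dominated Qser.
Proof. exact: dominatedD dominated1 (dominated_nat _ (dominated_sg _)). Qed.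
Lemma dominated_Rser : dominated Rser.
Proof. exact: dominatedD dominated1 (dominatedN (dominated_nat _ (dominated_sg _))). Qed.

Lemma dominated_evB g : dominated (evB g).
Proof.
elim/Bf_ind: g => [g h hg hh|c|g hg|g hg].
- by rewrite rmorphD; exact: dominatedD.
- by rewrite evB_c; apply/dominatedZ/dominated1.
- by rewrite rmorphM /= evB_Q; apply: dominatedM => //; exact: dominated_Qser.
by rewrite rmorphM /= evB_R; apply: dominatedM => //; exact: dominated_Rser.
Qed.

End Domination.

(** * Values at a real point *)

Section Value.
Context (r : real).

Definition term (u : FPS) n : real := ratr (u n) * r ^+ n.
Definition conv u := abs_cvg (term u).
Definition qval u := ser (term u).

Lemma termD u v n : term (u + v) n = term u n + term v n.
Proof. by rewrite /term fpsD rmorphD mulrDl. Qed.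

Lemma termZ c u n : term (c *: u) n = ratr c * term u n.
Proof. by rewrite /term fpsZ rmorphM mulrA. Qed.

Lemma termM u v n : term (u * v) n = cauchy (term u) (term v) n.
Proof.
rewrite /term fpsM /cauchy rmorph_sum mulr_suml; apply: eq_bigr => i _.
have le : (i <= n)%N by rewrite -ltnS.
have -> : r ^+ n = r ^+ i * r ^+ (n - i) by rewrite -exprD subnKC.
by rewrite rmorphM /=; ring.
Qed.

Lemma qvalD u v : conv u -> conv v -> qval (u + v) = qval u + qval v.
Proof. by move=> cu cv; rewrite /qval (ser_ext (termD u v)) serD. Qed.
Lemma convZ c u : conv u -> conv (c *: u).
Proof. by move=> cu; apply: (abs_cvg_ext (fun n => esym (termZ c u n))); exact: abs_cvgZ. Qed.
Lemma qvalZ c u : qval (c *: u) = ratr c * qval u.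
Proof. by rewrite /qval (ser_ext (termZ c u)) serZ. Qed.
Lemma convM u v : conv u -> conv v -> conv (u * v).
Proof. by move=> cu cv; apply: (abs_cvg_ext (fun n => esym (termM u v n))); exact: abs_cvgM. Qed.
Lemma qvalM u v : conv u -> conv v -> qval (u * v) = qval u * qval v.
Proof. by move=> cu cv; rewrite /qval (ser_ext (termM u v)) serM. Qed.

Lemma term1S n : term 1 n.+1 = 0.
Proof. by rewrite /term fps1 rmorph0 mul0r. Qed.

Lemma conv1 : conv 1.
Proof.
by apply: abs_cvg_unshift; apply: (abs_cvg_ext _ abs_cvg0) => n; rewrite term1S.
Qed.

Lemma qval1 : qval 1 = 1.
Proof.
rewrite /qval (ser_recl conv1) (ser_ext term1S) ser0 addr0.
by rewrite /term fps1 rmorph1 mul1r expr0.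
Qed.

Lemma qvalN u : qval (- u) = - qval u.
Proof. by rewrite -scaleN1r qvalZ rmorphN rmorph1 mulN1r. Qed.

Lemma convX u n : conv u -> conv (u ^+ n).
Proof. by move=> cu; elim: n => [|n IH]; [exact: conv1 | rewrite exprS; exact: convM]. Qed.
Lemma qvalX u n : conv u -> qval (u ^+ n) = qval u ^+ n.
Proof.
move=> cu; elim: n => [|n IH]; first exact: qval1.
by rewrite !exprS qvalM ?IH //; exact: convX.
Qed.

Context (r0 : 0 <= r) (r1 : r < 1).

Lemma val_le u v : (forall n, 0 <= u n <= v n) -> conv v -> qval u <= qval v.
Proof.
move=> h cv; apply: ser_le => // n; have /andP[u0 uv] := h n.
have rn : 0 <= r ^+ n by rewrite exprn_ge0.
by rewrite /term mulr_ge0 ?ler0q //= ler_wpM2r // ler_rat.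
Qed.

Lemma termGG n : term GG n = r ^+ n.
Proof. by rewrite /term /GG rmorph1 mul1r. Qed.

Let rn1 : `|r| < 1. Proof. by rewrite ger0_norm. Qed.

Lemma conv_GG : conv GG.
Proof. exact: (abs_cvg_ext (fun n => esym (termGG n)) (geom_cvg rn1)). Qed.
Lemma val_GG : qval GG = (1 - r)^-1.
Proof. by rewrite /qval (ser_ext termGG) ser_geom. Qed.

Lemma dominated_term u K (C : rat) : (forall n, `|u n| <= C * (GG ^+ K) n) ->
  forall n, `|term u n| <= term (C *: GG ^+ K) n.
Proof.
move=> h n; rewrite /term normrM [ `|r ^+ n|]ger0_norm ?exprn_ge0 //.
by rewrite ler_wpM2r ?exprn_ge0 // -ratr_norm ler_rat fpsZ.
Qed.

Lemma dominated_conv u : dominated u -> conv u.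
Proof.
move=> [K [C [C0 h]]]; apply: (abs_cvg_le (dominated_term h)).
by apply/convZ/convX; exact: conv_GG.
Qed.

Lemma dominated_val u K (C : rat) : (forall n, `|u n| <= C * (GG ^+ K) n) ->
  `|qval u| <= ratr C * ((1 - r)^-1) ^+ K.
Proof.
move=> h; have cG : conv (C *: GG ^+ K) by apply/convZ/convX; exact: conv_GG.
have cu : conv u by apply: abs_cvg_le (dominated_term h) cG.
apply: le_trans (ser_norm cu) _; rewrite -val_GG -qvalX; last exact: conv_GG.
rewrite -qvalZ; apply: ser_le => // n; rewrite normr_ge0 /=; exact: dominated_term.
Qed.

End Value.

(** * Growth of the partition series *)

Lemma sg_ge0 k n : 0 <= sg k n.
Proof. by case: n => // n; rewrite /sg /dsum sumr_ge0 // => d _; rewrite exprn_ge0. Qed.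

Lemma sg_ge k n : n%:R ^+ k.+1 <= sg k.+1 n.
Proof.
case: n => [|n]; first by rewrite expr0n /sg /dsum.
rewrite /sg /dsum (bigD1_seq n.+1) ?divisors_uniq //=; last by rewrite -dvdn_divisors.
by rewrite lerDl sumr_ge0 // => d _; rewrite exprn_ge0.
Qed.

Lemma pser_ge0 n : 0 <= pser n.
Proof. by rewrite /pser /num sumr_ge0. Qed.

Lemma pser_0 : pser 0%N = 1.
Proof.
pose e : ipartition := IPartition (isT : is_part [::]).
suff h : perm_eq (partitions 0) [:: e] by rewrite /pser /num (perm_big _ h) big_seq1.
apply: uniq_perm => [|//|l]; first exact: partitions_uniq.
rewrite mem_partitions inE -val_eqE /psize /=.
by case: l => -[|x l] //= /andP[_]; rewrite inE negb_or; case: x.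
Qed.

Lemma fps_mul_le (a a' b b' : FPS) : (forall n, 0 <= a n <= a' n) -> (forall n, 0 <= b n <= b' n) ->
  forall n, 0 <= (a * b) n <= (a' * b') n.
Proof.
move=> ha hb n; rewrite !fpsM; apply/andP; split.
  by apply: sumr_ge0 => i _; have [/andP[? _] /andP[? _]] := (ha i, hb (n - i)%N); rewrite mulr_ge0.
apply: ler_sum => i _; have [/andP[? ?] /andP[? ?]] := (ha i, hb (n - i)%N).
exact: ler_pM.
Qed.

(* Multiplying by G at each step: n p(n) = sum sigma(k) p(n-k) and sigma(k) >= k = [q G^2]_k. *)
Lemma pser_GG K n : (GG ^+ K) n <= (K`!)%:R * pser n.
Proof.
elim: K n => [|K IH] n.
  rewrite expr0 mul1r fps1; case: n => [|n]; first by rewrite pser_0.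
  exact: pser_ge0.
case: n => [|n].
  have -> : (GG ^+ K.+1) 0%N = 1.
    by elim: K {IH} => [|K IH]; rewrite ?expr1 // exprS GG_mul big_ord1.
  by rewrite pser_0 mulr1 ler1n fact_gt0.
have n0 : 0 < n.+1%:R :> rat by rewrite ltr0n.
rewrite -(ler_pM2l n0).
rewrite -[leLHS]/(fD (GG ^+ K.+1) n.+1) mulrCA -[n.+1%:R * pser _]/(fD pser n.+1).
rewrite fD_pser fD_GGX fpsZ factS natrM -mulrA ler_wpM2l //.
have -> : Zv * GG ^+ K.+2 = (Zv * GG ^+ 2) * GG ^+ K by rewrite -mulrA -exprD.
have -> : (K`!)%:R * (sg 1 * pser) n.+1 = (sg 1 * ((K`!)%:R *: pser)) n.+1 by rewrite -scalerAr.
suff h : 0 <= (Zv * GG ^+ 2 * GG ^+ K) n.+1 <= (sg 1 * ((K`!)%:R *: pser)) n.+1 by case/andP: h.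
apply: fps_mul_le => m.
- rewrite -fD_GG /fD mulr1 ler0n /=.
  by have := sg_ge 0 m; rewrite expr1.
- by rewrite GG_ge0 fpsZ IH.
Qed.

Lemma midpoint (F : realFieldType) (r : F) : 0 <= r -> r < 1 -> exists s, [/\ 0 < s, s < 1 & r < s].
Proof. by move=> r0 r1; exists ((1 + r) / 2%:R); split; lra. Qed.

Section Pser.
Context (r : real) (r0 : 0 <= r) (r1 : r < 1).

(** For [r < s < 1] the terms [p(n) s^n] are bounded: [n p(n) s^n] is a combination of earlier terms
    with coefficients [sigma(i) s^i], whose sum is at most [S], and [n] eventually exceeds [S]. The
    ratio [r/s] then gives convergence. *)
Lemma conv_pser : conv r pser.
Proof.
have [s [s0 s1 rs]] := midpoint r0 r1.
have csg : conv s (sg 1) by apply: dominated_conv (ltW s0) s1 _ (dominated_sg 1).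
pose S := qval s (sg 1); pose a n := term s pser n.
have tsg n : 0 <= term s (sg 1) n by rewrite /term mulr_ge0 ?ler0q ?sg_ge0 ?exprn_ge0 // ltW.
have S0 : 0 <= S by apply: ser_ge0.
have a0 n : 0 <= a n by rewrite /a /term mulr_ge0 ?ler0q ?pser_ge0 ?exprn_ge0 // ltW.
pose M := Num.bound S; have hM : S < M%:R by apply: archi_boundP.
pose C := \sum_(i < M.+1) a i.
have C0 : 0 <= C by apply: sumr_ge0 => i _; exact: a0.
have rec n : n%:R * a n = cauchy (term s (sg 1)) (term s pser) n.
  rewrite -termM -fD_pser /a /term /fD rmorphM rmorph_nat mulrA; by [].
have bnd n : a n <= C.
  elim/ltn_ind: n => n IH; case: (leqP n M) => [le|lt].
    rewrite /C (bigD1 (Ordinal (le : (n < M.+1)%N))) //= lerDl.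
    by apply: sumr_ge0 => i _; exact: a0.
  have n0 : 0 < n%:R :> real by rewrite ltr0n; apply: leq_ltn_trans lt.
  rewrite -(ler_pM2l n0) rec /cauchy.
  apply: (@le_trans _ _ (\sum_(i < n.+1) term s (sg 1) i * C)).
    apply: ler_sum => i _; case: (posnP i) => [->|i0].
      by rewrite /term /sg /dsum rmorph0 !mul0r.
    by rewrite ler_wpM2l // IH //; have := ltn_ord i; lia.
  rewrite -mulr_suml ler_wpM2r //; apply: le_trans (ser_partial _ tsg csg) _.
  by apply: le_trans (ltW hM) _; rewrite ler_nat ltnW.
have q1 : `|r / s| < 1.
  by rewrite ger0_norm ?divr_ge0 ?(ltW s0) // ltr_pdivrMr // mul1r.
apply: (abs_cvg_le _ (abs_cvgZ C (geom_cvg q1))) => n.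
have -> : term r pser n = a n * (r / s) ^+ n.
  have e : r = s * (r / s) by rewrite mulrCA mulfV ?mulr1 // lt0r_neq0.
  by rewrite /a /term {1}e exprMn mulrA.
have ge0 : 0 <= (r / s) ^+ n by rewrite exprn_ge0 // divr_ge0 // ltW.
rewrite ger0_norm; last exact: mulr_ge0.
exact: ler_wpM2r.
Qed.

Lemma val_pser K : ((1 - r)^-1) ^+ K <= (K`!)%:R * qval r pser.
Proof.
rewrite -val_GG // -qvalX; last exact: conv_GG.
have -> : (K`!)%:R * qval r pser = qval r ((K`!)%:R *: pser) by rewrite qvalZ rmorph_nat.
apply: val_le => // [n|]; last exact/convZ/conv_pser.
by rewrite GG_ge0 pser_GG.
Qed.

End Pser.

(** * Decay of the discriminant *)

Definition discr : FPS := Qser ^+ 3 - Rser ^+ 2.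

Lemma fD_discr : fD discr = Pser * discr.
Proof.
rewrite /discr linearB /= !fDX /=.
have -> : 3%:R * Qser ^+ 2 * fD Qser = Qser ^+ 2 * (3%:R * fD Qser) by ring.
have -> : 2%:R * Rser ^+ 1 * fD Rser = Rser * (2%:R * fD Rser) by rewrite expr1; ring.
by rewrite ramanujanQ ramanujanR; ring.
Qed.

(** The logarithmic derivative of the product is [P + 24 sg 1 = 1], and only multiples of q are
    fixed by q d/dq. *)
Lemma discr_pser n : n != 1%N -> (discr * pser ^+ 24) n = 0.
Proof.
apply: fD_eq; rewrite fDM fDX fD_discr fD_pser -[24.-1]/(23%N) exprS.
have -> : Pser = 1 - 24%:R * sg 1 by [].
by move: (pser ^+ 23) => x; ring.
Qed.

Lemma discr_neq0 : discr != 0.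
Proof.
apply/eqP => /(congr1 (fun a : FPS => a 1%N)).
have Q0 : Qser 0%N = 1 by rewrite QserE.
have Q1 : Qser 1%N = 240%:R by rewrite QserE /E4 /sigma /= big_seq1 mulr1.
have R0 : Rser 0%N = 1 by rewrite RserE.
have R1 : Rser 1%N = - 504%:R by rewrite RserE /E6 /sigma /= big_seq1 mulr1.
rewrite /discr fpsD fpsN !exprS expr0 !mulr1 !(fpsM, big_ord_recr, big_ord0) /= !subnn /= !Q0 !Q1 !R0 !R1 fps0.
by move/eqP; vm_compute.
Qed.

(* Faster than any power of 1 - r as r tends to 1. *)
Definition small (u : FPS) := forall K : nat, exists C : real, forall r : real,
  2%:R^-1 <= r -> r < 1 -> `|qval r u| * ((1 - r)^-1) ^+ K <= C.

Section Interval.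
Context (r : real) (r2 : 2%:R^-1 <= r) (r1 : r < 1).
Lemma half_ge0 : 0 <= r. Proof. by apply: le_trans r2; rewrite invr_ge0. Qed.
Lemma pole_gt0 : 0 < (1 - r)^-1. Proof. by rewrite invr_gt0 subr_gt0. Qed.
Lemma dominated_half u : dominated u -> conv r u.
Proof. exact: dominated_conv half_ge0 r1 _. Qed.
End Interval.

Lemma smallM u v : dominated u -> dominated v -> small u -> small (u * v).
Proof.
move=> du dv su K; have [L [C [C0 hv]]] := dv.
have [D hD] := su (L + K)%N; exists (D * ratr C) => r r2 r1.
rewrite qvalM; try exact: dominated_half.
rewrite normrM mulrAC -mulrA.
have t0 := ltW (pole_gt0 r1).
apply: le_trans (ler_wpM2l (normr_ge0 _) (ler_wpM2l (exprn_ge0 K t0) (dominated_val (half_ge0 r2) r1 hv))) _.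
have -> : `|qval r u| * ((1 - r)^-1 ^+ K * (ratr C * (1 - r)^-1 ^+ L))
  = `|qval r u| * (1 - r)^-1 ^+ (L + K) * ratr C by rewrite exprD; ring.
by rewrite ler_wpM2r ?ler0q // hD.
Qed.

Lemma smallD u v : dominated u -> dominated v -> small u -> small v -> small (u + v).
Proof.
move=> du dv su sv K; have [C hC] := su K; have [D hD] := sv K.
exists (C + D) => r r2 r1; rewrite qvalD; try exact: dominated_half.
apply: le_trans (lerD (hC r r2 r1) (hD r r2 r1)).
by rewrite -mulrDl ler_wpM2r ?ler_normD // exprn_ge0 // ltW // pole_gt0.
Qed.

Lemma small0 : small 0.
Proof.
by move=> K; exists 0 => r _ _; rewrite -(scale0r 1) qvalZ rmorph0 mul0r normr0 mul0r.
Qed.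

Lemma dominated_discr : dominated discr.
Proof.
apply: dominatedD; first exact/dominatedX/dominated_Qser.
exact/dominatedN/dominatedX/dominated_Rser.
Qed.

(** [|discr| p^24] is at most a constant times [1/(1 - r)], while [p <= p^24] because [p >= 1], and
    [p >= (1 - r)^(-K-1) / (K+1)!]. *)
Lemma small_discr : small discr.
Proof.
move=> K; pose y := discr * pser ^+ 24.
have hy n : `|y n| <= `|y 1%N| * (GG ^+ 1) n.
  rewrite expr1 mulr1; case: (eqVneq n 1%N) => [-> //|n1].
  by rewrite /y discr_pser // normr0.
exists ((K.+1`!)%:R * ratr `|y 1%N|) => r r2 r1.
have r0 := half_ge0 r2; have t0 := pole_gt0 r1; set t := (1 - r)^-1 in t0 *.
have p1 : 1 <= qval r pser by have := val_pser r0 r1 0; rewrite expr0 mul1r.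
have := dominated_val r0 r1 hy; rewrite expr1 -/t /y qvalM; last 2 first.
- exact: dominated_half dominated_discr.
- exact/convX/conv_pser.
rewrite qvalX; last exact: conv_pser.
rewrite normrM [X in _ * X]ger0_norm ?exprn_ge0 ?(le_trans ler01) // => h.
rewrite -(ler_pM2r t0) -mulrA -exprSr.
apply: le_trans (ler_wpM2l (normr_ge0 _) (val_pser r0 r1 K.+1)) _.
rewrite mulrCA -mulrA ler_wpM2l //; apply: le_trans h; apply: ler_wpM2l => //.
by rewrite -[leLHS]expr1; apply: ler_weXn2l.
Qed.

(** Horner's scheme: if [|p(x)| >= c] for large [x], then [|x p(x) + a| >= c x - |a| >= c] as soon
    as [x >= 1 + |a|/c]. *)
Lemma poly_away0 (p : {poly rat}) : p != 0 ->
  exists (c T : real), 0 < c /\ forall x, T <= x -> c <= `|(map_poly ratr p).[x]|.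
Proof.
elim/poly_ind: p => [|p a IH]; first by rewrite eqxx.
have [->|/IH [c [T [c0 hT]]] _] := eqVneq p 0.
  rewrite mul0r add0r polyC_eq0 => a0; exists `|ratr a|, 0; split=> [|x _].
    by rewrite normr_gt0 fmorph_eq0.
  by rewrite map_polyC hornerC.
exists c, (Num.max T (1 + `|ratr a| / c)); split=> // x; rewrite ge_max => /andP[/hT h1 h2].
rewrite rmorphD rmorphM /= map_polyX map_polyC hornerD hornerM hornerX hornerC.
have x0 : 0 <= x by apply: le_trans h2; rewrite addr_ge0 // divr_ge0 // ltW.
apply: le_trans (lerB_normD _ _); rewrite normrM [ `|x|]ger0_norm // lerBrDr.
apply: le_trans (ler_wpM2r x0 h1); apply: le_trans (ler_wpM2l (ltW c0) h2).
by rewrite mulrDr mulr1 mulrCA mulfV ?mulr1 // lt0r_neq0.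
Qed.

Lemma qval_evQ r (p : {poly rat}) : 2%:R^-1 <= r -> r < 1 ->
  qval r (evB p%:P) = (map_poly ratr p).[qval r Qser].
Proof.
move=> r2 r1; have c g := dominated_half r2 r1 (dominated_evB g).
have cQ := dominated_half r2 r1 dominated_Qser.
elim/poly_ind: p => [|p a IH].
  by rewrite !rmorph0 horner0 -(scale0r 1) qvalZ rmorph0 mul0r.
have -> : evB (p * 'X + a%:P)%:P = evB p%:P * Qser + a *: 1.
  by rewrite polyCD polyCM rmorphD rmorphM /= evB_Q evB_c.
rewrite rmorphD rmorphM /= map_polyX map_polyC hornerD hornerM hornerX hornerC.
rewrite (qvalD (convM (c p%:P) cQ) (convZ a (conv1 r))) (qvalM (c p%:P) cQ) IH.
by rewrite qvalZ qval1 mulr1.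
Qed.

Lemma Qser_ge r : 2%:R^-1 <= r -> r < 1 -> (1 - r)^-1 <= qval r Qser.
Proof.
move=> r2 r1; have r0 := half_ge0 r2; rewrite -val_GG //; apply: val_le => // [n|].
  rewrite ler01 /= /Qser fpsD fps1 fps_natM /GG.
  case: n => [|n]; first by rewrite lerDl mulr_ge0 // sg_ge0.
  rewrite add0r; have := sg_ge 2 n.+1; set x := sg 3 _ => hx.
  have h1 : 1 <= x by apply: le_trans hx; rewrite -natrX ler1n expn_gt0.
  by move: h1; clear; lra.
exact: dominated_half dominated_Qser.
Qed.

Lemma not_small (p : {poly rat}) : p != 0 -> ~ small (evB p%:P).
Proof.
move=> /poly_away0[c [T [c0 hT]]] /(_ 1%N) [C hC].
(* [t] will be [1/(1 - r)]. Then [Qser] is at least [t >= T] at [r], so the polynomial is at least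
   [c] there, and [c t > C] contradicts smallness; the summand 2 ensures [r >= 1/2]. *)
pose t : real := 2%:R + `|T| + `|C| / c.
have Cc : 0 <= `|C| / c by rewrite divr_ge0 // ltW.
have t2 : 2%:R <= t by rewrite /t -addrA lerDl addr_ge0.
have t0 : 0 < t by apply: lt_le_trans t2; rewrite ltr0n.
pose r := 1 - t^-1.
have e : (1 - r)^-1 = t by rewrite /r subKr invrK.
have r2 : 2%:R^-1 <= r.
  have h : t^-1 <= 2%:R^-1 by rewrite lef_pV2 // posrE ltr0n.
  rewrite /r lerBrDr; apply: le_trans (lerD (lexx _) h) _.
  by rewrite -mulr2n -[X in X <= _]mulr_natl mulfV ?pnatr_eq0.
have r1 : r < 1 by rewrite /r ltrBlDr ltrDl invr_gt0.
have := hC r r2 r1; rewrite e expr1 qval_evQ //.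
have h := Qser_ge r2 r1; rewrite e in h.
have hTt : T <= t.
  by apply: le_trans (ler_norm T) _; rewrite /t addrAC lerDr addr_ge0.
have := hT _ (le_trans hTt h); set v := `|_.[_]| => cv vC.
have : c * t <= C by apply: le_trans vC; rewrite ler_wpM2r // ltW.
apply/negP; rewrite -ltNge /t mulrDr mulrCA mulfV ?mulr1 ?lt0r_neq0 //.
apply: le_lt_trans (ler_norm C) _; rewrite ltrDr mulr_gt0 // ltr_pwDl //.
Qed.

(** * Independence of Q and R *)

Definition Dm : Bf := vQ ^+ 3 - vR ^+ 2.

Lemma evB_Dm : evB Dm = discr.
Proof. by rewrite rmorphB !rmorphXn /= evB_Q evB_R. Qed.

Lemma Dm_decomp g : exists q (g0 h0 : {poly rat}), g = Dm * q + (g0%:P + h0%:P * vR).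
Proof.
elim/Bf_ind: g => [_ _ [q [a [b ->]]] [q' [a' [b' ->]]]|c|_ [q [a [b ->]]]|_ [q [a [b ->]]]].
- by exists (q + q'), (a + a'), (b + b'); rewrite !polyCD; ring.
- by exists 0, c%:P, 0; rewrite polyC0; ring.
- exists (q * vQ), (a * 'X), (b * 'X); rewrite !polyCM; ring.
- by exists (q * vR - b%:P), (b * 'X ^+ 3), a; rewrite polyCM rmorphXn /= /Dm; ring.
Qed.

(** A nonzero square has even degree, and X^3 times a nonzero square has odd degree. *)
Lemma parity (p q : {poly rat}) : p ^+ 2 = 'X^3 * q ^+ 2 -> p = 0 /\ q = 0.
Proof.
have [->|q0] := eqVneq q 0.
  by rewrite expr0n mulr0 => /eqP; rewrite expf_eq0 /= => /eqP.
have [->|p0] := eqVneq p 0.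
  rewrite expr0n /= => /esym/eqP; rewrite mulf_eq0 expf_eq0 /= polyX_eq0 /= expf_eq0 /=.
  by rewrite (negPf q0).
move/(congr1 (fun p : {poly rat} => size p)).
rewrite !expr2 [_ * (q * q)]mulrC size_mulXn ?mulf_neq0 // !size_mul //.
have : (0 < size p)%N by rewrite size_poly_gt0.
have : (0 < size q)%N by rewrite size_poly_gt0.
by move: (size p) (size q) => m n hq hp e; exfalso; lia.
Qed.

(** Modulo [Dm] the form is [a + b R]. Multiplying by the conjugate [a - b R] produces a small
    polynomial [a^2 - Q^3 b^2] in Q alone, which must vanish; then [parity] applies. *)
Lemma small_dvd g : small (evB g) -> exists q, g = Dm * q.
Proof.
have [q [a [b ->]]] := Dm_decomp g; move=> sg.
suff [-> ->] : a = 0 /\ b = 0 by exists q; rewrite !polyC0 mul0r !addr0.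
apply: parity; apply/eqP; rewrite -subr_eq0; apply: contraT => n0.
have := not_small n0; case.
have dB := dominated_evB; have sD h : small (evB (Dm * h)).
  by rewrite rmorphM /= evB_Dm; exact: smallM dominated_discr (dB h) small_discr.
have -> : (a ^+ 2 - 'X^3 * b ^+ 2)%:P =
  (Dm * q + (a%:P + b%:P * vR)) * (a%:P - b%:P * vR) + Dm * (- (q * (a%:P - b%:P * vR)) - b%:P ^+ 2).
  by rewrite polyCB [('X^3 * _)%:P]polyCM !polyC_exp /Dm; ring.
rewrite rmorphD; apply: smallD => //.
by rewrite rmorphM; apply: smallM => //.
Qed.

Lemma size_Dm q : q != 0 -> size (Dm * q) = (size q).+2.
Proof.
move=> q0; have s3 : size Dm = 3%N.
  rewrite /Dm -rmorphXn /= addrC size_polyDl size_polyN size_polyXn //.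
  by rewrite (leq_ltn_trans (size_polyC_leq1 _)).
by rewrite size_mul ?s3 // -size_poly_gt0 s3.
Qed.

(** A relation is divisible by [Dm], whose value is not zero, and the quotient is a relation of
    smaller degree in R. *)
Lemma evB_inj g : evB g = 0 -> g = 0.
Proof.
have [n] := ubnP (size g); elim: n g => // n IH g lt_n eg.
have [q eq] : exists q, g = Dm * q by apply: small_dvd; rewrite eg; exact: small0.
have [q0|q0] := eqVneq q 0; first by rewrite eq q0 mulr0.
move: eg; rewrite eq rmorphM /= evB_Dm => e.
have z : evB q = 0 by apply: (fps_mulI discr_neq0); rewrite e mulr0.
by move: lt_n; rewrite eq size_Dm // => lt; rewrite (IH q) ?mulr0 //; lia.
Qed.

(** * Algebraic independence of P, Q, R *)

(* The restriction to the cuspidal curve Q^3 = R^2, parametrised by Q = x^2, R = x^3. *)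
Definition sigQ : {rmorphism {poly rat} -> {poly rat}} := horner_alg ('X^2 : {poly rat}).
Lemma sigQ_comm : commr_rmorph sigQ 'X^3. Proof. by move=> x; apply: mulrC. Qed.
Definition cusp : {rmorphism Bf -> {poly rat}} := horner_morph sigQ_comm.

Lemma cusp_C p : cusp p%:P = sigQ p. Proof. exact: horner_morphC. Qed.
Lemma cusp_R : cusp vR = 'X^3. Proof. exact: horner_morphX. Qed.
Lemma cusp_Q : cusp vQ = 'X^2.
Proof. by rewrite cusp_C -[LHS]/(horner_alg 'X^2 'X) horner_algX. Qed.
Lemma cusp_c (c : rat) : cusp c%:P%:P = c%:P.
Proof. by rewrite cusp_C -[LHS]/(horner_alg 'X^2 c%:P) horner_algC alg_polyC. Qed.
Lemma sigQE p : sigQ p = p \Po 'X^2.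
Proof.
elim/poly_ind: p => [|p c IH]; first by rewrite rmorph0 comp_poly0.
rewrite comp_polyD comp_polyM comp_polyX comp_polyC -IH rmorphD rmorphM -!cusp_C.
by rewrite cusp_c cusp_Q.
Qed.

Lemma sigQ_inj p : sigQ p = 0 -> p = 0.
Proof. by rewrite sigQE => /eqP; rewrite comp_poly_eq0 ?size_polyXn // => /eqP. Qed.

Lemma cusp_Dm : cusp Dm = 0.
Proof. by rewrite rmorphB !rmorphXn /= cusp_Q cusp_R -!exprM subrr. Qed.

Lemma cusp_eq0 g : cusp g = 0 -> exists q, g = Dm * q.
Proof.
have [q [a [b ->]]] := Dm_decomp g.
rewrite rmorphD rmorphM cusp_Dm mul0r add0r rmorphD rmorphM cusp_R !cusp_C => h.
suff [-> ->] : a = 0 /\ b = 0 by exists q; rewrite !polyC0 mul0r !addr0.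
apply: parity; apply/eqP; rewrite -subr_eq0; apply/eqP/sigQ_inj.
rewrite rmorphB [sigQ ('X^3 * _)]rmorphM !rmorphXn -[sigQ 'X]cusp_C cusp_Q.
have -> : sigQ a = - (sigQ b * 'X^3) by apply/eqP; rewrite -addr_eq0 h.
by rewrite -exprM sqrrN exprMn -exprM mulrC subrr.
Qed.

(** On the cuspidal curve the vector field [thB] is [- x] times the Euler field, as one sees on x^2
    and x^3. *)
Lemma cusp_th g : cusp (thB g) = - ('X * cusp (WB g)).
Proof.
elim/Bf_ind: g => [g h hg hh|c|g hg|g hg].
- by rewrite thBD WBD !rmorphD /= hg hh; ring.
- by rewrite thBc WBc rmorph0 mulr0 oppr0.
- rewrite thBM WBM !rmorphD !rmorphM hg thB_Q WB_Q rmorphN !rmorphM !rmorph_nat cusp_Q cusp_R.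
  by ring.
rewrite thBM WBM !rmorphD !rmorphM hg thB_R WB_R rmorphN !rmorphM !rmorph_nat cusp_Q cusp_R.
by ring.
Qed.

(** [12 D P] is, up to sign, a series with nonnegative coefficients whose value on [1/2, 1) is at
    least 1, so it can be cancelled from a small product. *)
Lemma small_fD_Pser u : dominated u -> small (u * (12%:R * fD Pser)) -> small u.
Proof.
move=> du su K; have [C hC] := su K; exists C => r r2 r1; apply: le_trans (hC r r2 r1).
have r0 := half_ge0 r2; have t0 := pole_gt0 r1.
have dD : dominated (12%:R * fD Pser) by apply/dominated_nat/dominated_fD/dominated_Pser.
rewrite (qvalM (dominated_half r2 r1 du) (dominated_half r2 r1 dD)) normrM.
rewrite ler_wpM2r ?exprn_ge0 ?(ltW t0) // ler_peMr //.
(* Hides the numeral 288; [2 <= c] is enough since [2 r >= 1]. *)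
have [c [c2 e]] : exists c : rat, 2%:R <= c /\ 12%:R * fD Pser = - (c *: fD (sg 1)).
  exists 288%:R; split; first by rewrite ler_nat.
  by rewrite /Pser linearB /= fD1 fDnat fps_natZ; ring.
have c0 : 0 <= c by apply: le_trans c2.
rewrite e qvalN normrN; apply: le_trans (ler_norm _).
have cs : conv r (c *: fD (sg 1)).
  by apply: dominated_half => //; apply/dominatedZ/dominated_fD/dominated_sg.
have -> : 1 = 2%:R * 2%:R^-1 :> real by rewrite mulfV ?pnatr_eq0.
apply: le_trans (ler_wpM2l (ler0n _ 2) r2) _.
have -> : 2%:R * r = \sum_(i < 2) term r (2%:R *: Zv) i.
  have h0 : term r (2%:R *: Zv) 0 = 0 by rewrite /term fpsZ /Zv mulr0 rmorph0 mul0r.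
  have h1 : term r (2%:R *: Zv) 1 = 2%:R * r by rewrite /term fpsZ /Zv mulr1 rmorph_nat expr1.
  by rewrite big_ord_recr big_ord1 /= h0 h1 add0r.
apply: le_trans (ser_partial 2 _ cs); last first.
  by move=> n; rewrite /term mulr_ge0 ?exprn_ge0 // ler0q fpsZ mulr_ge0 // /fD mulr_ge0 // sg_ge0.
apply: ler_sum => i _; rewrite /term ler_wpM2r ?exprn_ge0 // ler_rat !fpsZ.
case: (i : nat) (ltn_ord i) => [|[|//]] _; first by rewrite /Zv /fD mul0r !mulr0.
by have h1 := sg_ge 0 1; rewrite expr1 in h1; rewrite /Zv /fD mul1r; apply: ler_pM.
Qed.

Lemma WB0 : WB 0 = 0. Proof. by have := WBc 0; rewrite !rmorph0. Qed.
Lemma thB0 : thB 0 = 0. Proof. by have := thBc 0; rewrite !rmorph0. Qed.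

Lemma coef_WA (a : Af) j : (WA a)`_j = (2 * j)%:R * a`_j + WB a`_j.
Proof.
rewrite WAE coefD -mulrA -polyCn coefCM coefXM coef_deriv coef_cder; last exact: WBD.
case: j => [|j] /=; first by rewrite mulr0 mul0r.
by rewrite natrM -mulr_natl; ring.
Qed.

Lemma coef_DA (a : Af) m : (DA a)`_m.+2 =
  m.+1%:R * a`_m.+1 - m.+3%:R * vQ * a`_m.+3 + WB a`_m.+1 + thB a`_m.+2.
Proof.
rewrite DAE !coefD coefXM mulrBr coefB coefMXn coefMC !coef_deriv !coef_cder; [|exact: thBD|exact: WBD].
rewrite /= subn2 -[_ *+ _.+1]mulr_natl -[a`_m.+3 *+ _]mulr_natl /=; ring.
Qed.

Lemma deriv_WA a : (WA a)^`() = WA a^`() + 2%:R * a^`().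
Proof.
rewrite !WAE derivD (cder_deriv WBD) !derivM derivX -polyCn derivC; ring.
Qed.

(** * A relation of minimal degree in P *)

Section Minimal.
Context (F : Af) (F0 : ev F = 0) (szF : (1 < size F)%N).
Context (minF : forall a : Af, (size a < size F)%N -> ev a = 0 -> a = 0).
Let g := lead_coef F.
Let d := (size F).-1.

Let Fn0 : F != 0. Proof. by rewrite -size_poly_gt0; lia. Qed.
Let g0 : g != 0. Proof. by rewrite lead_coef_eq0. Qed.
Let evg0 : evB g != 0. Proof. by apply: contra_neq g0; exact: evB_inj. Qed.

(** Pseudo-division by [F]: the remainder is a relation of smaller degree, hence zero by
    minimality. *)
Lemma kernel_dvd (a : Af) : ev a = 0 -> exists k (L : Af), (g ^+ k)%:P * a = L * F.
Proof.
move=> a0; exists (Pdiv.Ring.rscalp a F), (Pdiv.Ring.rdivp a F).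
have := Pdiv.ComRing.rdivp_eq F a; rewrite -mul_polyC polyC_exp -/g => e.
have r0 : ev (Pdiv.Ring.rmodp a F) = 0.
  have -> : Pdiv.Ring.rmodp a F = (g%:P ^+ Pdiv.Ring.rscalp a F) * a - Pdiv.Ring.rdivp a F * F by rewrite e addrC addKr.
  by rewrite rmorphB !rmorphM /= a0 F0 !mulr0 subrr.
by rewrite e (minF _ r0) ?addr0 // Pdiv.Ring.ltn_rmodp.
Qed.

Lemma kernel_multiple (a : Af) : (size a <= size F)%N -> ev a = 0 -> g%:P * a = (a`_d)%:P * F.
Proof.
move=> sa a0; apply/eqP; rewrite -subr_eq0; apply/eqP; apply: minF; last first.
  by rewrite rmorphB !rmorphM /= a0 F0 !mulr0 subrr.
have sd : size F = d.+1 by rewrite /d; lia.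
rewrite sd ltnS; apply/leq_sizeP => j le; rewrite coefB !coefCM.
case: (ltngtP d j) => [lt|lt|<-]; last by rewrite mulrC -[F`_d]/g subrr.
  have za : a`_j = 0 by apply: nth_default; apply: leq_trans sa _; rewrite sd.
  have zF : F`_j = 0 by apply: nth_default; rewrite sd.
  by rewrite za zF !mulr0 subrr.
by lia.
Qed.

Let w := ev (WA F).
Let mu := ev F^`().

(** Apply the weight and d/dP to [g^k DA F = L F] and evaluate. If [w] were nonzero, [mu / w] would
    have the constant derivative [-1/12], which [fps_no_log] forbids. *)
Lemma weight_zero : w = 0.
Proof.
have e0 : ev (DA F) = 0 by rewrite ev_DA F0 linear0 mulr0.
have [k [L e]] := kernel_dvd e0.
have gk0 : evB (g ^+ k) != 0 by rewrite rmorphXn; elim: (k) => [|m IH]; rewrite ?expr0 ?oner_eq0 // exprS fps_mul_neq0.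
have e1 : evB (g ^+ k) * (12%:R * fD w) = ev L * w.
  have := congr1 (fun a => ev (WA a)) e.
  rewrite /= !WAM !rmorphD !rmorphM /= WA_DA rmorphD rmorphM /= e0 F0 !mulr0 !addr0 !add0r ev_C.
  by rewrite ev_DA.
have e2 : evB (g ^+ k) * (12%:R * fD mu + w) = ev L * mu.
  have := congr1 (fun a : Af => ev a^`()) e.
  rewrite /= !derivM derivC mul0r add0r deriv_DA !rmorphM !rmorphD !rmorphM /= F0 !mulr0 !add0r ev_C.
  by rewrite ev_DA.
apply: (@fps_no_log w mu (- 12%:R^-1)); first by rewrite oppr_eq0 invr_eq0 pnatr_eq0.
apply: (fps_mulI gk0).
have e3 : evB (g ^+ k) * (w * fD mu - mu * fD w) *+ 12 = - (evB (g ^+ k) * (w * w)).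
  have -> : evB (g ^+ k) * (w * fD mu - mu * fD w) *+ 12 =
    w * (evB (g ^+ k) * (12%:R * fD mu + w)) - mu * (evB (g ^+ k) * (12%:R * fD w)) - evB (g ^+ k) * (w * w).
    by rewrite -mulr_natl; ring.
  by rewrite e1 e2; ring.
by rewrite scaleNr mulrN -scalerAr -scalerN -e3 -scaler_nat scalerA mulVf ?scale1r.
Qed.

Lemma size_WA : (size (WA F) <= size F)%N.
Proof.
by apply/leq_sizeP => j le; rewrite coef_WA nth_default // WB0 mulr0 addr0.
Qed.

(** [WA F] is again a relation and no longer than [F], so it is proportional to [F]; the factor is
    read off from the coefficients of [P^d]. *)
Lemma weight_relation : g%:P * WA F = (WB g + (2 * d)%:R * g)%:P * F.
Proof.
rewrite (kernel_multiple size_WA weight_zero); congr (_%:P * _).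
by rewrite coef_WA addrC.
Qed.

Let sd : size F = d.+1. Proof. by rewrite /d; lia. Qed.

(** The same argument one derivative higher: [mu2 / mu] would have the constant derivative
    [(2 - 2 d)/12]. For [d] other than 1 this forces [mu = 0], so that [F'] is a relation of smaller
    degree. *)
Lemma kernel_linear : d = 1%N.
Proof.
apply/eqP; apply: contraT => d1.
have e0 : ev (DA F) = 0 by rewrite ev_DA F0 linear0 mulr0.
have [k [L e]] := kernel_dvd e0.
have gk0 : evB (g ^+ k) != 0.
  by rewrite rmorphXn; elim: (k) => [|m IH]; rewrite ?expr0 ?oner_eq0 // exprS fps_mul_neq0.
have [m dm] : exists m, d = m.+1 by exists d.-1; rewrite /d; lia.
have F_hi j : (d < j)%N -> F`_j = 0 by move=> lt; rewrite nth_default // sd.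
(* [DA] raises the degree in P by at most one, so [L] has degree at most one. *)
have sL : (size L <= 2)%N.
  have [->|L0] := eqVneq L 0; first by rewrite size_poly0.
  have : (size (L * F)%R <= d.+2)%N.
    rewrite -e; apply/leq_sizeP => -[|[|j]] le; [by lia|by lia|].
    by rewrite coefCM coef_DA !F_hi ?WB0 ?thB0 ?mulr0 ?subrr ?addr0 ?mulr0 //; lia.
  by rewrite size_mul // sd addnS /= -addn2 addnC leq_add2l.
have L1 : L^`() = (L`_1)%:P.
  apply/polyP => -[|i]; rewrite coef_deriv coefC //= nth_default ?mul0rn //.
  exact: leq_trans sL _.
have eL : L = (L`_0)%:P + (L`_1)%:P * P.
  apply/polyP => -[|[|i]]; rewrite coefD coefC coefCM coefX ?mulr0 ?mulr1 ?addr0 ?add0r //=.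
  by rewrite nth_default //; apply: leq_trans sL _.
have gE : F`_m.+1 = g by rewrite -dm.
(* Compare the coefficients of [P^(d+1)]. *)
have l1 : L`_1 * g = g ^+ k * (d%:R * g + WB g).
  have -> : L`_1 * g = (L * F)`_m.+2.
    rewrite {2}eL mulrDl coefD coefCM -mulrA coefCM coefXM /= gE F_hi ?mulr0 ?add0r //; lia.
  rewrite -e coefCM coef_DA gE !F_hi ?thB0 ?mulr0 ?subr0 ?addr0 -?dm //; lia.
pose G := evB g; pose ga := evB (g ^+ k); pose om := ev (WA F)^`(); pose mu2 := ev F^`()^`().
have e1 : ga * (12%:R * fD mu) = ev L * mu.
  have := congr1 (fun a : Af => ev a^`()) e.
  rewrite /= !derivM derivC mul0r add0r deriv_DA !rmorphM !rmorphD !rmorphM /= F0 !mulr0 !add0r ev_C.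
  by rewrite ev_DA -/w weight_zero addr0.
have e2 : ga * (12%:R * fD mu2 + (om - 2%:R * mu) + om) = 2%:R * (evB L`_1 * mu) + ev L * mu2.
  have := congr1 (fun a : Af => ev a^`()^`()) e.
  rewrite /= !derivM derivC mul0r add0r !derivD !derivM derivC mul0r add0r L1 derivC mul0r add0r.
  rewrite deriv_DA derivD deriv_DA !(rmorphD, rmorphM) /= !ev_C ev_DA.
  have -> : ev (WA F^`()) = om - 2%:R * mu.
    by rewrite /om deriv_WA rmorphD rmorphM rmorph_nat addrK.
  by rewrite -/mu -/mu2 -/om -/ga => ->; ring.
have e3 : G * om = (evB (WB g) + (2 * d)%:R * G) * mu.
  have := congr1 (fun a : Af => ev a^`()) weight_relation.
  rewrite /= !derivM !derivC !mul0r !add0r !rmorphM /= !ev_C rmorphD rmorphM rmorph_nat.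
  by [].
have e4 : evB L`_1 * G = ga * (d%:R * G + evB (WB g)).
  by have := congr1 evB l1; rewrite !rmorphM rmorphD rmorphM rmorph_nat.
have e5 : ga * (12%:R * fD mu2) = ga * (2%:R - (2 * d)%:R) * mu + ev L * mu2.
  apply: (fps_mulI evg0); rewrite -/G.
  have -> : G * (ga * (12%:R * fD mu2)) = G * (ga * (12%:R * fD mu2 + (om - 2%:R * mu) + om))
     - 2%:R * ga * (G * om) + 2%:R * ga * G * mu by ring.
  rewrite e2 e3.
  have -> : G * (2%:R * (evB L`_1 * mu) + ev L * mu2) = 2%:R * (evB L`_1 * G) * mu + G * ev L * mu2 by ring.
  by rewrite e4 natrM; ring.
have mu0 : mu = 0.
  apply: (@fps_no_log mu mu2 (12%:R^-1 * (2%:R - (2 * d)%:R))).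
    rewrite mulf_neq0 ?invr_eq0 ?pnatr_eq0 // subr_eq0 eqr_nat; move: d1; clear; lia.
  apply: (fps_mulI gk0); rewrite -/ga -scalerA.
  have e6 : ga * (mu * fD mu2 - mu2 * fD mu) *+ 12 = ga * ((2%:R - (2 * d)%:R) * (mu * mu)).
    have -> : ga * (mu * fD mu2 - mu2 * fD mu) *+ 12 =
      mu * (ga * (12%:R * fD mu2)) - mu2 * (ga * (12%:R * fD mu)) by rewrite -mulr_natl; ring.
    by rewrite e1 e5; ring.
  rewrite [(_ - _) *: _]fps_scaleE scalerBl !fps_natZ !mulr1 -scalerAr -e6 -scaler_nat scalerA mulVf ?scale1r //.
have F'0 : F^`() = 0 by apply: minF => //; rewrite lt_size_deriv.
have := congr1 (fun a : Af => a`_m) F'0; rewrite /= coef_deriv coef0 gE => /eqP.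
by rewrite -mulr_natl mulf_eq0 (negPf g0) orbF -!polyC_natr !polyC_eq0 pnatr_eq0.
Qed.
End Minimal.

(** For [F = g P + g1], eliminating P from [ev (DA F) = 0] gives a differential equation in
    rat[Q, R], which on the cuspidal curve becomes [(b + x a)^2 = 0]. Hence [Dm] divides
    [g1^2 - Q g^2], whose value is [12 G^2 D P]. By [small_fD_Pser] the series [G^2] is small, so
    [Dm] divides [g] and then [g1]. Division by [Dm] lowers the degree of [g] in R. *)
Lemma kernel_size2 (F : Af) : size F = 2%N -> ev F = 0 -> False.
Proof.
have [n] := ubnP (size F`_1); elim: n F => // n IH F lt_n sF F0.
have minF (a : Af) : (size a < size F)%N -> ev a = 0 -> a = 0.
  rewrite sF ltnS => /size1_polyC -> /=; rewrite ev_C => /evB_inj ->; by rewrite polyC0.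
have sF1 : (1 < size F)%N by rewrite sF.
have hW := weight_relation F0 sF1 minF.
have lF : lead_coef F = F`_1 by rewrite /lead_coef sF.
rewrite lF sF /= muln1 in hW.
move: lt_n hW; set g := F`_1; set g1 := F`_0 => lt_n hW.
have g0 : g != 0 by rewrite /g -lF lead_coef_eq0 -size_poly_gt0 sF.
have eF : F = g%:P * P + g1%:P.
  apply/polyP => -[|[|i]]; rewrite coefD coefC coefCM coefX ?mulr0 ?mulr1 ?addr0 ?add0r //=.
  by rewrite nth_default // sF.
have {}hW : g * WB g1 = (WB g + 2%:R * g) * g1.
  have := congr1 (fun a : Af => a`_0) hW; rewrite /= !coefCM coef_WA -/g1 => <-.
  by rewrite muln0 mul0r add0r.
pose G := evB g; pose G1 := evB g1.
have GP : G * Pser = - G1.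
  by apply/eqP; rewrite -addr_eq0; have := F0; rewrite eF rmorphD rmorphM /= !ev_C ev_P => ->.
(* [z] below is [G^2] times [ev (DA F)] with [G P] replaced by [- G1]; adding a multiple of [hW]
   makes it divisible by [g]. *)
have ode : g1 ^+ 2 + g1 * thB g - g * thB g1 + g ^+ 2 * vQ = 0.
  apply: (mulfI g0); rewrite mulr0.
  have z : (g + WB g) * g1 ^+ 2 - (thB g + WB g1) * g * g1 + g ^+ 2 * (thB g1 - g * vQ) = 0.
    apply: evB_inj; have : ev (DA F) = 0 by rewrite ev_DA F0 linear0 mulr0.
    rewrite eF DAD DAM DA_P !DA_C !(rmorphD, rmorphM, rmorphB, rmorphN, rmorphXn) !ev_C ev_P evB_Q.
    rewrite -/G -/G1 => h.
    set a := evB (WB g) in h *; set b := evB (thB g) in h *.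
    set a1 := evB (WB g1) in h *; set b1 := evB (thB g1) in h *.
    have := congr1 (fun x => G ^+ 2 * x) h; rewrite /= mulr0 => <-.
    have -> : G1 = - (G * Pser) by rewrite GP opprK.
    by ring.
  have -> : g * (g1 ^+ 2 + g1 * thB g - g * thB g1 + g ^+ 2 * vQ) =
    - ((g + WB g) * g1 ^+ 2 - (thB g + WB g1) * g * g1 + g ^+ 2 * (thB g1 - g * vQ))
    + g1 * ((WB g + 2%:R * g) * g1 - g * WB g1) by ring.
  by rewrite z hW; ring.
pose a := cusp g; pose b := cusp g1.
have ab : b = - ('X * a).
  apply/eqP; rewrite -addr_eq0 -sqrf_eq0; apply/eqP.
  have h1 := congr1 cusp ode; have h2 := congr1 cusp hW.
  rewrite !(rmorphD, rmorphB, rmorphN, rmorphM) !cusp_th cusp_Q rmorph0 -/a -/b in h1.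
  have {}h2 : a * cusp (WB g1) = (cusp (WB g) + 2%:R * a) * b.
    by rewrite -rmorphM h2 rmorphM rmorphD rmorphM rmorph_nat.
  have -> : (b + 'X * a) ^+ 2 = b * b + b * - ('X * cusp (WB g)) - a * - ('X * cusp (WB g1)) + a * a * 'X^2
     - 'X * (a * cusp (WB g1) - (cusp (WB g) + 2%:R * a) * b) by ring.
  by rewrite h2 subrr mulr0 subr0 h1.
have [U eU] : exists U, g1 ^+ 2 - vQ * g ^+ 2 = Dm * U.
  by apply: cusp_eq0; rewrite rmorphB !rmorphM cusp_Q -/a -/b ab; ring.
have sg2 : small (evB (g ^+ 2)).
  apply: small_fD_Pser; first exact: dominated_evB.
  rewrite ramanujanP rmorphXn -/G.
  have -> : G ^+ 2 * (Pser ^+ 2 - Qser) = evB (Dm * U).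
    rewrite -eU rmorphB !rmorphM evB_Q -/G -/G1.
    have -> : G1 = - (G * Pser) by rewrite GP opprK.
    by ring.
  rewrite rmorphM evB_Dm; exact: smallM dominated_discr (dominated_evB U) small_discr.
have [q eq2] := small_dvd sg2.
have a0 : a = 0.
  by apply/eqP; rewrite -sqrf_eq0 -rmorphXn eq2 rmorphM cusp_Dm mul0r.
have [q1 e1] := cusp_eq0 a0.
have b0 : cusp g1 = 0 by rewrite -/b ab a0 mulr0 oppr0.
have [q2 e2] := cusp_eq0 b0.
have q10 : q1 != 0 by apply: contra_neq g0 => z; rewrite e1 z mulr0.
pose F2 : Af := q1%:P * P + q2%:P.
have sF2 : size F2 = 2%N by rewrite size_MXaddC polyC_eq0 (negPf q10) /= size_polyC q10.
apply: (IH F2) => //.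
  have -> : F2`_1 = q1 by rewrite coefD coefCM coefX coefC mulr1 addr0.
  by move: lt_n; rewrite e1 size_Dm //; lia.
have : evB Dm * ev F2 = 0.
  rewrite -[RHS]F0 eF e1 e2 -ev_C -rmorphM; congr (ev _); rewrite /F2 !polyCM; ring.
rewrite evB_Dm => h; apply: (fps_mulI discr_neq0); by rewrite h mulr0.
Qed.

Theorem ev_inj (F : Af) : ev F = 0 -> F = 0.
Proof.
have [n] := ubnP (size F); elim: n F => // n IH F; rewrite ltnS => le_n F0.
case: (leqP (size F) 1) => [/size1_polyC eF|szF].
  by move: F0; rewrite eF ev_C => /evB_inj ->; rewrite polyC0.
have minF (a : Af) : (size a < size F)%N -> ev a = 0 -> a = 0.
  by move=> lt; apply: IH; apply: leq_trans lt le_n.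
have d1 := kernel_linear F0 szF minF.
by case: (@kernel_size2 F) => //; lia.
Qed.

(** * The q-bracket *)

Section Bracket.
Context (R : polyops).
(** [ph y] substitutes [y i] for Q_(i+1). The values are polynomials in one variable, which serves
    as the shift parameter of the Taylor expansion; numerical evaluation uses constant
    polynomials. *)
Context (ph : (nat -> {poly rat}) -> R -> {poly rat}).
Context (phD : forall y p q, ph y (p + q) = ph y p + ph y q).
Context (phZ : forall y c p, ph y (c *: p) = c *: ph y p).
Context (phM : forall y p q, ph y (p * q) = ph y p * ph y q).
Context (ph1 : forall y, ph y 1 = 1) (phQ : forall y i, ph y (PQ R i.+1) = y i).
Local Notation Q := (PQ R).
Local Notation pd := (@pd R).
Local Notation E := (der (euler R succn)).
Local Notation del := (der Q).
Local Notation pi := (@ppi R).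
Implicit Types (p q x f g : R) (l : ipartition).

Lemma alg_map_ext (S : comAlgType rat) (g h : R -> S) :
  (forall x y, g (x + y) = g x + g y) -> (forall x y, h (x + y) = h x + h y) ->
  (forall c x, g (c *: x) = c *: g x) -> (forall c x, h (c *: x) = c *: h x) ->
  (forall x y, g (x * y) = g x * g y) -> (forall x y, h (x * y) = h x * h y) ->
  g 1 = 1 -> h 1 = 1 -> (forall i, g (Q i.+1) = h (Q i.+1)) -> forall x, g x = h x.
Proof.
move=> gD hD gZ hZ gM hM g1 h1 e x; elim/pcar_ind: x => [p q IHp IHq|c p IH||i p IH].
- by rewrite gD hD IHp IHq.
- by rewrite gZ hZ IH.
- by rewrite g1 h1.
- by rewrite gM hM e IH.
Qed.

Definition pev (a : FPS) f : rat := (ph (fun i => (a i.+1)%:P) f).[0].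

Lemma pevD a f g : pev a (f + g) = pev a f + pev a g.
Proof. by rewrite /pev phD hornerD. Qed.
Lemma pevZ a c f : pev a (c *: f) = c * pev a f.
Proof. by rewrite /pev phZ hornerZ. Qed.
Lemma pevM a f g : pev a (f * g) = pev a f * pev a g.
Proof. by rewrite /pev phM hornerM. Qed.
Lemma pev1 a : pev a 1 = 1.
Proof. by rewrite /pev ph1 hornerC. Qed.
Lemma pevQ a i : pev a (Q i.+1) = a i.+1.
Proof. by rewrite /pev phQ hornerC. Qed.

Lemma pev_eq f a b : pd 0 f = 0 -> (forall j, (1 < j)%N -> a j = b j) -> pev a f = pev b f.
Proof.
move=> /ppi_id <- eab; apply: (@alg_map_ext rat^o (fun f => pev a (pi f)) (fun f => pev b (pi f)) _ _ _ _ _ _ _ _ _ f) =>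
  [x y|x y|c x|c x|x y|x y|||[|i]]; rewrite ?ppiD ?pevD ?ppiZ ?pevZ ?ppiM ?pevM ?ppi1 ?pev1 //.
  by rewrite ppiQ /= -(scale0r 1) !pevZ !mul0r.
by rewrite ppiQ /= !pevQ eab.
Qed.

(** * Shifting the generating series of the Q_k *)

Section Taylor.
Context (l : ipartition).

(** Coefficient of z^k in [e^(nu z)] times the generating series, as a polynomial in [nu].
    Differentiation in [nu] lowers the index just as [del] does, so the shift by [nu] is the
    exponential of [nu del]. *)
Definition shiftQ k : {poly rat} := \poly_(j < k.+1) (Qs l (k - j)%N / (j`!)%:R).

Lemma shiftQ0 : shiftQ 0 = 1.
Proof.
apply/polyP => -[|i]; rewrite coef_poly coef1 //=.
by rewrite /Qs Qfun0 fact0 divr1.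
Qed.

Lemma deriv_shiftQ k : (shiftQ k.+1)^`() = shiftQ k.
Proof.
apply/polyP => i; rewrite coef_deriv !coef_poly !ltnS subSS.
case: leqP => _; last by rewrite mul0rn.
rewrite factS natrM -[_ *+ i.+1]mulr_natr invfM -!mulrA; congr (_ * _).
have i1 : i.+1%:R != 0 :> rat by rewrite pnatr_eq0.
by rewrite mulrCA mulVf ?mulr1.
Qed.

Lemma horner_shiftQ k nu : (shiftQ k).[nu] = (ex nu * Qs l) k.
Proof.
rewrite (@horner_coef_wide _ k.+1) ?size_poly // fpsM; apply: eq_bigr => i _.
by rewrite coef_poly ltn_ord /ex /fps_exp mulrAC -mulrA mulrC.
Qed.

Definition taylor f := ph (fun i => shiftQ i.+1) f.

Lemma taylor_pev f nu : (taylor f).[nu] = pev (ex nu * Qs l) f.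
Proof.
apply: (@alg_map_ext rat^o (fun f => (taylor f).[nu]) (pev (ex nu * Qs l)) _ _ _ _ _ _ _ _ _ f) =>
  [x y|x y|c x|c x|x y|x y|||i]; rewrite ?pevD ?pevZ ?pevM ?pev1 // /taylor.
- by rewrite phD hornerD.
- by rewrite phZ hornerZ.
- by rewrite phM hornerM.
- by rewrite ph1 hornerC.
- by rewrite phQ pevQ horner_shiftQ.
Qed.

Lemma deriv_taylor f : (taylor f)^`() = taylor (del f).
Proof.
have t0 : taylor 0 = 0 by rewrite -(scale0r 1) /taylor phZ scale0r.
elim/pcar_ind: f => [p q hp hq|c p hp||i p hp].
- by rewrite linearD /= /taylor !phD derivD -!/(taylor _) hp hq.
- by rewrite linearZ /= /taylor !phZ derivZ -!/(taylor _) hp.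
- by rewrite der1 t0 /taylor ph1 -polyC1 derivC.
rewrite derM delQ /taylor phD !phM phQ derivM deriv_shiftQ -!/(taylor _) hp.
congr (_ * _ + _); rewrite /taylor.
by case: i => [|i]; rewrite ?PQ0 ?ph1 ?shiftQ0 ?phQ.
Qed.

Definition pf f := pev (Qs l) f.

Lemma coef_taylor f i : (taylor f)`_i = pf (iter i del f) / (i`!)%:R.
Proof.
elim: i f => [|i IH] f.
  by rewrite fact0 divr1 -horner_coef0 taylor_pev ex0 mul1r.
have i1 : i.+1%:R != 0 :> rat by rewrite pnatr_eq0.
have i2 : (i`!)%:R != 0 :> rat by rewrite pnatr_eq0 -lt0n fact_gt0.
have := IH (del f); rewrite -deriv_taylor coef_deriv -iterSr => h.
apply: (mulIf i1); rewrite mulr_natr h factS natrM invfM -mulrA -mulrA.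
by rewrite [_^-1 * (_ * _)]mulrCA mulVf ?mulr1.
Qed.

Lemma taylor_formula f B nu : (forall n, (B <= n)%N -> iter n del f = 0) ->
  pev (ex nu * Qs l) f = \sum_(i < B) pf (iter i del f) / (i`!)%:R * nu ^+ i.
Proof.
move=> hB; rewrite -taylor_pev (@horner_coef_wide _ B) => [|].
  by apply: eq_bigr => i _; rewrite coef_taylor.
apply/leq_sizeP => j le; rewrite coef_taylor hB // /pf -(scale0r 1) pevZ !mul0r; by [].
Qed.

End Taylor.

(** * The Bloch-Okounkov identity *)

Definition nm f : FPS := num (fun l => pf l f).

(** Expand the toggle identity in powers of the charge minus 1/2. The charges [-s] and [s + 1] have
    the same energy, opposite signs, and opposite values [-(s + 1/2)] and [s + 1/2]: even powers
    cancel, odd powers double. *)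
Lemma theta_identity f K : pd 0 f = 0 -> (forall n, (2 * K <= n)%N -> iter n del f = 0) ->
  \sum_(k < K) ((2 * k).+1`!)%:R^-1 *: (theta (2 * k).+1 * nm (iter (2 * k).+1 del f)) = 0.
Proof.
move=> f0 hK; apply: fpsP => n; pose N := (2 * n + 2)%N.
pose a i m := nm (iter i del f) m.
pose S i := \sum_(s < N) (if ('C(s.+1, 2) <= n)%N then
     (-1) ^+ s * (s%:R + 2%:R^-1) ^+ i * a i (n - 'C(s.+1, 2))%N else 0).
have -> : (\sum_(k < K) ((2 * k).+1`!)%:R^-1 *: (theta (2 * k).+1 * nm (iter (2 * k).+1 del f))) n
   = \sum_(k < K) ((2 * k).+1`!)%:R^-1 * S (2 * k).+1.
  rewrite fps_sum; apply: eq_bigr => k _; rewrite fpsZ (@theta_mul _ _ _ N) //.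
  by rewrite /N; lia.
have := @toggle_identity n (fun b => pev b f) (fun b c => @pev_eq f b c f0).
pose T i k := (-1) ^+ k * (if (tri N k <= n)%N then
   (charge n k - 2%:R^-1) ^+ i * a i (n - tri N k)%N else 0).
have -> : \sum_(k < (2 * N).+1) (-1) ^+ k * (if (tri N k <= n)%N then
     \sum_(l <- partitions (n - tri N k)) pev (ex (charge n k - 2%:R^-1) * Qs l) f else 0)
   = \sum_(i < 2 * K) (i`!)%:R^-1 * \sum_(k < (2 * N).+1) T i k.
  rewrite [RHS](eq_bigr _ (fun i _ => mulr_sumr _ _ _ _)) exchange_big /=.
  apply: eq_bigr => k _; rewrite /T; case: leqP => _; last first.
    by rewrite mulr0 big1 // => i _; rewrite !mulr0.
  rewrite (eq_bigr _ (fun l _ => taylor_formula l _ hK)) exchange_big /= mulr_sumr.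
  apply: eq_bigr => i _; rewrite /a /nm /num !mulr_sumr.
  by apply: eq_bigr => l _; ring.
have TS i : \sum_(k < (2 * N).+1) T i k = ((-1) ^+ i - 1) * S i.
  have -> : ((2 * N).+1 = N.+1 + N)%N by lia.
  (* The index [k = 0] violates the energy bound; the other [2 N] indices are paired as [N - s] and
     [N + 1 + s]. *)
  rewrite big_split_ord /= big_ord_recl {1}/T /= (_ : (tri N 0 <= n)%N = false); last first.
    apply/negbTE; rewrite -ltnNge /tri sub0n subn0 /= binS bin1 /N; lia.
  rewrite mulr0 add0r (reindex_inj rev_ord_inj) /= -big_split /= mulr_sumr.
  apply: eq_bigr => s _; have ls := ltn_ord s.
  have oN : ~~ odd N by rewrite /N oddD oddM.
  have e1 : bump 0 (N - s.+1) = (N - s)%N by rewrite /bump /=; lia.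
  have t1 : tri N (N - s) = 'C(s.+1, 2) by rewrite /tri subKn 1?ltnW // (_ : N - s - N = 0)%N //; lia.
  have t2 : tri N (N.+1 + s) = 'C(s.+1, 2).
    by rewrite /tri addSnnS addKn subnDA subnn sub0n addn0.
  rewrite e1 /T t1 t2; case: ifP => _; last by rewrite !mulr0 addr0.
  have -> : (-1) ^+ (N - s) = (-1) ^+ s :> rat.
    by rewrite -signr_odd oddB 1?ltnW // (negbTE oN) /= signr_odd.
  have -> : (-1) ^+ (N.+1 + s) = - (-1) ^+ s :> rat.
    by rewrite -signr_odd oddD /= oN /= -addTb signr_addb expr1 signr_odd mulN1r.
  have -> : charge n (N - s) - 2%:R^-1 = - (s%:R + 2%:R^-1).
    by rewrite /charge -/N natrB 1?ltnW //; ring.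
  have -> : charge n (N.+1 + s) - 2%:R^-1 = s%:R + 2%:R^-1.
    by rewrite /charge -/N natrD -natr1; field.
  by rewrite [(- (_ + _)) ^+ i]exprNn; ring.
rewrite (sum_odd (G := fun i => (i`!)%:R^-1 * \sum_(k < (2 * N).+1) T i k)) => [h|i oi]; last first.
  by rewrite TS -signr_odd (negbTE oi) subrr mul0r mulr0.
apply: (@mulfI _ (-2%:R)) => //; rewrite fps0 mulr0 -[RHS]h mulr_sumr.
apply: eq_bigr => k _; rewrite TS -signr_odd /= oddM /= expr1; ring.
Qed.

Lemma Pser_sg : Pser = 1 - 24%:R * sg 1. Proof. by []. Qed.

Lemma nmQ2 f : nm (Q 2 * f) = fD (nm f) - 24%:R^-1 *: nm f.
Proof.
rewrite -num_psize -scaleNr -numZ -numD; apply: eq_num => l.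
by rewrite /pf pevM pevQ /Qs Qfun2; ring.
Qed.

Lemma nm1 : nm 1 = pser.
Proof. by apply: eq_num => l; rewrite /pf pev1. Qed.

(** The identity for Q_3 has only two terms, with <Q_2> = -P/24 and <1> = 1. Combined with
    [theta_rec] it gives the logarithmic derivative of [theta 1]. *)
Lemma theta_ode : 4%:R *: theta 3 = Pser * theta 1.
Proof.
have f0 : pd 0 (Q 3) = 0 by rewrite pdQ.
have := @theta_identity (Q 3) 2 f0; rewrite !big_ord_recr big_ord0 /= add0r.
rewrite !delQ PQ0 nm1 -[Q 2]mulr1 nmQ2 nm1 fD_pser => h.
have {h} : (1`!)%:R^-1 *: (theta 1 * (sg 1 * pser - 24%:R^-1 *: pser)) + (3`!)%:R^-1 *: (theta 3 * pser) = 0.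
  apply: h => n le; rewrite -(subnK le) iterD /= !delQ PQ0 der1.
  by elim: (n - 4)%N => //= m ->; rewrite linear0.
pose k : FPS := 24%:R^-1 *: 1.
have k24 : 24%:R * k = 1 by rewrite /k mulr_natl -scaler_nat scalerA mulfV ?scale1r.
have e c (x : FPS) : c *: x = (c *: 1) * x by rewrite -scalerAl mul1r.
have -> : (3`!)%:R^-1 *: (theta 3 * pser) = 4%:R * k * (theta 3 * pser).
  rewrite e; congr (_ * _); rewrite /k mulr_natl -scaler_nat scalerA.
  by congr (_ *: _); apply/eqP; vm_compute.
rewrite (_ : (1`!)%:R^-1 = 1 :> rat) // scale1r [_ *: pser]e -/k => h.
suff : k * pser * (4%:R *: theta 3 - Pser * theta 1) = 0.
  rewrite -mulrA => /(congr1 (fun x : FPS => 24%:R * x)); rewrite mulr0 mulrA k24 mul1r.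
  move/eqP; apply: contraTeq => ne; apply: fps_mul_neq0; first exact: pser_neq0.
  by rewrite subr_eq0.
rewrite -[RHS]h fps_natZ Pser_sg.
have es : theta 1 * (sg 1 * pser) = 24%:R * k * (theta 1 * (sg 1 * pser)) by rewrite k24 mul1r.
by rewrite [theta 1 * (_ - _)]mulrBr es; ring.
Qed.

Definition brk f : FPS := br (fun l => pf l f).

Lemma nm_brk f : nm f = brk f * pser. Proof. exact: num_br. Qed.

Lemma brkD f g : brk (f + g) = brk f + brk g.
Proof. by rewrite -brD; apply: eq_br => l; rewrite /pf pevD. Qed.
Lemma brkZ c f : brk (c *: f) = c *: brk f.
Proof. by rewrite -brZ; apply: eq_br => l; rewrite /pf pevZ. Qed.
Lemma brk_is_linear : linear brk.
Proof. by move=> c f g; rewrite brkD brkZ. Qed.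
HB.instance Definition _ := GRing.isLinear.Build rat R FPS _ brk brk_is_linear.

Lemma brk1 : brk 1 = 1.
Proof. by rewrite -br1; apply: eq_br => l; rewrite /pf pev1. Qed.

Lemma brkQ1 f : brk (Q 1 * f) = 0.
Proof.
have -> : brk (Q 1 * f) = brk (0 *: 1).
  by apply: eq_br => l; rewrite /pf pevM pevQ /Qs Qfun1 pevZ !mul0r.
by rewrite brkZ scale0r.
Qed.

Lemma brk_ppi f : brk (pi f) = brk f.
Proof. by have [g {2}->] := ppi_decomp f; rewrite brkD brkQ1 addr0. Qed.

Lemma fps_pserI (a b : FPS) : a * pser = b * pser -> a = b.
Proof. by move=> h; apply: (fps_mulI pser_neq0); rewrite !(mulrC pser). Qed.

Lemma brkQ2 f : brk (Q 2 * f) = fD (brk f) - 24%:R^-1 *: (Pser * brk f).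
Proof.
apply: fps_pserI; rewrite -nm_brk nmQ2 nm_brk fDM fD_pser Pser_sg.
pose k : FPS := 24%:R^-1 *: 1.
have k24 : 24%:R * k = 1 by rewrite /k mulr_natl -scaler_nat scalerA mulfV ?scale1r.
have e (x : FPS) : 24%:R^-1 *: x = k * x by rewrite -scalerAl mul1r.
have es : brk f * (sg 1 * pser) = 24%:R * k * (brk f * (sg 1 * pser)) by rewrite k24 mul1r.
by rewrite es !e; ring.
Qed.

(** [theta_rec] makes 12 times the next odd theta series equal to [24 D + 3] applied to the current
    one. As [(8 D + 1) theta 1 = P theta 1], pulling out [theta 1] turns [24 D + 3] into
    [24 D + 3 P], the value of [2 DA + 3 P]. *)
Lemma theta_SA k : 12%:R ^+ k *: theta (2 * k).+1 = ev (SA k) * theta 1.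
Proof.
elim: k => [|k IH]; first by rewrite scale1r rmorph1 mul1r.
have t1 : 8%:R * fD (theta 1) + theta 1 = Pser * theta 1.
  rewrite -theta_ode theta_rec scalerDr scalerA mulfV ?scale1r //.
  by rewrite scaler_nat -mulr_natl; congr (_ + _); ring.
rewrite mulnS addnC addn2 theta_rec exprS -scalerA.
have -> : 12%:R ^+ k *: (2%:R * fD (theta (2 * k).+1) + 4%:R^-1 *: theta (2 * k).+1)
  = 2%:R * fD (12%:R ^+ k *: theta (2 * k).+1) + 4%:R^-1 *: (12%:R ^+ k *: theta (2 * k).+1).
  by rewrite scalerDr [fD (_ *: _)]linearZ /= -scalerAr !scalerA [4%:R^-1 * _]mulrC.
rewrite IH scalerDr scalerA (_ : 12%:R * 4%:R^-1 = 3%:R); last by apply/eqP; vm_compute.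
have -> : ev (SA k.+1) = 2%:R * (12%:R * fD (ev (SA k))) + 3%:R * Pser * ev (SA k).
  by rewrite /= rmorphD /= !rmorphM /= !rmorph_nat ev_DA ev_P.
rewrite !fps_natZ fDM [RHS]mulrDl.
have -> : 3%:R * Pser * ev (SA k) * theta 1 = 3%:R * ev (SA k) * (Pser * theta 1) by ring.
rewrite -t1; ring.
Qed.

Definition cf k : rat := (12%:R ^+ k * ((2 * k).+1`!)%:R)^-1.

Lemma cf0 : cf 0 = 1. Proof. by apply/eqP; vm_compute. Qed.
Lemma ev_SA0 : ev (SA 0) = 1. Proof. exact: rmorph1. Qed.

Lemma bracket_identity f K : pd 0 f = 0 -> (forall n, (2 * K <= n)%N -> iter n del f = 0) ->
  \sum_(k < K) cf k *: (ev (SA k) * brk (iter (2 * k).+1 del f)) = 0.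
Proof.
move=> f0 hK; have := theta_identity f0 hK.
have -> : \sum_(k < K) ((2 * k).+1`!)%:R^-1 *: (theta (2 * k).+1 * nm (iter (2 * k).+1 del f))
  = theta 1 * (pser * \sum_(k < K) cf k *: (ev (SA k) * brk (iter (2 * k).+1 del f))).
  rewrite !mulr_sumr; apply: eq_bigr => k _; rewrite nm_brk.
  have -> : theta (2 * k).+1 = (12%:R ^+ k)^-1 *: (ev (SA k) * theta 1).
    by rewrite -theta_SA scalerA mulVf ?scale1r // expf_neq0.
  rewrite -!scalerAl -!scalerAr scalerA /cf invfM [_^-1 * _]mulrC; congr (_ *: _); ring.
move=> h; apply: (fps_mulI pser_neq0); apply: (fps_mulI theta1_neq0).
by rewrite h !mulr0.
Qed.

(** * The bracket as a polynomial in P, Q, R *)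

Definition polyA f := exists a : Af, ev a = brk f /\ 12%:R * ev a^`() = brk (opDelta f).

Lemma polyAD f g : polyA f -> polyA g -> polyA (f + g).
Proof.
move=> [a [ea da]] [b [eb db]]; exists (a + b).
by rewrite derivD !rmorphD /= mulrDr ea eb da db !linearD.
Qed.

Lemma brk_Delta_ppi f : brk (opDelta (pi f)) = brk (opDelta f).
Proof. by rewrite -brk_ppi ppi_Delta brk_ppi. Qed.

(** Compares consecutive constants with the factor produced by [deriv_SA]; the half reflects the 2
    in [opD = 2 opDelta + del^2]. *)
Lemma cfS k : 12%:R * cf k.+1 * (k.+1 * (2 * k.+1).+1)%:R = 2%:R^-1 * cf k.
Proof.
rewrite /cf mulnS !factS !natrM exprS -!natr1 natrM.
have h1 : 12%:R ^+ k != 0 :> rat by rewrite expf_neq0.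
have h2 : ((2 * k)`!)%:R != 0 :> rat by rewrite pnatr_eq0 -lt0n fact_gt0.
have h3 : (2%:R * k%:R + 1) != 0 :> rat by rewrite -natrM natr1 pnatr_eq0.
have h4 : (2%:R * k%:R + 1 + 1) != 0 :> rat by rewrite -natrM !natr1 pnatr_eq0.
have h5 : (2%:R * k%:R + 1 + 1 + 1) != 0 :> rat by rewrite -natrM !natr1 pnatr_eq0.
by field; rewrite h1 h2 h3 h4 h5.
Qed.

(** Lift [f] to [g] with [del g = f] modulo Q_1. The identity for [g] expresses <f> through brackets
    of smaller weight and so defines [a]. The odd [del]-iterates of [opD g] are
    [2 opDelta (G k) + G (k+1)], and the identity for [opD g] becomes the formula for 24 da/dP. *)
Lemma bracket_polyA w f : pd 0 f = 0 -> E f = w%:R * f -> polyA f.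
Proof.
elim/ltn_ind: w f => w IH f f0 Ef.
apply: (Lambda_hom_ind polyAD _ f0 Ef) => {f0 Ef}f l ef.
case: (ef) => f0 Ef _ [l0|[c ->]]; last first.
  exists (c%:P%:P%:P); rewrite ev_c derivC rmorph0 mulr0 Delta1 linear0.
  by rewrite linearZ /= brk1.
have [g [g0 Eg dg]] := lower_surj ef l0.
pose K := w.+2; pose G k := iter (2 * k).+1 del g.
have nilp n : (2 * K <= n)%N -> iter n del g = 0.
  by move=> le; apply: (del_hom_nilp Eg); rewrite /K in le; lia.
have aG k : exists a : Af, (0 < k)%N -> ev a = brk (G k) /\ 12%:R * ev a^`() = brk (opDelta (G k)).
  case: k => [|k]; first by exists 0.
  case: (ltnP w (2 * k.+1)) => le.
    exists 0 => _; rewrite deriv0 !rmorph0 mulr0 /G (del_hom_nilp Eg) ?linear0 //.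
  have [|||a] := IH (w - 2 * k.+1)%N _ (pi (G k.+1)).
  - by lia.
  - exact: pd0_ppi.
  - rewrite E_ppi (E_iter_del _ Eg) ppiM -natrB; last by lia.
    by rewrite ppi_nat; congr (_%:R * _); lia.
  by rewrite brk_ppi brk_Delta_ppi => h; exists a.
have [a ha] := boolp.choice aG.
have bf : brk f = brk (G 0%N) by rewrite -dg -lower_ppi_del // brk_ppi.
have bDf : brk (opDelta f) = brk (opDelta (G 0%N)) by rewrite -dg -lower_ppi_del // brk_Delta_ppi.
have M1 := bracket_identity g0 nilp.
have nilp2 n : (2 * K <= n)%N -> iter n del (opD g) = 0.
  move=> le; have -> : iter n del (opD g) = opD (iter n del g).
    by elim: n {le} => //= n ->; rewrite scrD_del.
  by rewrite nilp // linear0.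
have M2 := bracket_identity (pd0_scrD g0) nilp2.
exists (- \sum_(k < w.+1) (cf k.+1)%:P%:P%:P * (SA k.+1 * a k.+1)).
rewrite bf bDf; split.
  rewrite rmorphN rmorph_sum; apply/eqP; rewrite eq_sym -addr_eq0; apply/eqP.
  rewrite -[RHS]M1 (sum_recl _ (fun k => cf k *: (ev (SA k) * brk (G k)))).
  rewrite cf0 scale1r ev_SA0 mul1r.
  congr (_ + _); apply: eq_bigr => k _; have [e1 _] := ha k.+1 isT.
  by rewrite rmorphM [ev (SA _ * _)]rmorphM ev_c -scalerAl mul1r e1.
have sD k : iter (2 * k).+1 del (opD g) = 2%:R * opDelta (G k) + G k.+1.
  have cD (d : R -> R) : (forall x, d (del x) = del (d x)) -> d (G k) = iter (2 * k).+1 del (d g).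
    by move=> h; rewrite /G; elim: (_.+1) => //= n IHn; rewrite h IHn.
  by have <- := cD (@opD R) (@scrD_del R); rewrite DeltaE /G mulnS.
have GK : G w.+2 = 0 by rewrite /G nilp //; lia.
have brk2 x : brk (2%:R * x) = 2%:R * brk x by rewrite -natrZ linearZ /= scaler_nat mulr_natl.
have {M2} : 2%:R * brk (opDelta (G 0%N)) + \sum_(k < w.+1) cf k.+1 *: (2%:R * (ev (SA k.+1) * brk (opDelta (G k.+1))) )
    + \sum_(k < w.+1) cf k *: (ev (SA k) * brk (G k.+1)) = 0.
  rewrite -[RHS]M2; under [RHS]eq_bigr => k _ do rewrite sD brkD brk2 mulrDr scalerDr.
  rewrite big_split /=; congr (_ + _).
    rewrite (sum_recl _ (fun k => cf k *: (ev (SA k) * (2%:R * brk (opDelta (G k)))))).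
    rewrite cf0 scale1r ev_SA0 mul1r; congr (_ + _).
    by apply: eq_bigr => k _; rewrite mulrCA.
  by rewrite [RHS]big_ord_recr /= GK linear0 mulr0 scaler0 addr0.
move=> M2.
have inj2 (x y : FPS) : 2%:R * x = 2%:R * y -> x = y.
  rewrite !mulr_natl -!scaler_nat => /(congr1 (fun z : FPS => 2%:R^-1 *: z)).
  by rewrite !scalerA mulVf ?scale1r.
apply: inj2; apply/eqP; rewrite eq_sym -subr_eq0; apply/eqP; rewrite -[RHS]M2 -addrA; congr (_ + _).
have -> : 2%:R * (12%:R * ev (- \sum_(k < w.+1) (cf k.+1)%:P%:P%:P * (SA k.+1 * a k.+1))^`())
  = - \sum_(k < w.+1) 2%:R * (12%:R * ev ((cf k.+1)%:P%:P%:P * (SA k.+1 * a k.+1))^`()).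
  by rewrite linearN /= linear_sum /= rmorphN rmorph_sum !mulrN !mulr_sumr.
rewrite opprK -big_split; apply: eq_bigr => k _; have [e1 e2] := ha k.+1 isT.
rewrite derivM derivC mul0r add0r derivM deriv_SA [k.+1.-1]/= rmorphM rmorphD.
rewrite rmorphM [ev (_ * _^`())]rmorphM rmorphM rmorph_nat ev_c e1.
rewrite [RHS]addrC [cf k.+1 *: (_ * _)]fps_scaleE [cf k *: _]fps_scaleE -e2.
have <- : 2%:R * (12%:R * (cf k.+1 *: 1 * (k.+1 * (2 * k.+1).+1)%:R)) = cf k *: 1 :> FPS.
  rewrite -!fps_natZ [_ * (_ * _)%:R]mulrC -fps_natZ !scalerA; congr (_ *: _).
  have -> : cf k = 2%:R * (2%:R^-1 * cf k) by rewrite mulrA mulfV ?mul1r.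
  by rewrite -cfS; ring.
by ring.
Qed.

Local Notation L := (fun x => pi (opDelta x)).
Local Notation U := (fun x => Q 2 * x).

Lemma polyA_Lambda f : pd 0 f = 0 -> polyA f.
Proof.
move=> f0; have [m [F [ef hF]]] := graded succn f.
have F0 i : (i < m)%N -> pd 0 (F i) = 0.
  apply: (@graded_stable R succn (fun y => pd 0 y = 0)) => //; rewrite -?ef //.
  - by move=> x y x0 y0; rewrite linearD /= x0 y0 addr0.
  - by move=> a x x0; rewrite linearZ /= x0 scaler0.
  - exact: pd0_E.
have A0 : polyA 0.
  by exists 0; rewrite deriv0 !rmorph0 mulr0 !linear0.
rewrite ef; elim/big_ind: _ => // [x y|i _]; first exact: polyAD.
exact: (bracket_polyA (F0 i (ltn_ord i)) (hF i)).
Qed.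

Lemma bracket_evB f : pd 0 f = 0 ->
  (exists g : Bf, brk f = evB g) <-> brk (opDelta f) = 0.
Proof.
move=> f0; have [a [ea da]] := polyA_Lambda f0; rewrite -ea -da.
split=> [[g eg]|].
  have -> : a = g%:P.
    by apply/eqP; rewrite -subr_eq0; apply/eqP/ev_inj; rewrite rmorphB ev_C /= eg subrr.
  by rewrite derivC rmorph0 mulr0.
rewrite -fps_natZ => /eqP; rewrite scaler_eq0 pnatr_eq0 /= => /eqP/ev_inj a'0.
exists a`_0; rewrite -ev_C; congr (ev _); apply/polyP => -[|i]; rewrite coefC //=.
have := congr1 (fun b : Af => b`_i) a'0; rewrite /= coef_deriv coef0 => /eqP.
by rewrite -mulr_natl mulf_eq0 -!polyC_natr !polyC_eq0 pnatr_eq0 => /eqP.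
Qed.

(** * The kernel of the bracket *)

Definition null x := pd 0 x = 0 /\ brk x = 0.

Lemma null0 : null 0.
Proof. by split; rewrite ?linear0 // -(scale0r 1) brkZ scale0r. Qed.
Lemma nullD x y : null x -> null y -> null (x + y).
Proof. by move=> [x0 bx] [y0 hy]; split; rewrite ?linearD /= ?x0 ?y0 ?brkD ?bx ?hy ?addr0. Qed.
Lemma nullZ c x : null x -> null (c *: x).
Proof. by move=> [x0 bx]; split; rewrite ?linearZ /= ?x0 ?brkZ ?bx ?scaler0. Qed.

Lemma pd0_Q2 x : pd 0 x = 0 -> pd 0 (Q 2 * x) = 0.
Proof. by move=> x0; rewrite pdM pdQ x0 mul0r mulr0 addr0. Qed.

Lemma null_Q2 x : null x -> null (Q 2 * x).
Proof.
move=> [x0 bx]; split; first exact: pd0_Q2.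
by rewrite brkQ2 bx linear0 mulr0 scaler0 subr0.
Qed.

(** Zero is the value of a polynomial in Q and R, so [bracket_evB] applies; stability of the kernel
    thus rests on algebraic independence. *)
Lemma null_Delta x : null x -> null (L x).
Proof.
move=> [x0 bx]; split; first exact: pd0_ppi.
rewrite brk_ppi; apply/(bracket_evB x0); exists 0.
by rewrite bx rmorph0.
Qed.

Lemma Delta_Q2_comm x : pd 0 x = 0 -> L (Q 2 * x) = Q 2 * L x + (E x - 2%:R^-1 *: x).
Proof.
move=> x0; apply: two_inj.
rewrite mulrDr mulrBr -[2%:R * (2%:R^-1 *: x)]natrZ scalerA mulfV ?scale1r //.
have p2 y : pi (2%:R * y) = 2%:R * pi y by rewrite ppiM ppi_nat.
rewrite -p2 Delta_Q2 ppiD [pi (_ - _)]linearB /= [pi (_ - _)]linearB /= !p2 !ppiM !ppiQ /= mul0r mulr0 subr0.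
by rewrite -E_ppi !(ppi_id x0); ring.
Qed.

(** The weight is recovered from the commutator of two operators that preserve the kernel, so the
    kernel is graded. *)
Lemma null_E x : null x -> null (E x).
Proof.
move=> nx; have x0 := proj1 nx.
have -> : E x = L (Q 2 * x) + (-1) *: (Q 2 * L x) + 2%:R^-1 *: x.
  by rewrite Delta_Q2_comm // scaleN1r; ring.
apply: nullD; last exact: nullZ.
apply: nullD; first exact/null_Delta/null_Q2.
exact/nullZ/null_Q2/null_Delta.
Qed.

Lemma E_L w x : E x = w *: x -> E (L x) = (w - 2%:R) *: L x.
Proof.
move=> Ex; rewrite E_ppi E_Delta Ex linearZ /= linearB /= linearZ /= scalerBl; congr (_ - _).
by rewrite ppiM ppi_nat natrZ.
Qed.

Lemma null_lift_hom w x : null x -> E x = w%:R * x -> exists2 k, null k & L k = x.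
Proof.
move=> nx Ex.
have Ew : E x = w%:R *: x by rewrite natrZ.
have LN n : E (iter n L x) = (w%:R - 2%:R * n%:R) *: iter n L x.
  elim: n => [|n IH]; first by rewrite mulr0 subr0.
  by rewrite iterS (E_L IH); congr (_ *: _); rewrite -natr1; ring.
have L0 : iter w.+1 L x = 0.
  apply: (euler_eq0 (LN w.+1)) => n; rewrite eq_sym subr_eq -natrM -natrD eqr_nat.
  by apply/eqP; lia.
apply: (@sl2_lowering_surj R L U (fun x => E x - 2%:R^-1 *: x) (fun x => pd 0 x = 0)
   _ _ _ _ _ _ _ null (w%:R - 2%:R^-1) x w.+1) => //.
- by move=> c a b; rewrite !linearP.
- by move=> c a b; rewrite mulrDr scalerAr.
- by move=> a _; exact: pd0_ppi.
- exact: pd0_Q2.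
- exact: Delta_Q2_comm.
- move=> a y y0 Hy; have Ey : E y = (a + 2%:R^-1) *: y by rewrite scalerDl -Hy subrK.
  rewrite derM ER Ey -natrZ -scalerAr -scalerAl -scalerDl -scalerBl; congr (_ *: _).
  by rewrite addrAC [2%:R + _]addrC; ring.
- move=> a y y0 Hy; have Ey : E y = (a + 2%:R^-1) *: y by rewrite scalerDl -Hy subrK.
  by rewrite (E_L Ey) -scalerBl; congr (_ *: _); ring.
- exact: null0.
- exact: nullD.
- exact: nullZ.
- move=> j; apply: iter_stable; first exact: null_Q2.
  apply: iter_stable => //; exact: null_Delta.
- by case: nx.
- by rewrite Ew scalerBl.
(* Doubling [w - 1/2 = j] would make an even number equal to an odd one. *)
- move=> j _; rewrite subr_eq; apply/eqP => h.
  have := congr1 (fun z : rat => 2%:R * z) h; rewrite mulrDr mulfV // -natrM -[1]/(1%:R) -natrM -natrD => /eqP.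
  by rewrite eqr_nat; lia.
Qed.

Lemma null_lift x : null x -> exists2 k, null k & L k = x.
Proof.
move=> nx; have [m [F [ef hF]]] := graded succn x.
have nF i : (i < m)%N -> null (F i).
  apply: (@graded_stable R succn null nullD nullZ null_E) => //; by rewrite -ef.
rewrite ef; elim/big_ind: _ => [|_ _ [k nk <-] [k' nk' <-]|i _].
- by exists 0; [exact: null0 | rewrite !linear0].
- by exists (k + k'); [exact: nullD | rewrite !linearD].
exact: (null_lift_hom (nF i (ltn_ord i)) (hF i)).
Qed.

Theorem modular_iff_harmonic f : pd 0 f = 0 ->
  (exists g : Bf, brk f = evB g) <->
  exists h k, [/\ f = h + k, pd 0 h = 0 /\ exists g, opDelta h = Q 1 * g, pd 0 k = 0 & brk k = 0].
Proof.
move=> f0; split=> [/(bracket_evB f0) bf|[h [k [-> [h0 [g hg]] k0 bk]]]].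
  have nf : null (L f) by split; [exact: pd0_ppi | rewrite brk_ppi].
  have [k [k0 bk] Lk] := null_lift nf; exists (f - k), k; split=> //; first by rewrite subrK.
  split; first by rewrite linearB /= f0 k0 subrr.
  by apply/ppi_Delta_eq0; rewrite !linearB /= Lk subrr.
have [g' eg'] : exists g : Bf, brk h = evB g by apply/(bracket_evB h0); rewrite hg brkQ1.
by exists g'; rewrite brkD bk addr0.
Qed.

End Bracket.

(** * The theorem *)

Definition Rpoly_ops : polyops :=
  @PolyOps Rpoly Qvar pderiv nvars pi0 (erefl _) pderivD pderivZ pderivM pderivQ
    (fun p i => @pderiv_nvars i p) Rpoly_ind pi0D pi0Z pi0M pi0_1 pi0Q.

Definition psubst (y : nat -> {poly rat}) : Rpoly_ops -> {poly rat} := subst (@polyC rat) y.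

Lemma psubstD y p q : psubst y (p + q) = psubst y p + psubst y q.
Proof. exact: substD. Qed.
Lemma psubstZ y c p : psubst y (c *: p) = c *: psubst y p.
Proof. by rewrite -mul_polyC; exact: substZ. Qed.
Lemma psubstM y p q : psubst y (p * q) = psubst y p * psubst y q.
Proof. exact: substM. Qed.
Lemma psubst1 y : psubst y 1 = 1.
Proof. exact: subst1. Qed.
Lemma psubstQ y i : psubst y (PQ Rpoly_ops i.+1) = y i.
Proof. exact: substQ. Qed.

Lemma pfun_pf (p : Rpoly) l : pfun p l = pf psubst l p.
Proof.
pose ev1 (p : Rpoly_ops) : rat^o := subst idfun (fun i => Qfun i.+1 (evseq_of_partition l)) p.
apply: (@alg_map_ext Rpoly_ops rat^o ev1 (pf psubst l)) => [x y|x y|c x|c x|x y|x y|||i].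
- exact: substD.
- exact: (pevD psubstD).
- exact: substZ.
- exact: (pevZ psubstZ).
- exact: substM.
- exact: (pevM psubstM).
- exact: subst1.
- exact: (pev1 psubst1).
- by rewrite /pf (pevQ psubstQ) /ev1; exact: substQ.
Qed.

Lemma Delta_ops (p : Rpoly) : Delta p = @opDelta Rpoly_ops p.
Proof. by []. Qed.

Lemma qbracket_brk (p : Rpoly) : (qbracket (pfun p) : FPS) = brk psubst p.
Proof. by apply: eq_br => l; exact: pfun_pf. Qed.

Lemma modular_evB (u : FPS) : modular u <-> exists g : Bf, u = evB g.
Proof.
pose mono (N : nat) (c : nat -> nat -> rat) : Bf :=
  \sum_(i < N) \sum_(j < N) (c i j)%:P%:P * (vQ ^+ i * vR ^+ j).
have monoE N c : evB (mono N c) =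
    (fun n => \sum_(i < N) \sum_(j < N) c i j * fps_mul (fps_pow E4 i) (fps_pow E6 j) n) :> FPS.
  apply: fpsP => n; rewrite rmorph_sum fps_sum; apply: eq_bigr => i _.
  rewrite rmorph_sum fps_sum; apply: eq_bigr => j _.
  rewrite rmorphM evB_c -scalerAl mul1r fpsZ rmorphM !rmorphXn evB_Q evB_R.
  by rewrite QserE RserE -!fps_powE.
split=> [[N [c hc]]|[g ->]].
  pose c' i j := if (insub i, insub j) is (Some i', Some j') then c i' j' else 0.
  exists (mono N c'); rewrite monoE; apply: fpsP => n; rewrite hc.
  by apply: eq_bigr => i _; apply: eq_bigr => j _; rewrite /c' !valK.
(* Exceeds the degree in R and the degrees in Q of all coefficients. *)
pose N := (size g + \max_(j < size g) size (g`_j)%R)%N.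
suff -> : g = mono N (fun i j => (g`_j)`_i).
  by exists N, (\matrix_(i, j) (g`_j)`_i) => n; rewrite monoE; apply: eq_bigr => i _;
    apply: eq_bigr => j _; rewrite mxE.
have inner j : g`_j = \sum_(i < N) (g`_j)`_i *: 'X^i.
  rewrite -poly_def; apply/polyP => i; rewrite coef_poly; case: ltnP => // le.
  rewrite nth_default //; apply: leq_trans le; case: (ltnP j (size g)) => hj.
    by rewrite /N (leq_trans _ (leq_addl _ _)) // (leq_bigmax (Ordinal hj)).
  by rewrite [g`_j]nth_default // size_poly0.
have outer : g = \sum_(j < N) (g`_j)%:P * vR ^+ j.
  transitivity (\poly_(j < N) g`_j); last by rewrite poly_def; apply: eq_bigr => j _; rewrite mul_polyC.
  apply/polyP => j; rewrite coef_poly; case: ltnP => // le.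
  by rewrite nth_default // (leq_trans (leq_addr _ _) le).
rewrite {1}outer /mono exchange_big; apply: eq_bigr => j _.
rewrite {1}inner rmorph_sum mulr_suml; apply: eq_bigr => i _.
by rewrite /= -mul_polyC polyCM polyC_exp mulrA.
Qed.

Theorem theorem1p2 (f : Rpoly) (hf : in_Lambda_star f) :
  modular (qbracket (pfun f)) <->
  exists h k : Rpoly,
    [/\ f = h + k, harmonic h, in_Lambda_star k
      & qbracket (pfun k) =1 (fun=> 0)].
Proof.
have f0 : @pd Rpoly_ops 0 f = 0 by apply/in_Lambda_starE.
have main := modular_iff_harmonic psubstD psubstZ psubstM psubst1 psubstQ f0.
rewrite -qbracket_brk in main; split.
  move=> /modular_evB /main[h [k [e [h0 [g hg]] k0 bk]]]; exists h, k; split=> //.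
  - split; first exact: (proj2 (in_Lambda_starE h) h0).
    by exists g; rewrite Delta_ops; exact: hg.
  - exact: (proj2 (in_Lambda_starE k) k0).
  - by move=> n; rewrite -[qbracket _]/(qbracket (pfun k) : FPS) qbracket_brk bk.
case=> [h [k [e [/in_Lambda_starE h0 [g hg]] /in_Lambda_starE k0 bk]]].
rewrite Delta_ops in hg.
have bk0 : brk psubst k = 0 by rewrite -qbracket_brk; apply: fpsP => n; exact: bk.
apply/modular_evB/(proj2 main); exists h, k.
exact: (And4 e (conj h0 (ex_intro _ g hg)) k0 bk0).
Qed.
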